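(* Let $\mathsf{E}^c_t=\varphi(\mathcal{E}^c_t)$ be the dendriform image of the series $\mathcal{E}^c_t$ of connected flows on rooted trees. Then $$\mathsf{E}^c_t=\frac{1}{1-t}\,Y+\Big(\frac{t}{1-t}+b\Big)\,1\vee\mathbf{N}_t\mathbf{T}\mathbf{P}-\Big(\frac{t}{1-t}+b\Big)\,\mathbf{N}\mathbf{T}\mathbf{P}_t\vee1-t\Big(\frac{t}{1-t}+b\Big)\,\mathbf{N}\mathbf{T}\mathbf{P}_t\vee\mathbf{N}_t\mathbf{T}\mathbf{P},$$ where the noncommutative series $\mathbf{N}_t\mathbf{T}\mathbf{P}$ and $\mathbf{N}\mathbf{T}\mathbf{P}_t$ are interpreted as series of planar binary trees through the full canopy.
   Context: All series have coefficients in $\mathbb{Q}[b][[t]]$; $\frac1{1-t}$ is expanded in powers of $t$. **Flows.** A rooted tree $T$ is a finite tree with a distinguished vertex (the root), edges oriented towards the root; $w\to v$ means that $w$ is a child of $v$. A flow on $T$ of size $k$ is a set $O$ of $k$ vertices (outputs) and a function $m:V(T)\to\mathbb{N}$ vanishing on $O$ such that the rates determined by $r(v)=m(v)-[v\in O]+\sum_{w\to v}r(w)$ are all $\ge 0$. Here $r(v)$ is the rate of the edge going out of $v$; the exit rate is $r(\mathrm{root})$. A flow is connected if every edge has strictly positive rate, i.e. $r(v)\ge1$ for every non-root vertex $v$. Let $\mathcal{E}_{T,t}=\sum b^{\text{size}}t^{\text{exit rate}}$ over all flows on $T$, and $\mathcal{E}^c_{T,t}$ the same sum over connected flows. Put $\mathcal{E}^c_t=\sum_T\mathcal{E}^c_{T,t}\,T/\mathrm{aut}(T)$,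 sum over isomorphism classes of rooted trees, $\mathrm{aut}(T)$ being the number of automorphisms. Let $\mathbf{ca}_{n,t}=\mathcal{E}_{\mathrm{Lnr}_n,t}$, where $\mathrm{Lnr}_n$ is the linear rooted tree (chain) with $n$ vertices, and $\mathbf{ca}_n=\mathbf{ca}_{n,t}|_{t=0}$. **Pre-Lie and dendriform algebras.** The free pre-Lie algebra on one generator $\bullet$ (the one-vertex tree) has basis the rooted trees, with $S\curvearrowleft T$ the sum over vertices $v$ of $S$ of the tree obtained by grafting the root of $T$ on $v$. A planar binary tree is either the trivial tree $1=|$ or $x\vee y$, obtained by gluing planar binary trees $x$ (left) and $y$ (right) on a new root vertex. The free dendriform algebra $\mathrm{Dend}$ on one generator has basis the planar binary trees with $n\ge1$ inner vertices, generator $Y=1\vee1$, and products $\prec,\succ$, $x*y=x\prec y+x\succ y$, determined bilinearly by $(x\vee y)\prec z=x\vee(y*z)$, $z\succ(x\vee y)=(z*x)\vee y$, $1$ being a unit for $*$. The operation $\vee$ is extended bilinearly to series. $\varphi$ is the unique morphism of pre-Lie algebras with $\varphi(\bullet)=Y$, for the pre-Lie product $x\curvearrowleft y:=y\succ x-x\prec y$ on $\mathrm{Dend}$, extended to formal series. **Full canopy and word series.** The canopy of a planar binary tree with $n$ inner vertices is the word of length $n-1$ in letters $\mathtt{p},\mathtt{m}$ (written $+,-$ in the paper) with one letter for each leaf except the leftmost and the rightmost, from left to right: $\mathtt{m}$ if the leaf is a left child, $\mathtt{p}$ if it is a right child. The full canopy is $\mathtt{m}\cdot\text{canopy}\cdot\mathtt{p}$.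 A noncommutative series all of whose words start with $\mathtt{m}$ and end with $\mathtt{p}$ is interpreted as the series of planar binary trees in which the coefficient of a tree is the coefficient of its full canopy. Let $\mathbf{P}_t=\sum_{k\ge1}\mathbf{ca}_{k,t}\mathtt{p}^k$, $\mathbf{N}_t=\sum_{k\ge1}(-1)^k\mathbf{ca}_{k,t}\mathtt{m}^k$, $\mathbf{P}=\mathbf{P}_0$, $\mathbf{N}=\mathbf{N}_0$, $\mathbf{T}=\sum_{k\ge0}b^k(\mathbf{P}\mathbf{N})^k$. *)

(* Defs.v *)
From HB Require Import structures.
From mathcomp Require Import all_boot all_order all_algebra.
From mathcomp Require Import finmap.
From mathcomp Require Import boolp classical_sets functions cardinality fsbigop.
From mathcomp Require Import monalg.

Set Implicit Arguments.
Unset Strict Implicit.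
Unset Printing Implicit Defensive.

Import GRing.Theory.

Local Open Scope quotient_scope.
Local Open Scope ring_scope.

(** * Formal power series in one variable *)

Record fps (R : Type) := Fps { fps_coef : nat -> R }.

HB.instance Definition _ R := gen_eqMixin (fps R).
HB.instance Definition _ R := gen_choiceMixin (fps R).

Lemma fpsP R (f g : fps R) : fps_coef f =1 fps_coef g -> f = g.
Proof. by case: f g => [f] [g] /= /funext ->. Qed.

Section FpsRing.
Variable R : comNzRingType.
Implicit Types f g h : fps R.

Definition fps0 : fps R := Fps (fun=> 0).
Definition fps_opp f := Fps (fun n => - fps_coef f n).
Definition fps_add f g := Fps (fun n => fps_coef f n + fps_coef g n).
Definition fpsC (c : R) := Fps (fun n => if n == 0%N then c else 0).
Definition fps_mul f g :=
  Fps (fun n => \sum_(i < n.+1) fps_coef f i * fps_coef g (n - i)).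

Lemma fps_addA : associative fps_add.
Proof. by move=> f g h; apply: fpsP => n /=; rewrite addrA. Qed.
Lemma fps_addC : commutative fps_add.
Proof. by move=> f g; apply: fpsP => n /=; rewrite addrC. Qed.
Lemma fps_add0 : left_id fps0 fps_add.
Proof. by move=> f; apply: fpsP => n /=; rewrite add0r. Qed.
Lemma fps_addN : left_inverse fps0 fps_opp fps_add.
Proof. by move=> f; apply: fpsP => n /=; rewrite addNr. Qed.

HB.instance Definition _ := GRing.isZmodule.Build (fps R)
  fps_addA fps_addC fps_add0 fps_addN.

Let tr N f : {poly R} := \poly_(i < N) fps_coef f i.

Let trM N f g n : (n < N)%N -> fps_coef (fps_mul f g) n = (tr N f * tr N g)`_n.
Proof.
move=> nN; rewrite coefM; apply: eq_bigr => i _; rewrite !coef_poly.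
by rewrite !ifT ?(leq_ltn_trans _ nN) ?leq_subr // -ltnS ltn_ord.
Qed.

Let coefM_eq (p p' q q' : {poly R}) n :
    (forall i, (i <= n)%N -> p`_i = p'`_i) ->
    (forall i, (i <= n)%N -> q`_i = q'`_i) -> (p * q)`_n = (p' * q')`_n.
Proof.
move=> pp' qq'; rewrite !coefM; apply: eq_bigr => i _.
by rewrite pp' ?qq' ?leq_subr // -ltnS.
Qed.

Let tr_mul n f g i : (i <= n)%N ->
  (tr n.+1 (fps_mul f g))`_i = (tr n.+1 f * tr n.+1 g)`_i.
Proof. by move=> le_in; rewrite -trM // coef_poly ltnS le_in. Qed.

Lemma fps_mulA : associative fps_mul.
Proof.
move=> f g h; apply: fpsP => n; rewrite !(@trM n.+1) //.
rewrite (coefM_eq (fun=> fun=> erefl) (tr_mul g h)).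
by rewrite [RHS](coefM_eq (tr_mul f g) (fun=> fun=> erefl)) mulrA.
Qed.

Lemma fps_mulC : commutative fps_mul.
Proof. by move=> f g; apply: fpsP => n; rewrite !(@trM n.+1) // mulrC. Qed.

Lemma fps_mul1 : left_id (fpsC 1) fps_mul.
Proof.
move=> f; apply: fpsP => n /=; rewrite big_ord_recl /= subn0 mul1r.
by rewrite big1 ?addr0 // => i _; rewrite mul0r.
Qed.

Lemma fps_mulDl : left_distributive fps_mul fps_add.
Proof.
move=> f g h; apply: fpsP => n /=; rewrite -big_split /=.
by apply: eq_bigr => i _; rewrite mulrDl.
Qed.

Lemma fps_1neq0 : fpsC 1 != 0 :> fps R.
Proof.
by apply/eqP => /(congr1 (@fps_coef R)) /(congr1 (@^~ 0%N)) /=; apply/eqP/oner_neq0.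
Qed.

HB.instance Definition _ := GRing.Zmodule_isComNzRing.Build (fps R)
  fps_mulA fps_mulC fps_mul1 fps_mulDl fps_1neq0.

Definition fpsX : fps R := Fps (fun n => if n == 1%N then 1 else 0).

(** 1 / (1 - t) *)
Definition fps_geom : fps R := Fps (fun=> 1).

Lemma fps_geomP : (1 - fpsX) * fps_geom = 1.
Proof.
have geomE : fps_geom = 1 + fpsX * fps_geom.
  apply: fpsP => -[|n].
    by rewrite /= big_ord_recl big_ord0 /= mul0r !addr0.
  rewrite /= 2!big_ord_recl /= mul0r mulr1 !add0r.
  by rewrite big1 ?addr0 // => i _; rewrite mul0r.
by rewrite mulrBl mul1r {1}geomE addrK.
Qed.

End FpsRing.

(** The coefficient ring Q[b][[t]]. *)
Definition K : comNzRingType := fps {poly rat}.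

Definition ratK (q : rat) : K := fpsC q%:P.
Definition bK : K := fpsC 'X.
Definition tK : K := fpsX {poly rat}.
Definition geomK : K := fps_geom {poly rat}.
Definition at_t0 (f : K) : K := fpsC (fps_coef f 0).

(** * Rooted trees *)

(* Rooted trees are taken as ordered trees up to isomorphism, where an
   isomorphism is a bijection of the vertices respecting root and edges (and
   ignoring the order of the children). *)
Inductive otree := ONode of seq otree.

Definition children (T : otree) := let: ONode ts := T in ts.

Fixpoint otree_enc (T : otree) : GenTree.tree unit :=
  let: ONode ts := T in GenTree.Node 0 (map otree_enc ts).
Fixpoint otree_dec (g : GenTree.tree unit) : otree :=
  if g is GenTree.Node _ gs then ONode (map otree_dec gs) else ONode [::].
Fixpoint otree_encK T : otree_dec (otree_enc T) = T.
Proof.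
case: T => ts /=; congr ONode; elim: ts => //= T ts ->.
by rewrite otree_encK.
Qed.
HB.instance Definition _ := Countable.copy otree (can_type otree_encK).

(* A vertex is given by the path leading to it from the root: [::] is the root,
   and rcons v i is the i-th child of v. *)
Fixpoint verts (T : otree) : seq (seq nat) :=
  let: ONode ts := T in
  [::] :: flatten [seq [seq ip.1 :: p | p <- ip.2]
                  | ip <- zip (iota 0 (size ts)) (map verts ts)].

Definition vertex (T : otree) : finType := seq_sub (verts T).

Lemma root_subproof T : [::] \in verts T.
Proof. by case: T. Qed.

Definition root T : vertex T := SeqSub (root_subproof T).

Definition is_child T (w v : vertex T) : bool :=
  (ssval w != [::]) && (ssval v == take (size (ssval w)).-1 (ssval w)).

Definition is_iso T U (f : {ffun vertex T -> vertex U}) : bool :=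
  [&& injectiveb f, [forall u, u \in codom f], f (root T) == root U
    & [forall w, forall v, is_child (f w) (f v) == is_child w v]].

Definition otree_iso : rel otree :=
  fun T U => [exists f : {ffun vertex T -> vertex U}, is_iso f].

Lemma is_isoP T U (f : {ffun vertex T -> vertex U}) :
  reflect [/\ bijective f, f (root T) = root U
            & forall w v, is_child (f w) (f v) = is_child w v] (is_iso f).
Proof.
apply: (iffP and4P) => [[/injectiveP fI /forallP fS /eqP fr /forallP fc]|].
  split=> // [|w v]; last by have /forallP /(_ v) /eqP := fc w.
  exists (fun u => iinv (fS u)) => [v|u]; last exact: f_iinv.
  by apply: fI; rewrite f_iinv.
move=> [[g fK gK] -> fc]; split=> //.
- by apply/injectiveP; apply: can_inj fK.
- by apply/forallP => u; rewrite -[u]gK codom_f.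
- by apply/forallP => w; apply/forallP => v; rewrite fc.
Qed.

Lemma otree_iso_refl : reflexive otree_iso.
Proof.
move=> T; apply/existsP; exists [ffun v => v]; apply/is_isoP.
split=> [||w v]; rewrite ?ffunE //.
by exists id => v; rewrite ffunE.
Qed.

Lemma otree_iso_imp T U : otree_iso T U -> otree_iso U T.
Proof.
move=> /existsP[f /is_isoP[[g fK gK] fr fc]]; apply/existsP.
exists [ffun u => g u]; apply/is_isoP; split.
- by exists f => v; rewrite ffunE.
- by rewrite ffunE -fr fK.
- by move=> w v; rewrite !ffunE -fc !gK.
Qed.

Lemma otree_iso_sym : symmetric otree_iso.
Proof. by move=> T U; apply/idP/idP; apply: otree_iso_imp. Qed.

Lemma otree_iso_trans : transitive otree_iso.
Proof.
move=> U T W /existsP[f /is_isoP[fB fr fc]] /existsP[g /is_isoP[gB gr gc]].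
apply/existsP; exists [ffun v => g (f v)]; apply/is_isoP; split.
- by apply: (eq_bij (bij_comp gB fB)) => v; rewrite ffunE.
- by rewrite ffunE fr.
- by move=> w v; rewrite !ffunE gc fc.
Qed.

Canonical otree_iso_equiv :=
  EquivRel otree_iso otree_iso_refl otree_iso_sym otree_iso_trans.

Definition rtree := {eq_quot otree_iso}.
HB.instance Definition _ := Choice.on rtree.
HB.instance Definition _ := EqQuotient.on rtree.

Definition aut (T : otree) : nat :=
  #|[set f : {ffun vertex T -> vertex T} | is_iso f]|.

(** Lnr_n, for n >= 1. *)
Definition Lnr (n : nat) : otree :=
  iter n.-1 (fun T => ONode [:: T]) (ONode [::]).

Definition bullet : rtree := \pi_rtree (ONode [::]).

(** * Flows *)

(* A flow, i.e. its set of outputs and its function m, is recorded together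
   with its rates r, which are determined by them. Taking r in nat encodes r >= 0, and the defining equation of the
   rates is written without subtraction. *)
Definition flow_data (T : otree) : choiceType :=
  ({set vertex T} * {ffun vertex T -> nat} * {ffun vertex T -> nat})%type.

Definition is_flow T (F : flow_data T) : bool :=
  let: (outs, m, r) := F in
  [forall v, (v \in outs) ==> (m v == 0%N)] &&
  [forall v, (r v + (v \in outs) == m v + \sum_(w | is_child w v) r w)%N].

Definition flow_size T (F : flow_data T) : nat := #|F.1.1|.

Definition flow_weight T (F : flow_data T) : {poly rat} := 'X^(flow_size F).

Definition exit_rate T (F : flow_data T) : nat := F.2 (root T).

Definition is_connected T (F : flow_data T) : bool :=
  [forall v, (v != root T) ==> (1 <= F.2 v)%N].

(* There are finitely many flows with a given exit rate e, since the values of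
   m sum to e plus the number of outputs. *)
Definition flow_series (T : otree) : K :=
  Fps (fun e => \sum_(F \in [set F : flow_data T
                 | is_flow F /\ exit_rate F = e]%classic) flow_weight F).

Definition cflow_series (T : otree) : K :=
  Fps (fun e => \sum_(F \in [set F : flow_data T
                 | [/\ is_flow F, is_connected F & exit_rate F = e]]%classic)
                 flow_weight F).

(* A formal series of rooted trees is given by its coefficients. *)
Definition connected_flows (T : rtree) : K :=
  ratK (aut (repr T))%:R^-1 * cflow_series (repr T).

Definition ca_t (n : nat) : K := flow_series (Lnr n).

(** * Free modules with a product given on a basis *)

Definition bilin (R : comNzRingType) (A B C : choiceType)
    (f : A -> B -> {malg R[C]}) (x : {malg R[A]}) (y : {malg R[B]}) :
    {malg R[C]} :=
  \sum_(a <- msupp x) \sum_(b <- msupp y) (x@_a * y@_b) *: f a b.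

(** * The free pre-Lie algebra on one generator *)

Fixpoint graft (S : otree) (p : seq nat) (T : otree) {struct p} : otree :=
  if p is i :: p' then
    ONode (set_nth (ONode [::]) (children S) i
             (graft (nth (ONode [::]) (children S) i) p' T))
  else ONode (T :: children S).

Section PreLie.
Variable R : comNzRingType.

Definition graft_sum (S T : rtree) : {malg R[rtree]} :=
  \sum_(v : vertex (repr S)) << \pi_rtree (graft (repr S) (ssval v) (repr T)) >>.

Definition pl_mul : {malg R[rtree]} -> {malg R[rtree]} -> {malg R[rtree]} :=
  bilin graft_sum.

End PreLie.

(** * Planar binary trees and the free dendriform algebra *)

Inductive pbt := PLeaf | PNode of pbt & pbt.

Fixpoint pbt_enc (x : pbt) : GenTree.tree unit :=
  if x is PNode l r then GenTree.Node 0 [:: pbt_enc l; pbt_enc r]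
  else GenTree.Leaf tt.
Fixpoint pbt_dec (g : GenTree.tree unit) : pbt :=
  if g is GenTree.Node _ [:: l; r] then PNode (pbt_dec l) (pbt_dec r)
  else PLeaf.
Lemma pbt_encK : cancel pbt_enc pbt_dec.
Proof. by elim=> //= l -> r ->. Qed.
HB.instance Definition _ := Countable.copy pbt (can_type pbt_encK).

Definition Ytree : pbt := PNode PLeaf PLeaf.

(* Dend is the submodule of {malg R[pbt]} spanned by the nontrivial trees;
   << PLeaf >> is the unit 1 of the product *. The half products are extended
   to {malg R[pbt]} as total functions, with 1 < z = 0 and z > 1 = 0; these
   values play no role inside Dend. *)
Section Dend.
Variable R : comNzRingType.
Local Notation DendU := {malg R[pbt]}.

Definition in_Dend (f : DendU) : Prop := f@_PLeaf = 0.

Definition vee : DendU -> DendU -> DendU :=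
  bilin (fun x y => << PNode x y >>).

Fixpoint star_tree (x : pbt) : pbt -> DendU :=
  fix star_x (y : pbt) : DendU :=
    match x, y with
    | PLeaf, _ => << y >>
    | _, PLeaf => << x >>
    | PNode a b, PNode c d =>
        vee << a >> (star_tree b y) + vee (star_x c) << d >>
    end.

Definition prec_tree (x z : pbt) : DendU :=
  if x is PNode a b then vee << a >> (star_tree b z) else 0.

Definition succ_tree (z x : pbt) : DendU :=
  if x is PNode a b then vee (star_tree z a) << b >> else 0.

Lemma star_1l y : star_tree PLeaf y = << y >>.
Proof. by case: y. Qed.

Lemma star_1r x : star_tree x PLeaf = << x >>.
Proof. by case: x. Qed.

Lemma star_treeE x y : x != PLeaf -> y != PLeaf ->
  star_tree x y = prec_tree x y + succ_tree x y.
Proof. by case: x y => [|a b] [|c d]. Qed.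

Definition dprec : DendU -> DendU -> DendU := bilin prec_tree.
Definition dsucc : DendU -> DendU -> DendU := bilin succ_tree.

Definition dend_pl_mul (x y : DendU) : DendU := dsucc y x - dprec x y.

End Dend.

(** * Formal series of planar binary trees *)

Definition tseries := pbt -> K.

(* A K-linear map on the free pre-Lie algebra is extended to formal series of
   rooted trees coefficient by coefficient; for the map of interest the sum is
   finite, as it sends a tree with n vertices to trees with n inner vertices. *)
Definition extend_to_series (phi : {linear {malg K[rtree]} -> {malg K[pbt]}})
    (s : rtree -> K) : tseries :=
  fun x => \sum_(T \in [set: rtree]%classic) s T * (phi << T >>)@_x.

Definition tree_s (y : pbt) : tseries := fun x => if x == y then 1 else 0.

Definition vee_s (f g : tseries) : tseries :=
  fun x => if x is PNode l r then f l * g r else 0.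

(** * Noncommutative series in the letters p and m *)

Inductive letter := Lp | Lm.

Definition letter_code (a : letter) : bool := if a is Lp then true else false.
Definition letter_decode (c : bool) : letter := if c then Lp else Lm.
Lemma letter_codeK : cancel letter_code letter_decode.
Proof. by case. Qed.
HB.instance Definition _ := Countable.copy letter (can_type letter_codeK).

Definition wseries := seq letter -> K.

Definition wone : wseries := fun w => if w == [::] then 1 else 0.

Definition wmul (f g : wseries) : wseries :=
  fun w => \sum_(i < (size w).+1) f (take i w) * g (drop i w).

Definition wexp (f : wseries) (k : nat) : wseries := iter k (wmul f) wone.

(** The series of the c k a^k for k >= 1. *)
Definition letter_series (a : letter) (c : nat -> K) : wseries :=
  fun w => if (w != [::]) && all (pred1 a) w then c (size w) else 0.

Definition Pt_s : wseries := letter_series Lp ca_t.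
Definition Nt_s : wseries := letter_series Lm (fun k => (-1) ^+ k * ca_t k).
Definition P_s : wseries := letter_series Lp (fun k => at_t0 (ca_t k)).
Definition N_s : wseries :=
  letter_series Lm (fun k => (-1) ^+ k * at_t0 (ca_t k)).

(* The words of (P N)^k have length at least 2k, so that only the terms with
   k <= size w contribute to the coefficient of w. *)
Definition T_s : wseries :=
  fun w => \sum_(k < (size w).+1) bK ^+ k * wexp (wmul P_s N_s) k w.

(* The letters of the leaves from left to right; the argument a is the letter
   of the tree itself, used when it is reduced to a leaf. *)
Fixpoint leaf_letters (a : letter) (x : pbt) : seq letter :=
  if x is PNode l r then leaf_letters Lm l ++ leaf_letters Lp r else [:: a].

Definition canopy (l r : pbt) : seq letter :=
  let s := leaf_letters Lm l ++ leaf_letters Lp r in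
  behead (take (size s).-1 s).

Definition full_canopy (l r : pbt) : seq letter := Lm :: rcons (canopy l r) Lp.

Definition canopy_s (f : wseries) : tseries :=
  fun x => if x is PNode l r then f (full_canopy l r) else 0.

(* Main.v *)
Require Import Defs.
From HB Require Import structures.
From mathcomp Require Import all_boot all_order all_algebra.
From mathcomp Require Import finmap.
From mathcomp Require Import boolp classical_sets functions cardinality fsbigop.
From mathcomp Require Import monalg.
From mathcomp Require Import ring zify.
Set Implicit Arguments.
Unset Strict Implicit.
Unset Printing Implicit Defensive.
Import GRing.Theory.
Local Open Scope ring_scope.

(** Write [c = t / (1 - t) + b], let [E] be the series of connected flows and
    [G = E - E|_(t = 0)] its part of positive exit rate. Removing the root of a
    connected flow leaves a set of connected flows of positive rate, so that
      [t E = c S - b o],  with [S = B_+ (exp G)]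
    and [o] the one-vertex tree: a root that is not an output multiplies the
    series of the incoming rates by [1 / (1 - t)], and a root that is an output
    divides its part of positive rate by [t].

    The image of [S] under [phi] is [X > Y < W], where [>] and [<] are the two
    dendriform products and [X], [W] are the solutions of
      [X = 1 + gam < X],  [W = 1 - W > gam],  [gam = phi G].
    This is obtained from a differential equation. Let [N] multiply a tree by its
    number of vertices. Grafting on a tree of the form [B_+ (...)] is a derivation
    for the adjunction of branches ([pl_splits]), and the factors [1 / aut] turn
    sums over trees with a marked branch into products of sums ([sum_splits]).
    Hence there is an element [H] such that, with the pre-Lie product [<-],
      [N G = H + (G <- H)],  [N S = S + (S <- H)]
    ([euler_graft]). With [q = phi H], the dendriform axioms give [N X = q * X]
    and [N W = - W * q] ([deriv_X], [deriv_W]), so [X > Y < W] satisfies the same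
    differential equation as [phi S], and this equation has one solution
    ([exp_unique]). In [sum_splits], the number of ways of splitting a branch off
    a tree is obtained by counting isomorphisms ([card_isos_split]).

    It remains to recognise [X = 1 - t N T P_t] and [W = 1 + t N_t T P]: then
    [t E = c X > Y < W - b Y], which is the formula multiplied by [t]. The product
    of canopy series only depends on canopies and cuts a word at each of its
    letters, so the equations for [X] and [W] become identities between word
    series. They follow from one identity ([key_identity]), valid for all series
    [F T G] with [F] a series in the letter m and [G] one in the letter p that
    satisfy the same quadratic recursion as the series of flows on chains; it is
    proved block by block, a block being a word [m^a p^k]. The recursion
    itself is [ca_conv].

    The theorem then follows by induction on the size of the binary trees
    ([Ec_formula]): in size [n + 1], [X > Y < W] only depends on [gam] in sizes at
    most [n]. *)

Local Notation root := Defs.root.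
Local Notation "\pi T" := (\pi_rtree%qT T) (at level 10, T at next level).
Local Notation ca0 := (fun i => at_t0 (ca_t i)).
Local Notation nca f := (fun i => (-1) ^+ i * f i).

(** * Vertices of ordered trees *)

Definition leafT : otree := ONode [::].

Lemma otree_ind_children (P : otree -> Prop) :
  (forall ts, (forall t, t \in ts -> P t) -> P (ONode ts)) -> forall T, P T.
Proof.
move=> IH; fix rec 1; case=> ts; apply: IH.
elim: ts => [|t ts IHts] u; first exact: (fun h => False_ind _ (notF h)).
by rewrite inE => /predU1P[->|]; [exact: rec|exact: IHts].
Qed.

Lemma mem_verts_nil T : [::] \in verts T.
Proof. by case: T. Qed.

Lemma mem_verts_cons ts i p :
  (i :: p \in verts (ONode ts)) = (i < size ts)%N && (p \in verts (nth leafT ts i)).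
Proof.
rewrite /= inE /=.
have aux k : (i :: p \in flatten [seq [seq ip.1 :: p0 | p0 <- ip.2]
   | ip <- zip (iota k (size ts)) (map verts ts)])
   = [&& (k <= i)%N, (i < k + size ts)%N & p \in verts (nth leafT ts (i - k))].
  elim: ts k => [|t ts IH] k /=.
    by rewrite addn0 in_nil; case: leqP => //= ik; rewrite ltnNge ik.
  rewrite mem_cat IH /= addnS.
  have -> : (i :: p \in [seq k :: p0 | p0 <- verts t]) = (i == k) && (p \in verts t).
    apply/mapP/andP => [[q qt [-> ->]]//|[/eqP-> pt]]; by exists p.
  case: (ltngtP i k) => [ik|ki|->] /=.
  - by [].
  - by rewrite -(subSS k i) subSn.
  - by rewrite subnn ltnS leq_addr orbF.
by rewrite aux leq0n add0n subn0.
Qed.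

Lemma verts_uniq T : uniq (verts T).
Proof.
elim/otree_ind_children: T => ts IH /=; apply/andP; split.
  apply/negP => /flattenP[s /mapP[[i vs] _ ->]] /mapP[p _]; by [].
have aux k : uniq (flatten [seq [seq ip.1 :: p0 | p0 <- ip.2]
   | ip <- zip (iota k (size ts)) (map verts ts)]).
  elim: ts k IH => [|t ts IHts] k IH //=.
  rewrite cat_uniq map_inj_uniq ?IH ?mem_head // => [|p q [] //].
  rewrite IHts ?andbT => [|u uts]; last by apply: IH; rewrite inE uts orbT.
  apply/hasPn => q /flattenP[s /mapP[[i vs] ivs ->]] /mapP[p _ ->] /=.
  apply/negP => /mapP[p' _ [ik _]].
  have : i \in unzip1 (zip (iota k.+1 (size ts)) (map verts ts)).
    by apply/mapP; exists (i, vs).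
  by rewrite unzip1_zip ?size_map ?size_iota // mem_iota ik ltnn.
exact: aux.
Qed.

Lemma mem_verts_rcons T p i : rcons p i \in verts T -> p \in verts T.
Proof.
elim: p T => [|j p IH] [ts]; first by rewrite mem_verts_nil.
by rewrite rcons_cons !mem_verts_cons => /andP[-> /IH].
Qed.

Lemma ssval_in T (v : vertex T) : ssval v \in verts T.
Proof. by case: v. Qed.

Definition vtx T p (h : p \in verts T) : vertex T := SeqSub h.

Lemma is_child_root T (v : vertex T) : is_child (root T) v = false.
Proof. by []. Qed.

Lemma vertex_ind T (P : vertex T -> Prop) :
  P (root T) -> (forall w v, is_child w v -> P v -> P w) -> forall v, P v.
Proof.
move=> Pr Pc [p pT]; elim/last_ind: p pT => [|p i IH] pT.
  by congr P: Pr; apply: val_inj.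
have pT' := mem_verts_rcons pT.
apply: Pc (IH pT').
by rewrite /is_child /= size_rcons /= -cats1 take_size_cat // eqxx -size_eq0 size_cat addn1.
Qed.

(** * Splitting off a child of the root *)

Definition del_nth (j : nat) (us : seq otree) := take j us ++ drop j.+1 us.

Lemma size_del_nth j us : (j < size us)%N -> (size (del_nth j us)).+1 = size us.
Proof.
by move=> ju; rewrite size_cat size_take size_drop ju -addnS subnSK // subnKC // ltnW.
Qed.

Lemma nth_del_nth j us i : (j < size us)%N ->
  nth leafT (del_nth j us) i = nth leafT us (bump j i).
Proof.
move=> ju; rewrite nth_cat size_take ju /bump.
case: leqP => ji; first by rewrite nth_drop addSn subnKC.
by rewrite nth_take.
Qed.

(** How the vertices of [U] are shared between the branch [t] at one child of the
    root and the rest [S], abstracted from paths: flows and isomorphisms are cut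
    and glued along this interface only. *)
Record splitting (t S U : otree) := Splitting {
  inL : vertex t -> vertex U;
  inR : vertex S -> vertex U;
  side : vertex U -> vertex t + vertex S;
  side_inL : forall p, side (inL p) = inl p;
  side_inR : forall q, side (inR q) = inr q;
  sideK : forall v, match side v with inl p => inL p | inr q => inR q end = v;
  child_LL : forall p p', is_child (inL p) (inL p') = is_child p p';
  child_RR : forall q q', is_child (inR q) (inR q') = is_child q q';
  child_RL : forall q p, is_child (inR q) (inL p) = false;
  child_LR : forall p q, is_child (inL p) (inR q) = (p == root t) && (q == root S);
  inR_root : inR (root S) = root U }.

Section SplittingAt.
Variables (us : seq otree) (j : nat) (ju : (j < size us)%N).
Let t := nth leafT us j.
Let S := ONode (del_nth j us).
Let U := ONode us.

Let insert_path (q : seq nat) := if q is i :: q' then bump j i :: q' else [::].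

Let inL_proof (p : vertex t) : j :: ssval p \in verts U.
Proof. by rewrite mem_verts_cons ju ssval_in. Qed.

Let bump_size i : (bump j i < size us)%N = (i < size (del_nth j us))%N.
Proof. by rewrite -(size_del_nth ju) /bump; have := size_del_nth ju; case: leqP; lia. Qed.

Let inR_proof (q : vertex S) : insert_path (ssval q) \in verts U.
Proof.
case: q => [[|i q] qS]; first exact: (mem_verts_nil U).
by have := qS; rewrite !mem_verts_cons bump_size nth_del_nth.
Qed.

Let mvL (p : vertex t) : vertex U := vtx (inL_proof p).
Let mvR (q : vertex S) : vertex U := vtx (inR_proof q).

Let mvside (v : vertex U) : vertex t + vertex S :=
  if ssval v is i :: p then
    if i == j then inl (insubd (root t) p) else inr (insubd (root S) (unbump j i :: p))
  else inr (root S).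

Let ssval_insubd T (p : seq nat) : p \in verts T -> ssval (insubd (root T) p) = p.
Proof. exact: insubdK. Qed.

Let mvside_L p : mvside (mvL p) = inl p.
Proof. by rewrite /mvside /= eqxx; congr inl; apply: (valKd (root t) p). Qed.

Let mvside_R q : mvside (mvR q) = inr q.
Proof.
rewrite /mvside; case: q => [[|i q] /= qS].
  by congr inr; apply: val_inj.
rewrite (negbTE (_ : bump j i != j)) ?[_ == j]eq_sym ?neq_bump // bumpK.
by congr inr; apply: (valKd (root S) (SeqSub qS)).
Qed.

Let mvsideK v : match mvside v with inl p => mvL p | inr q => mvR q end = v.
Proof.
case: v => [[|i p] vU]; rewrite /mvside /=; first exact: val_inj.
have:= vU; rewrite mem_verts_cons => /andP[iu pi].
case: eqP => [ij|/eqP ij]; apply: val_inj.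
  by rewrite /= (ssval_insubd (T := t)) ?ij // /t -ij.
have ub : bump j (unbump j i) = i by rewrite unbumpK // inE.
by rewrite /= (ssval_insubd (T := S)) /= ?ub // mem_verts_cons -bump_size nth_del_nth // ub iu.
Qed.

Let is_child_cons (i k : nat) (w v : seq nat) :
  (i :: w != [::]) && (k :: v == take (size (i :: w)).-1 (i :: w))
  = [&& i == k, w != [::] & v == take (size w).-1 w].
Proof. by case: w => [|x w] /=; rewrite ?andbF // eqseq_cons eq_sym. Qed.

Lemma splitting_at : splitting t S U.
Proof.
apply: (@Splitting t S U mvL mvR mvside mvside_L mvside_R mvsideK).
- by move=> p p'; rewrite /is_child is_child_cons eqxx.
- case=> [[|i q] qS] [[|i' q'] qS'] //=; rewrite /is_child /=.
    by case: q qS => // x q.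
  have := is_child_cons i i' q q'; rewrite /= => ->.
  have := is_child_cons (bump j i) (bump j i') q q'; rewrite /= => ->.
  by rewrite (can_eq (@bumpK j)).
- case=> [[|i q] qS] [p pt] //=; rewrite /is_child.
  by rewrite is_child_cons (negbTE (_ : bump j i != j)) // eq_sym neq_bump.
- case=> [p pt] [[|i q] qS]; rewrite /is_child /= -!(inj_eq val_inj) /=.
    by case: p pt => [|x p].
  have := is_child_cons j (bump j i) p q; rewrite /= => ->.
  by rewrite (negbTE (neq_bump _ _)) andbF.
- exact: val_inj.
Defined.

End SplittingAt.

(** * Counting isomorphisms *)

Definition isos T U : {set {ffun vertex T -> vertex U}} := [set f | is_iso f].

Lemma is_childP us (v : vertex (ONode us)) :
  is_child v (root (ONode us)) -> exists2 j, (j < size us)%N & ssval v = [:: j].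
Proof.
case: v => [[|j p] vU] //; rewrite /is_child /= => /eqP.
case: p vU => // vU _; exists j => //.
by move: vU; rewrite mem_verts_cons => /andP[].
Qed.

Variant split_spec t S U (D : splitting t S U) : vertex U -> Type :=
  | SplitL p : split_spec D (inL D p)
  | SplitR q : split_spec D (inR D q).

Lemma splitP t S U (D : splitting t S U) v : split_spec D v.
Proof. by rewrite -(sideK D v); case: (side D v) => ?; constructor. Qed.

Lemma inL_inj t S U (D : splitting t S U) : injective (inL D).
Proof. by move=> p p' e; have := side_inL D p; rewrite e side_inL => -[]. Qed.

Lemma inR_inj t S U (D : splitting t S U) : injective (inR D).
Proof. by move=> p p' e; have := side_inR D p; rewrite e side_inR => -[]. Qed.

Lemma inLR t S U (D : splitting t S U) p q : inL D p <> inR D q.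
Proof. by move=> e; have := side_inL D p; rewrite e side_inR. Qed.

Section Glue.
Variables (t S T t' S' T' : otree) (D : splitting t S T) (D' : splitting t' S' T').

Definition glue (a : {ffun vertex t -> vertex t'}) (b : {ffun vertex S -> vertex S'}) :
    {ffun vertex T -> vertex T'} :=
  [ffun v => match side D v with inl p => inL D' (a p) | inr q => inR D' (b q) end].

Lemma glueL a b p : glue a b (inL D p) = inL D' (a p).
Proof. by rewrite ffunE side_inL. Qed.

Lemma glueR a b q : glue a b (inR D q) = inR D' (b q).
Proof. by rewrite ffunE side_inR. Qed.

Lemma glue_iso a b : is_iso a -> is_iso b -> is_iso (glue a b).
Proof.
move=> /is_isoP[[a' aK a'K] ar ac] /is_isoP[[b' bK b'K] br bc].
apply/is_isoP; split.
- exists (fun v => match side D' v with inl p => inL D (a' p) | inr q => inR D (b' q) end).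
    by move=> v; case: (splitP D v) => p; rewrite ?glueL ?glueR ?side_inL ?side_inR ?aK ?bK.
  by move=> v; case: (splitP D' v) => p; rewrite ?side_inL ?side_inR ?glueL ?glueR ?a'K ?b'K.
- by rewrite -(inR_root D) glueR br inR_root.
- have rE (x : vertex t) : (a x == root t') = (x == root t).
    by rewrite -ar (can_eq aK).
  have rE' (x : vertex S) : (b x == root S') = (x == root S).
    by rewrite -br (can_eq bK).
  move=> w v; case: (splitP D w) => w'; case: (splitP D v) => v'; rewrite ?glueL ?glueR.
  + by rewrite !child_LL ac.
  + by rewrite !child_LR rE rE'.
  + by rewrite !child_RL.
  + by rewrite !child_RR bc.
Qed.

Lemma glue_inj a b a2 b2 : glue a b = glue a2 b2 -> (a, b) = (a2, b2).
Proof.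
move=> /ffunP e; congr pair; apply/ffunP => x.
  by have := e (inL D x); rewrite !glueL => /inL_inj.
by have := e (inR D x); rewrite !glueR => /inR_inj.
Qed.

(** The set of descendants of a child of the root is determined by that child,
    so an isomorphism matching two children splits into two isomorphisms. *)
Lemma unglue f : is_iso f -> f (inL D (root t)) = inL D' (root t') ->
  exists a b, [/\ is_iso a, is_iso b & f = glue a b].
Proof.
move=> /is_isoP[[g fK gK] fr fc] ft.
have fL p : {p' | f (inL D p) = inL D' p'}.
  case E: (side D' (f (inL D p))) => [p'|q'].
    by exists p'; rewrite -(sideK D' (f _)) E.
  exfalso; suff [p' fp] : exists p', f (inL D p) = inL D' p' by rewrite fp side_inL in E.
  elim/vertex_ind: p {E} => [|w v wv [v' fv]]; first by exists (root t').
  have: is_child (f (inL D w)) (inL D' v') by rewrite -fv fc child_LL.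
  by case: (splitP D' (f _)) => w'; [exists w'|rewrite child_RL].
have fR q : {q' | f (inR D q) = inR D' q'}.
  case E: (side D' (f (inR D q))) => [p'|q'].
    exfalso; suff [q' fp] : exists q', f (inR D q) = inR D' q' by rewrite fp side_inR in E.
    elim/vertex_ind: q {E} => [|w v wv [v' fv]].
      by exists (root S'); rewrite !inR_root.
    have: is_child (f (inR D w)) (inR D' v') by rewrite -fv fc child_RR.
    case E: _ / (splitP D' (f _)) => [w'|w']; last by exists w'.
    rewrite child_LR => /andP[/eqP w'r _]; move: E; rewrite w'r -ft => /(can_inj fK).
    by move/esym/inLR.
  by exists q'; rewrite -(sideK D' (f _)) E.
pose a := [ffun p => sval (fL p)]; pose b := [ffun q => sval (fR q)].
have aE p : inL D' (a p) = f (inL D p) by rewrite ffunE; case: (fL p).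
have bE q : inR D' (b q) = f (inR D q) by rewrite ffunE; case: (fR q).
have fE : f = glue a b.
  by apply/ffunP => v; case: (splitP D v) => x; rewrite ?glueL ?glueR ?aE ?bE.
have gL p' : exists p, inL D p = g (inL D' p').
  case E: _ / (splitP D (g _)) => [p|q]; first by exists p.
  by case: (@inLR _ _ _ D' p' (b q)); rewrite bE -E gK.
have gR q' : exists q, inR D q = g (inR D' q').
  case E: _ / (splitP D (g _)) => [p|q]; last by exists q.
  by case: (@inLR _ _ _ D' (a p) q'); rewrite aE -E gK.
have aI : injective a by move=> x y e; apply/(inL_inj (D := D))/(can_inj fK); rewrite -!aE e.
have bI : injective b by move=> x y e; apply/(inR_inj (D := D))/(can_inj fK); rewrite -!bE e.
exists a, b; split=> //; apply/and4P; split.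
- exact/injectiveP.
- apply/forallP => u; have [p pE] := gL u; apply/codomP; exists p.
  by apply: (inL_inj (D := D')); rewrite aE pE gK.
- by apply/eqP/(inL_inj (D := D')); rewrite aE.
- by apply/forallP => w; apply/forallP => v; rewrite -(child_LL D') !aE fc child_LL.
- exact/injectiveP.
- apply/forallP => u; have [p pE] := gR u; apply/codomP; exists p.
  by apply: (inR_inj (D := D')); rewrite bE pE gK.
- by apply/eqP/(inR_inj (D := D')); rewrite bE !inR_root.
- by apply/forallP => w; apply/forallP => v; rewrite -(child_RR D') !bE fc child_RR.
Qed.

Lemma card_glue :
  #|[set f in isos T T' | f (inL D (root t)) == inL D' (root t')]|
    = (#|isos t t'| * #|isos S S'|)%N.
Proof.
rewrite -cardsX -(card_in_imset (f := fun ab => glue ab.1 ab.2)); last first.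
  by move=> [a b] [a' b'] _ _ /glue_inj.
apply: eq_card => f; rewrite !inE; apply/andP/imsetP.
  move=> [fi /eqP ft]; have [a [b [ai bi ->]]] := unglue fi ft.
  by exists (a, b); rewrite // !inE ai bi.
move=> [[a b]]; rewrite !inE => /andP[/= ai bi] ->; split; first exact: glue_iso.
by have /is_isoP[_ ar _] := ai; rewrite glueL ar.
Qed.

End Glue.

(** An isomorphism sends the chosen child of the root to some child of the root;
    the sum is over the position of the latter. *)
Lemma card_isos_split t S T (D : splitting t S T) us :
  #|isos T (ONode us)| = (\sum_(j < size us)
     #|isos t (nth leafT us j)| * #|isos S (ONode (del_nth j us))|)%N.
Proof.
pose D' (j : 'I_(size us)) := splitting_at (ltn_ord j).
pose im (f : {ffun vertex T -> vertex (ONode us)}) := f (inL D (root t)).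
transitivity (\sum_(j < size us)
  #|[set f in isos T (ONode us) | im f == inL (D' j) (root _)]|)%N; last first.
  by apply: eq_bigr => j _; apply: card_glue.
transitivity (\sum_(j < size us) \sum_(f in isos T (ONode us))
  (im f == inL (D' j) (root _)))%N; last first.
  apply: eq_bigr => j _; rewrite -sum1_card big_mkcond [RHS]big_mkcond /=.
  by apply: eq_bigr => f _; rewrite !inE; case: is_iso => //=; case: eqP.
rewrite exchange_big /= -sum1_card; apply: eq_bigr => f; rewrite inE => /is_isoP[_ fr fc].
have /is_childP[j ju fj] : is_child (im f) (root (ONode us)).
  by rewrite /im -fr -(inR_root D) fc child_LR !eqxx.
rewrite (bigD1 (Ordinal ju)) //= big1 => [|k kj].
  by rewrite -(inj_eq val_inj) /= fj eqxx.
rewrite -(inj_eq val_inj) /= fj; case: eqP => // -[jk].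
by move: kj; rewrite -(inj_eq val_inj) /= jk eqxx.
Qed.

(** * Isomorphism classes *)

Lemma piP T U : reflect (\pi T = \pi U) (otree_iso T U).
Proof. exact: eqmodP. Qed.

Lemma repr_iso T : otree_iso (repr (\pi T)) T.
Proof. by apply/piP; rewrite reprK. Qed.

Lemma otree_isoE T U : otree_iso T U = (0 < #|isos T U|)%N.
Proof.
apply/existsP/card_gt0P => -[f fi]; exists f; first by rewrite inE.
by rewrite inE in fi.
Qed.

Lemma comp_iso T U W (f : {ffun vertex T -> vertex U}) (g : {ffun vertex U -> vertex W}) :
  is_iso f -> is_iso g -> is_iso [ffun v => g (f v)].
Proof.
move=> /is_isoP[fB fr fc] /is_isoP[gB gr gc]; apply/is_isoP; split.
- by apply: (eq_bij (bij_comp gB fB)) => v; rewrite ffunE.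
- by rewrite ffunE fr.
- by move=> w v; rewrite !ffunE gc fc.
Qed.

Lemma leq_card_isos T U U' : otree_iso U U' -> (#|isos T U| <= #|isos T U'|)%N.
Proof.
move=> /existsP[h hi]; pose c (f : {ffun vertex T -> vertex U}) := [ffun v => h (f v)].
rewrite -(card_imset _ (f := c)) => [|f g /ffunP e].
  apply/subset_leq_card/fintype.subsetP => _ /imsetP[f fi ->].
  by rewrite inE in fi; rewrite inE; apply: comp_iso.
have /is_isoP[/bij_inj hI _ _] := hi.
by apply/ffunP => v; have := e v; rewrite !ffunE => /hI.
Qed.

Lemma card_isos_congr T U U' : otree_iso U U' -> #|isos T U| = #|isos T U'|.
Proof. by move=> UU'; apply/eqP; rewrite eqn_leq !leq_card_isos // otree_iso_sym. Qed.

Lemma leq_card_isosl T T' U : otree_iso T T' -> (#|isos T U| <= #|isos T' U|)%N.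
Proof.
rewrite otree_iso_sym => /existsP[h hi].
pose c (f : {ffun vertex T -> vertex U}) := [ffun v => f (h v)].
rewrite -(card_imset _ (f := c)) => [|f g /ffunP e].
  apply/subset_leq_card/fintype.subsetP => _ /imsetP[f fi ->].
  by rewrite inE in fi; rewrite inE; apply: comp_iso.
have /is_isoP[[h' hK h'K] _ _] := hi.
by apply/ffunP => v; have := e (h' v); rewrite !ffunE h'K.
Qed.

Lemma card_isos_congl T T' U : otree_iso T T' -> #|isos T U| = #|isos T' U|.
Proof. by move=> TT'; apply/eqP; rewrite eqn_leq !leq_card_isosl // otree_iso_sym. Qed.

Lemma card_isosE T U : #|isos T U| = (aut T * otree_iso T U)%N.
Proof.
case TU: (otree_iso T U); last first.
  by rewrite muln0; apply/eqP; rewrite eqn0Ngt -otree_isoE TU.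
by rewrite muln1 -(card_isos_congr _ TU).
Qed.

Lemma aut_gt0 T : (0 < aut T)%N.
Proof. by have := otree_iso_refl T; rewrite otree_isoE. Qed.

(** The Butcher product of rooted trees. *)
Definition bprod (t S : otree) := ONode (t :: children S).

Lemma card_isos_bprod t S us :
  #|isos (bprod t S) (ONode us)| = (\sum_(j < size us)
     #|isos t (nth leafT us j)| * #|isos S (ONode (del_nth j us))|)%N.
Proof.
apply: card_isos_split; case: S => ss.
by have := @splitting_at (t :: ss) 0 isT; rewrite /del_nth /= drop0.
Qed.

Lemma otree_iso_bprod t S us j : (j < size us)%N ->
  otree_iso t (nth leafT us j) -> otree_iso S (ONode (del_nth j us)) ->
  otree_iso (bprod t S) (ONode us).
Proof.
move=> ju; rewrite !otree_isoE card_isos_bprod (bigD1 (Ordinal ju)) //= => c1 c2.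
by rewrite addn_gt0 muln_gt0 c1 c2.
Qed.

Lemma bprod_iso t t' S S' : otree_iso t t' -> otree_iso S S' -> otree_iso (bprod t S) (bprod t' S').
Proof.
move=> tt' SS'; apply: (@otree_iso_bprod _ _ (t' :: children S') 0) => //.
by rewrite /del_nth /= drop0; case: S' SS'.
Qed.

Definition bprodR (A S : rtree) : rtree := \pi (bprod (repr A) (repr S)).

Lemma bprodR_pi t S : bprodR (\pi t) (\pi S) = \pi (bprod t S).
Proof. by apply/piP/bprod_iso; apply: repr_iso. Qed.

Lemma pi_del_nth us j : (j < size us)%N ->
  bprodR (\pi (nth leafT us j)) (\pi (ONode (del_nth j us))) = \pi (ONode us).
Proof.
by move=> ju; rewrite bprodR_pi; apply/piP/(otree_iso_bprod ju); apply: otree_iso_refl.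
Qed.

Lemma iota0E n : iota 0 n = index_iota 0 n.
Proof. by rewrite /index_iota subn0. Qed.

(** A sequence and not a set, because a branch class counts with multiplicity;
    another representative of the tree only permutes it. *)
Definition splits_seq (us : seq otree) : seq (rtree * rtree) :=
  [seq (\pi (nth leafT us j), \pi (ONode (del_nth j us))) | j <- iota 0 (size us)].

Definition splits (T : rtree) := splits_seq (children (repr T)).

Definition autR (T : rtree) := aut (repr T).

Lemma autR_pi T : autR (\pi T) = aut T.
Proof.
have e := repr_iso T; rewrite /autR -[RHS]/(#|isos T T|).
by rewrite -(card_isos_congl _ e) card_isosE e muln1.
Qed.

(** Each way of splitting off a branch isomorphic to [A], with rest isomorphic to
    [S], carries [aut A * aut S] isomorphisms. *)
Lemma count_splits_seq A S us :
  (count_mem (A, S) (splits_seq us) * (autR A * autR S))%N = #|isos (bprod (repr A) (repr S)) (ONode us)|.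
Proof.
rewrite card_isos_bprod -sum1_count big_distrl /= big_map big_mkcond iota0E big_mkord.
apply: eq_bigr => j _; rewrite !card_isosE mul1n /= xpair_eqE.
have piE T (B : rtree) : (\pi T == B) = otree_iso (repr B) T.
  by rewrite -{1}[B]reprK; apply/eqP/piP => ->.
by rewrite !piE; do 2!case: otree_iso; rewrite ?muln0 ?muln1.
Qed.

Lemma autR_gt0 T : (0 < autR T)%N.
Proof. exact: aut_gt0. Qed.

(** The multiplicities are numbers of isomorphisms, divided by a constant. *)
Lemma splits_seq_perm us us' : otree_iso (ONode us) (ONode us') -> perm_eq (splits_seq us) (splits_seq us').
Proof.
move=> e; rewrite /perm_eq; apply/seq.allP; case=> A S _ /=.
have a0 : (0 < autR A * autR S)%N by rewrite muln_gt0 !autR_gt0.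
by rewrite -(eqn_pmul2r a0) !count_splits_seq (card_isos_congr _ e).
Qed.

Lemma splits_pi us : perm_eq (splits (\pi (ONode us))) (splits_seq us).
Proof. by have := repr_iso (ONode us); rewrite /splits; case: (repr _) => vs; apply: splits_seq_perm. Qed.

Lemma count_splits A S T :
  (count_mem (A, S) (splits T) * (autR A * autR S))%N = (autR T * (bprodR A S == T))%N.
Proof.
rewrite count_splits_seq; case E: (repr T) => [us] /=.
have TE : T = \pi (ONode us) by rewrite -E reprK.
rewrite card_isosE TE autR_pi /bprodR.
case: (piP (bprod _ _) (ONode us)) => [e|]; first by rewrite e eqxx -autR_pi e autR_pi.
by rewrite !muln0 => /eqP/negbTE->; rewrite muln0.
Qed.

Lemma splits_bprodR A S T : (A, S) \in splits T -> bprodR A S = T.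
Proof.
case/mapP=> j; rewrite mem_iota /= => ju [-> ->]; rewrite pi_del_nth //.
by case E: (repr T) => [us] /=; rewrite -E reprK.
Qed.

Lemma splits_bullet : splits bullet = [::].
Proof. by apply/perm_nilP/(perm_trans (splits_pi [::])). Qed.

Lemma splits_nil T : splits T = [::] -> T = bullet.
Proof.
rewrite /splits; case E: (repr T) => [[|//]] _.
by rewrite -[T]reprK E.
Qed.

Lemma splits_seq_cons u us :
  splits_seq (u :: us) = (\pi u, \pi (ONode us))
    :: [seq (CR.1, bprodR (\pi u) CR.2) | CR <- splits_seq us].
Proof.
rewrite /splits_seq /= /del_nth /= drop0; congr cons; rewrite (iotaDl 1) -!map_comp.
by apply: eq_map => j /=; rewrite bprodR_pi.
Qed.

Lemma splits_bprodR_perm A S :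
  perm_eq (splits (bprodR A S)) ((A, S) :: [seq (CR.1, bprodR A CR.2) | CR <- splits S]).
Proof.
apply: perm_trans (splits_pi _) _; rewrite splits_seq_cons reprK.
have -> : ONode (children (repr S)) = repr S by case: (repr S).
by rewrite reprK.
Qed.

Lemma size_splits_bprodR A S : size (splits (bprodR A S)) = (size (splits S)).+1.
Proof. by rewrite (perm_size (splits_bprodR_perm A S)) /= size_map. Qed.

Definition nverts (T : otree) := size (verts T).
Definition nvertsR (T : rtree) := nverts (repr T).

Lemma nvertsE ts : nverts (ONode ts) = (sumn (map nverts ts)).+1.
Proof.
rewrite /nverts /=; congr S; rewrite size_flatten /shape -map_comp; congr sumn.
elim: ts 0%N => //= t ts IH k; rewrite size_map; congr cons; exact: IH.
Qed.

Lemma card_vertex T : #|{: vertex T}| = nverts T.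
Proof. by rewrite card_seq_sub ?verts_uniq. Qed.

Lemma nverts_iso T U : otree_iso T U -> nverts T = nverts U.
Proof. by move=> /existsP[f /is_isoP[fB _ _]]; rewrite -!card_vertex; apply: bij_eq_card fB. Qed.

Lemma nvertsR_pi T : nvertsR (\pi T) = nverts T.
Proof. exact/nverts_iso/repr_iso. Qed.

Lemma nverts_gt0 T : (0 < nverts T)%N.
Proof. by case: T => ts; rewrite nvertsE. Qed.

Lemma nverts_bprod t S : nverts (bprod t S) = (nverts t + nverts S)%N.
Proof. by case: S => ss; rewrite /bprod !nvertsE /= addnS. Qed.

Lemma nvertsR_gt0 T : (0 < nvertsR T)%N.
Proof. exact: nverts_gt0. Qed.

Lemma nvertsR_bprodR A S : nvertsR (bprodR A S) = (nvertsR A + nvertsR S)%N.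
Proof. by rewrite nvertsR_pi nverts_bprod. Qed.

Lemma nvertsR_bullet : nvertsR bullet = 1%N.
Proof. by rewrite nvertsR_pi. Qed.

Lemma nvertsR_splits T : nvertsR T = (\sum_(AS <- splits T) nvertsR AS.1).+1.
Proof.
rewrite /nvertsR /splits; case: (repr T) => us /=; rewrite nvertsE; congr S.
rewrite sumnE !big_map iota0E (big_nth leafT) !big_mkord.
by apply: eq_bigr => j _; rewrite -[RHS]/(nvertsR _) nvertsR_pi.
Qed.

(** * Generating series of flows *)

Section FiniteSums.
Variable V : nzRingType.

(** Finiteness is part of the predicate, since a sum over a set where [w] has
    infinite support has the default value 0. *)
Definition has_sum (X : choiceType) (A : pred X) (w : X -> V) (v : V) :=
  exists l : seq X, [/\ uniq l, l =i A & v = \sum_(x <- l) w x].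

Lemma has_sum_fsbig (X : choiceType) (A : pred X) w v :
  has_sum A w v -> \sum_(x \in [set x | A x]%classic) w x = v.
Proof.
case=> l [lU lA ->]; have -> : [set x | A x]%classic = [set` l]%classic.
  by apply/seteqP; split=> x /=; rewrite lA.
by rewrite [RHS]fsbig_seq.
Qed.

(** A sum is computed by parametrising the index set by finitely many index sets,
    the weights being multiplied by a constant on each of them. *)
Lemma has_sum_union (X Y : choiceType) n (A : nat -> pred X) (f : nat -> X -> Y)
    (C : pred Y) w w' (k v : nat -> V) :
  (forall i, (i < n)%N -> has_sum (A i) w (v i)) ->
  (forall i x, (i < n)%N -> A i x -> w' (f i x) = k i * w x) ->
  (forall i x, (i < n)%N -> A i x -> C (f i x)) ->
  (forall y, C y -> exists i x, [/\ (i < n)%N, A i x & y = f i x]) ->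
  (forall i j x x', A i x -> A j x' -> f i x = f j x' -> i = j /\ x = x') ->
  has_sum C w' (\sum_(i < n) k i * v i).
Proof.
move=> sA wf fC Cf fI.
have [l lP] : exists l : 'I_n -> seq X, forall i : 'I_n,
    [/\ uniq (l i), l i =i A i & v i = \sum_(x <- l i) w x].
  apply: (@fin_all_exists 'I_n (fun=> seq X) (fun i li =>
    [/\ uniq li, li =i A i & v i = \sum_(x <- li) w x])) => i.
  exact: sA.
exists [seq f i x | i : 'I_n <- enum 'I_n, x <- l i]; split.
- refine (@allpairs_uniq_dep 'I_n (fun=> X) Y (fun i x => f i x) (enum 'I_n) l _ _ _).
  + exact: enum_uniq.
  + by move=> i _; have [] := lP i.
  move=> [i x] [j y] /allpairsPdep[i' [x' [_ x'l [-> ->]]]] /allpairsPdep[j' [y' [_ y'l [-> ->]]]] /=.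
  have [_ lA _] := lP i'; have [_ lA' _] := lP j'.
  rewrite lA in x'l; rewrite lA' in y'l.
  move=> e; have [ij xy] := fI _ _ _ _ x'l y'l e.
  by rewrite xy; congr existT; apply: val_inj.
- move=> y; apply/allpairsPdep/idP => [[i [x [_ xl ->]]]|].
    by have [_ lA _] := lP i; rewrite lA in xl; apply: fC.
  move=> /Cf[i [x [ni xA yE]]]; exists (Ordinal ni), x; split=> //; first exact: mem_enum.
  by have [_ lA _] := lP (Ordinal ni); rewrite lA.
- rewrite big_allpairs_dep /= big_enum; apply: eq_bigr => i _.
  have [_ lA ->] := lP i; rewrite big_distrr /= big_seq [RHS]big_seq.
  by apply: eq_bigr => x; rewrite lA => /wf->.
Qed.

Lemma has_sum_pair (X Y : choiceType) (A : pred X) (B : pred Y) w w' v v' :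
  has_sum A w v -> has_sum B w' v' ->
  has_sum (fun xy : X * Y => A xy.1 && B xy.2) (fun xy => w xy.1 * w' xy.2) (v * v').
Proof.
move=> [l [lU lA ->]] [l' [lU' lA' ->]]; exists [seq (x, y) | x <- l, y <- l']; split.
- by apply: allpairs_uniq => // -[? ?] [? ?] _ _ [-> ->].
- move=> [x y]; rewrite -[RHS]/(A x && B y) -[A x]/(x \in A) -[B y]/(y \in B) -lA -lA'.
  by apply/allpairsP/andP => [[[a b] [? ? [-> ->]]]//|[xl yl]]; exists (x, y).
- by rewrite big_allpairs_dep big_distrlr.
Qed.

Lemma has_sum0 (X : choiceType) (A : pred X) w : A =1 pred0 -> has_sum A w 0.
Proof. by move=> A0; exists [::]; split=> [//|x|]; rewrite ?big_nil // -[RHS]/(A x) A0. Qed.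

Lemma has_sum1 (X : choiceType) (A : pred X) x w : A =1 pred1 x -> has_sum A w (w x).
Proof.
move=> A1; exists [:: x]; split=> [//|y|]; last by rewrite big_seq1.
by rewrite inE -[RHS]/(A y) A1.
Qed.

End FiniteSums.

(** A lower bound [d] on the rates of the edges covers both all flows ([d = 0])
    and connected flows ([d = 1]). *)
Definition is_flow_ge (d : nat) (T : otree) (e : nat) (F : flow_data T) : bool :=
  [&& is_flow F, [forall v, (v != root T) ==> (d <= F.2 v)%N] & exit_rate F == e].

(** Flows whose root is inert, so that the exit rate is the sum of the rates of
    the edges entering the root: these encode families of flows on the children. *)
Definition is_inert_flow (d : nat) (T : otree) (e : nat) (F : flow_data T) : bool :=
  [&& is_flow_ge d e F, root T \notin F.1.1 & F.1.2 (root T) == 0%N].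

Lemma is_flow_geP d T e (F : flow_data T) :
  reflect [/\ forall v, v \in F.1.1 -> F.1.2 v = 0%N,
     forall v, (F.2 v + (v \in F.1.1) = F.1.2 v + \sum_(w | is_child w v) F.2 w)%N,
     forall v, v != root T -> (d <= F.2 v)%N & F.2 (root T) = e] (is_flow_ge d e F).
Proof.
case: F => [[O m] r]; rewrite /is_flow_ge /exit_rate /=.
apply: (iffP and3P) => [[/andP[/forallP h1 /forallP h2] /forallP h3 /eqP h4]|[h1 h2 h3 h4]].
  split=> // v.
  - by move=> vO; have /implyP/(_ vO)/eqP := h1 v.
  - exact/eqP.
  - exact/implyP.
split; last exact/eqP.
- apply/andP; split; apply/forallP => v; last exact/eqP/h2.
  by apply/implyP => /h1->.
- by apply/forallP => v; apply/implyP/h3.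
Qed.

Section RootUpdate.
Variable T : otree.
Implicit Types F : flow_data T.

Definition upd (f : {ffun vertex T -> nat}) (k : nat) : {ffun vertex T -> nat} :=
  [ffun v => if v == root T then k else f v].

Lemma updr f k : upd f k (root T) = k. Proof. by rewrite ffunE eqxx. Qed.

Lemma updN f k v : v != root T -> upd f k v = f v.
Proof. by move=> /negbTE vr; rewrite ffunE vr. Qed.

Lemma upd_upd f k k' : upd (upd f k) k' = upd f k'.
Proof. by apply/ffunP => v; rewrite !ffunE; case: eqP. Qed.

Lemma upd_id f : upd f (f (root T)) = f.
Proof. by apply/ffunP => v; rewrite !ffunE; case: eqP => // ->. Qed.

Lemma sum_upd f k v :
  (\sum_(w | is_child w v) upd f k w = \sum_(w | is_child w v) f w)%N.
Proof.
apply: eq_bigr => w wv; rewrite updN //; apply: contraL wv => /eqP->.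
by rewrite is_child_root.
Qed.

Definition set_root (o : bool) (k e : nat) (F : flow_data T) : flow_data T :=
  (if o then root T |: F.1.1 else F.1.1, upd F.1.2 k, upd F.2 e).

(** A flow of exit rate [e] is obtained from a flow with inert root and exit rate
    [s]: if [s <= e] the root creates [e - s], and if [s = e + 1] it is an output. *)
Lemma flow_ge_sum d (z : nat -> {poly rat}) e :
  (forall s, has_sum (@is_inert_flow d T s) (@flow_weight T) (z s)) ->
  has_sum (@is_flow_ge d T e) (@flow_weight T) (\sum_(s < e.+1) z s + 'X * z e.+1).
Proof.
move=> zs.
have -> : \sum_(s < e.+1) z s + 'X * z e.+1
    = \sum_(s < e.+2) (if (s <= e)%N then 1 else 'X) * z s.
  rewrite [RHS]big_ord_recr /= ltnn; congr (_ + _).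
  by apply: eq_bigr => s _; rewrite -ltnS ltn_ord mul1r.
pose f s := set_root (e < s)%N (e - s) e.
apply: (has_sum_union (X := flow_data T) (A := fun s => @is_inert_flow d T s) (f := f)
  (w := @flow_weight T) (k := fun s => if (s <= e)%N then 1 else 'X) (v := z)) => //.
- move=> s F _ /and3P[_ rO _]; rewrite /flow_weight /flow_size /f /=.
  case: ltnP => _; last by rewrite mul1r.
  by rewrite cardsU1 rO exprS.
- move=> s F; rewrite ltnS => se /and3P[/is_flow_geP[h1 h2 h3 h4] rO /eqP m0].
  have h2r := h2 (root T); rewrite (negbTE rO) m0 h4 add0n addn0 in h2r.
  apply/is_flow_geP; rewrite /f /=; split=> [v|v|v vr|]; last by rewrite updr.
  + have [->|vr] := eqVneq v (root T).
      by rewrite updr; case: ltnP; rewrite ?(negbTE rO) //; lia.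
    by rewrite updN //; case: ifP => _; rewrite ?in_setU1 ?(negbTE vr); apply: h1.
  + rewrite sum_upd; have [->|vr] := eqVneq v (root T).
      by rewrite !updr -h2r; case: ltnP => ?; rewrite ?setU11 ?(negbTE rO); lia.
    by rewrite !updN // -h2; case: ifP => _; rewrite ?in_setU1 ?(negbTE vr).
  + by rewrite updN //; apply: h3.
- move=> F Fm; have /is_flow_geP[h1 h2 h3 h4] := Fm.
  have := h2 (root T); rewrite h4; move rhs_s : (\sum_(w | _) _)%N => s hr.
  exists s; exists ((F.1.1 :\ root T, upd F.1.2 0, upd F.2 s) : flow_data T); split.
  + by move: hr; case: (boolP (_ \in _)) => [/h1->|_]; lia.
  + apply/and3P; split; rewrite /= ?updr ?setD11 //; apply/is_flow_geP; split=> /= [v|v|v vr|].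
    * by rewrite in_setD1 => /andP[vr /h1]; rewrite updN.
    * rewrite sum_upd in_setD1; have [->|vr] := eqVneq v (root T); first by rewrite !updr addn0 rhs_s.
      by rewrite !updN //= h2.
    * by rewrite updN //; apply: h3.
    * by rewrite updr.
  + rewrite /f /set_root /= !upd_upd -[in upd _ e]h4 upd_id.
    case: F {Fm} h1 h2 h3 h4 rhs_s hr => [[O m] r] /= h1 h2 h3 h4 rhs_s hr.
    have [rO|rO] := boolP (root T \in O).
      have -> : (e < s)%N by move: hr; rewrite rO h1 //; lia.
      rewrite finset.setD1K //; congr (_, _, _); rewrite -[LHS]upd_id h1 //; congr upd.
      by move: hr; rewrite rO h1 //; lia.
    rewrite (negbTE rO) addn0 in hr.
    have -> : (e < s)%N = false by lia.
    have -> : (e - s)%N = m (root T) by rewrite hr addnK.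
    rewrite upd_id.
    congr (_, _, _); apply/setP => v; rewrite in_setD1.
    by case: eqP => // ->; rewrite (negbTE rO).
- move=> i j [[O m] r] [[O' m'] r'] /and3P[/is_flow_geP[h1 h2 h3 h4] rO /eqP m0].
  move=> /and3P[/is_flow_geP[h1' h2' h3' h4'] rO' /eqP m0'] [] /=.
  move=> eO em er; rewrite /= in m0 m0' h4 h4' rO rO'.
  have em' : m = m' by rewrite -(upd_id m) -(upd_id m') m0 m0' -(upd_upd m (e - i)) em upd_upd.
  have sr k : upd r k = upd r' k by rewrite -(upd_upd r e) er upd_upd.
  have sE : (\sum_(w | is_child w (root T)) r w = \sum_(w | is_child w (root T)) r' w)%N.
    by rewrite -(sum_upd r 0) sr sum_upd.
  have ij : i = j.
    have := h2 (root T); have := h2' (root T) => /=.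
    by rewrite sE m0 m0' (negbTE rO) (negbTE rO') h4 h4' !addn0 => -> ->.
  split=> //; rewrite -(upd_id r) -(upd_id r') h4 h4' ij sr em'; congr (_, _, _).
  rewrite ij in eO; move: eO; case: ifP => // _ eO.
  apply/setP => v; have := congr1 (fun A : {set vertex T} => v \in A) eO; rewrite !in_setU1.
  by case: eqP => // ->; rewrite (negbTE rO) (negbTE rO').
Qed.

End RootUpdate.

Section FlowGlue.
Variables (d : nat) (t S T : otree) (D : splitting t S T).

Lemma big_vertex_split (V : nmodType) (P : pred (vertex T)) (F : vertex T -> V) :
  \sum_(v | P v) F v = \sum_(p | P (inL D p)) F (inL D p) + \sum_(q | P (inR D q)) F (inR D q).
Proof.
pose g (x : vertex t + vertex S) := match x with inl p => inL D p | inr q => inR D q end.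
rewrite (reindex g) /=; first by rewrite big_sumType.
exists (side D) => [[p|q] _|v _]; [exact: side_inL|exact: side_inR|].
by rewrite /g sideK.
Qed.

Definition glue_fun (A : Type) (f : {ffun vertex t -> A}) (g : {ffun vertex S -> A}) :
    {ffun vertex T -> A} :=
  [ffun v => match side D v with inl p => f p | inr q => g q end].

Lemma glue_funL A f g p : @glue_fun A f g (inL D p) = f p.
Proof. by rewrite ffunE side_inL. Qed.

Lemma glue_funR A f g q : @glue_fun A f g (inR D q) = g q.
Proof. by rewrite ffunE side_inR. Qed.

Definition glue_set (O : {set vertex t}) (O' : {set vertex S}) : {set vertex T} :=
  [set v | match side D v with inl p => p \in O | inr q => q \in O' end].

Lemma glue_setL O O' p : (inL D p \in glue_set O O') = (p \in O).
Proof. by rewrite inE side_inL. Qed.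

Lemma glue_setR O O' q : (inR D q \in glue_set O O') = (q \in O').
Proof. by rewrite inE side_inR. Qed.

Lemma inL_root p : (inL D p == root T) = false.
Proof. by rewrite -(inR_root D); apply/eqP/inLR. Qed.

Lemma inR_eq_root q : (inR D q == root T) = (q == root S).
Proof. by rewrite -(inR_root D) (inj_eq (@inR_inj _ _ _ D)). Qed.

Definition glue_flow (F : flow_data t) (F' : flow_data S) : flow_data T :=
  (glue_set F.1.1 F'.1.1, glue_fun F.1.2 F'.1.2,
   glue_fun F.2 (upd F'.2 (F'.2 (root S) + F.2 (root t)))).

Lemma glue_flow_size F F' : flow_size (glue_flow F F') = (flow_size F + flow_size F')%N.
Proof.
rewrite /flow_size -!sum1_card (big_vertex_split (V := nat)) /=.
by congr (_ + _)%N; apply: eq_bigl => v; rewrite ?glue_setL ?glue_setR.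
Qed.

Lemma sum_childL (r : vertex T -> nat) p :
  (\sum_(w | is_child w (inL D p)) r w = \sum_(p' | is_child p' p) r (inL D p'))%N.
Proof.
rewrite (big_vertex_split (V := nat)) [X in (_ + X)%R]big1 ?addr0; last first.
  by move=> q; rewrite child_RL.
by apply: eq_bigl => p'; rewrite child_LL.
Qed.

Lemma sum_childR (r : vertex T -> nat) q :
  (\sum_(w | is_child w (inR D q)) r w =
   (q == root S) * r (inL D (root t)) + \sum_(q' | is_child q' q) r (inR D q'))%N.
Proof.
rewrite (big_vertex_split (V := nat)); congr (_ + _)%N; last first.
  by apply: eq_bigl => q'; rewrite child_RR.
rewrite (eq_bigl (fun p => (p == root t) && (q == root S))); last first.
  by move=> p; rewrite child_LR.
case: (q == root S); last by rewrite mul0n big_pred0 // => p; rewrite andbF.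
by rewrite (big_pred1 (root t)) ?mul1n // => p; rewrite andbT.
Qed.

Lemma glueF_inert a s F F' : (d <= a)%N -> is_flow_ge d a F -> is_inert_flow d s F' ->
  is_inert_flow d (a + s) (glue_flow F F').
Proof.
move=> da /is_flow_geP[h1 h2 h3 h4] /and3P[/is_flow_geP[k1 k2 k3 k4] rO m0].
rewrite /is_inert_flow /= -(inR_root D) glue_funR m0 glue_setR rO !andbT.
apply/is_flow_geP; split=> /=.
- move=> v; case: (splitP D v) => x; rewrite ?glue_setL ?glue_setR ?glue_funL ?glue_funR; [exact: h1|exact: k1].
- move=> v; case: (splitP D v) => x; rewrite ?glue_setL ?glue_setR ?glue_funL ?glue_funR.
    by rewrite sum_childL h2; congr (_ + _)%N; apply: eq_bigr => p _; rewrite glue_funL.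
  rewrite sum_childR glue_funL (eq_bigr (upd F'.2 (F'.2 (root S) + F.2 (root t)))); last first.
    by move=> q _; rewrite glue_funR.
  rewrite sum_upd; have [->|xr] := eqVneq x (root S).
    by rewrite updr addnAC k2 mul1n -addnA [(_ + F.2 _)%N]addnC.
  by rewrite updN // k2 mul0n.
- move=> v; case: (splitP D v) => x; rewrite ?glue_funL ?glue_funR ?inR_eq_root => xr.
    by have [->|/h3//] := eqVneq x (root t); rewrite h4.
  by rewrite updN // k3.
- by rewrite -(inR_root D) glue_funR updr h4 k4 addnC.
Qed.

Lemma unglue_flow s F : is_inert_flow d s F -> exists a F1 F2,
  [/\ (d <= a)%N, (a <= s)%N, is_flow_ge d a F1, is_inert_flow d (s - a) F2 & F = glue_flow F1 F2].
Proof.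
move=> /and3P[/is_flow_geP[h1 h2 h3 h4] rO /eqP m0].
pose F1 : flow_data t := ([set p | inL D p \in F.1.1], [ffun p => F.1.2 (inL D p)],
  [ffun p => F.2 (inL D p)]).
pose a := F.2 (inL D (root t)).
pose F2 : flow_data S := ([set p | inR D p \in F.1.1], [ffun p => F.1.2 (inR D p)],
  upd [ffun p => F.2 (inR D p)] (s - a)).
have sE : (s = a + \sum_(q' | is_child q' (root S)) F.2 (inR D q'))%N.
  have := h2 (root T); rewrite (negbTE rO) m0 h4 addn0 add0n => ->.
  by rewrite -(inR_root D) sum_childR eqxx mul1n.
exists a, F1, F2; split.
- by apply: h3; rewrite inL_root.
- by rewrite sE leq_addr.
- apply/is_flow_geP; split=> [p|p|p pr|] /=; rewrite ?ffunE ?inE.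
  + exact: h1.
  + by rewrite h2 sum_childL; congr (_ + _)%N; apply: eq_bigr => p' _; rewrite ffunE.
  + by apply: h3; rewrite inL_root.
  + by [].
- apply/and3P; split; rewrite /= ?inE ?ffunE ?inR_root ?m0 //.
  apply/is_flow_geP; split=> [q|q|q qr|] /=; rewrite ?updr // ?inE.
  + by rewrite ffunE; apply: h1.
  + rewrite sum_upd (eq_bigr (fun q' => F.2 (inR D q'))) => [|q' _]; last by rewrite ffunE.
    have [->|qr] := eqVneq q (root S); last first.
      by rewrite updN // !ffunE h2 sum_childR (negbTE qr).
    by rewrite updr ffunE inR_root (negbTE rO) m0 add0n addn0 {1}sE addKn.
  + by rewrite updN // ffunE h3 // inR_eq_root.
- rewrite /glue_flow /F1 /F2 /= {F1 F2}; rewrite /a {a} in sE *.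
  case: F h1 h2 h3 h4 rO m0 sE => [[O m] r] /= h1 h2 h3 h4 rO m0 sE.
  congr (_, _, _).
  + by apply/setP => v; case: (splitP D v) => x; rewrite ?glue_setL ?glue_setR inE.
  + by apply/ffunP => v; case: (splitP D v) => x; rewrite ?glue_funL ?glue_funR ffunE.
  + apply/ffunP => v; case: (splitP D v) => x; rewrite ?glue_funL ?glue_funR ?ffunE ?eqxx //.
    have [->|xr] := eqVneq x (root S); last by rewrite ?(negbTE xr).
    by rewrite inR_root h4 subnK // sE leq_addr.
Qed.

Lemma glue_flow_inj a a' s s' F1 F1' F2 F2' :
  is_flow_ge d a F1 -> is_flow_ge d a' F1' -> is_inert_flow d s F2 -> is_inert_flow d s' F2' ->
  glue_flow F1 F2 = glue_flow F1' F2' -> a = a' /\ (F1, F2) = (F1', F2').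
Proof.
move=> /is_flow_geP[_ _ _ f1] /is_flow_geP[_ _ _ f1'].
move=> /and3P[/is_flow_geP[_ _ _ f2] _ _] /and3P[/is_flow_geP[_ _ _ f2'] _ _].
case: F1 F1' F2 F2' f1 f1' f2 f2' => [[O m] r] [[O' m'] r'] [[P n] q] [[P' n'] q'] /=.
move=> f1 f1' f2 f2' [] /= eO em er.
have rE : r = r'.
  by apply/ffunP => x; have /ffunP/(_ (inL D x)) := er; rewrite !glue_funL.
have aE : a = a' by rewrite -f1 -f1' rE.
split=> //; rewrite rE; congr (_, _, _, (_, _, _)).
- by apply/setP => x; have /setP/(_ (inL D x)) := eO; rewrite !glue_setL.
- by apply/ffunP => x; have /ffunP/(_ (inL D x)) := em; rewrite !glue_funL.
- by apply/setP => x; have /setP/(_ (inR D x)) := eO; rewrite !glue_setR.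
- by apply/ffunP => x; have /ffunP/(_ (inR D x)) := em; rewrite !glue_funR.
- apply/ffunP => x; have /ffunP/(_ (inR D x)) := er; rewrite !glue_funR.
  have [->|xr] := eqVneq x (root S); last by rewrite !updN.
  by rewrite !updr rE => /addIn.
Qed.

(** A flow with inert root on [T] is a flow on the branch [t] together with a flow
    with inert root on the rest [S], and the rate of the edge below [t] adds to
    the exit rate; this edge is where the bound [d] matters. *)
Lemma inert_sum (f z : nat -> {poly rat}) s :
  (forall a, has_sum (@is_flow_ge d t a) (@flow_weight t) (f a)) ->
  (forall s, has_sum (@is_inert_flow d S s) (@flow_weight S) (z s)) ->
  has_sum (@is_inert_flow d T s) (@flow_weight T)
    (\sum_(a < s.+1) (if (d <= a)%N then f a else 0) * z (s - a)%N).
Proof.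
move=> fs zs.
have -> : \sum_(a < s.+1) (if (d <= a)%N then f a else 0) * z (s - a)%N
    = \sum_(a < s.+1) 1 * (if (d <= a)%N then f a * z (s - a)%N else 0).
  by apply: eq_bigr => a _; rewrite mul1r; case: ifP => // _; rewrite mul0r.
pose A a := fun FF : flow_data t * flow_data S =>
  if (d <= a)%N then is_flow_ge d a FF.1 && is_inert_flow d (s - a)%N FF.2 else false.
apply: (has_sum_union (X := (flow_data t * flow_data S)%type) (A := A)
  (f := fun _ FF => glue_flow FF.1 FF.2)
  (w := fun FF => flow_weight FF.1 * flow_weight FF.2) (k := fun=> 1)
  (v := fun a => if (d <= a)%N then f a * z (s - a)%N else 0)).
- move=> a _; rewrite /A; case: ifP => da; last exact: has_sum0.
  exact: has_sum_pair (fs a) (zs _).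
- by move=> a [F1 F2] _ _; rewrite mul1r /flow_weight glue_flow_size exprD.
- move=> a [F1 F2]; rewrite /A ltnS => sa; case: ifP => // da /andP[F1m F2z].
  by rewrite -(subnKC sa); apply: glueF_inert.
- move=> F /unglue_flow[a [F1 [F2 [da sa F1m F2z FE]]]]; exists a, (F1, F2); split=> //.
  by rewrite /A da; apply/andP.
- move=> a a' [F1 F2] [F1' F2']; rewrite /A; do 2!case: ifP => // _.
  move=> /andP[m1 z1] /andP[m2 z2].
  exact: glue_flow_inj m1 m2 z1 z2.
Qed.

End FlowGlue.

(** * Formal power series *)

Lemma coefD (f g : K) n : fps_coef (f + g) n = fps_coef f n + fps_coef g n.
Proof. by []. Qed.

Lemma coefB (f g : K) n : fps_coef (f - g) n = fps_coef f n - fps_coef g n.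
Proof. by []. Qed.

Lemma coef_mul (f g : K) n :
  fps_coef (f * g) n = \sum_(i < n.+1) fps_coef f i * fps_coef g (n - i).
Proof. by []. Qed.

Lemma coef_C (c : {poly rat}) (f : K) n : fps_coef ((fpsC c : K) * f) n = c * fps_coef f n.
Proof.
rewrite coef_mul big_ord_recl /= subn0 big1 ?addr0 // => i _.
by rewrite mul0r.
Qed.

Lemma coef_bK (f : K) n : fps_coef (bK * f) n = 'X * fps_coef f n.
Proof. exact: coef_C. Qed.

Lemma coef_tK0 (f : K) : fps_coef (tK * f) 0 = 0.
Proof. by rewrite coef_mul big_ord_recl big_ord0 /= mul0r addr0. Qed.

Lemma coef_tKS (f : K) n : fps_coef (tK * f) n.+1 = fps_coef f n.
Proof.
rewrite coef_mul big_ord_recl /= mul0r add0r big_ord_recl /= mul1r subSS subn0.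
by rewrite big1 ?addr0 // => i _; rewrite mul0r.
Qed.

Lemma coef_geomK (f : K) n : fps_coef (geomK * f) n = \sum_(i < n.+1) fps_coef f i.
Proof. by rewrite mulrC coef_mul; apply: eq_bigr => i _; rewrite mulr1. Qed.

Lemma tK_inj (f g : K) : tK * f = tK * g -> f = g.
Proof. by move=> e; apply: fpsP => n; rewrite -(coef_tKS f) -(coef_tKS g) e. Qed.

Lemma bK_inj (f g : K) : bK * f = bK * g -> f = g.
Proof.
move=> e; apply: fpsP => n; apply: (@mulfI _ 'X); first by rewrite polyX_eq0.
by rewrite -!coef_bK e.
Qed.

Lemma at_t0_is_zmod_morphism : zmod_morphism at_t0.
Proof. by move=> f g; apply: fpsP => -[|n] //=; rewrite oppr0 addr0. Qed.

Lemma at_t0_is_monoid_morphism : monoid_morphism at_t0.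
Proof.
split; first by apply: fpsP => -[].
move=> f g; apply: fpsP => n; rewrite [RHS]coef_C.
by case: n => [|n]; rewrite /= ?mulr0 // big_ord1.
Qed.

HB.instance Definition _ := GRing.isZmodMorphism.Build K K at_t0 at_t0_is_zmod_morphism.
HB.instance Definition _ := GRing.isMonoidMorphism.Build K K at_t0 at_t0_is_monoid_morphism.

Lemma ratK_is_zmod_morphism : zmod_morphism ratK.
Proof.
by move=> p q; apply: fpsP => -[|n] /=; rewrite ?rmorphB // oppr0 addr0.
Qed.

Lemma ratK_is_monoid_morphism : monoid_morphism ratK.
Proof.
split; first by apply: fpsP => -[].
move=> p q; apply: fpsP => n; rewrite [RHS]coef_C.
by case: n => [|n]; rewrite /= ?mulr0 // rmorphM.
Qed.

HB.instance Definition _ := GRing.isZmodMorphism.Build rat K ratK ratK_is_zmod_morphism.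
HB.instance Definition _ := GRing.isMonoidMorphism.Build rat K ratK ratK_is_monoid_morphism.

Lemma ratK_mulVn n : (0 < n)%N -> ratK (n%:R^-1) * n%:R = 1.
Proof.
move=> n0; rewrite -(rmorph_nat ratK) -rmorphM /= mulVf ?rmorph1 //.
by rewrite Num.Theory.pnatr_eq0 -lt0n.
Qed.

Lemma natK_inj n (f g : K) : (0 < n)%N -> n%:R * f = n%:R * g -> f = g.
Proof.
move=> n0 /(congr1 (fun h : K => ratK n%:R^-1 * h)).
by rewrite !mulrA ratK_mulVn // !mul1r.
Qed.

Lemma at_t0_ratK q : at_t0 (ratK q) = ratK q.
Proof. by apply: fpsP => -[]. Qed.

Lemma at_t0_tK : at_t0 tK = 0.
Proof. by apply: fpsP => -[]. Qed.

Lemma at_t0_bK : at_t0 bK = bK.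
Proof. by apply: fpsP => -[]. Qed.

Lemma at_t0_geomK : at_t0 geomK = 1.
Proof. by apply: fpsP => -[]. Qed.

Lemma at_t0_idem f : at_t0 (at_t0 f) = at_t0 f.
Proof. by apply: fpsP => -[]. Qed.

Lemma tgeomK : tK * geomK = geomK - 1.
Proof.
have : (1 - tK) * geomK = 1 by exact: fps_geomP.
by rewrite mulrBl mul1r => e; rewrite -[in RHS]e opprB addrC subrK.
Qed.

(** The factor [t / (1 - t) + b] by which a vertex acts on the incoming rate. *)
Definition cK : K := tK * geomK + bK.

(** * Recursions for flow series *)

Definition flow_ge_series d T : K :=
  Fps (fun e => \sum_(F \in [set F | @is_flow_ge d T e F]%classic) flow_weight F).

Definition inert_series d T : K :=
  Fps (fun e => \sum_(F \in [set F | @is_inert_flow d T e F]%classic) flow_weight F).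

Definition drop_below d (f : K) : K := Fps (fun a => if (d <= a)%N then fps_coef f a else 0).

Lemma inert_sum_leaf d s :
  has_sum (@is_inert_flow d leafT s) (@flow_weight leafT) (s == 0%N)%:R.
Proof.
have vr (v : vertex leafT) : v = root leafT.
  by apply: val_inj; case: v => p /=; rewrite inE => /eqP.
have sum0 (F : {ffun vertex leafT -> nat}) v : (\sum_(w | is_child w v) F w = 0)%N.
  by rewrite big_pred0 // => w; rewrite (vr w) is_child_root.
pose F0 : flow_data leafT := (finset.set0, [ffun=> 0%N], [ffun=> 0%N]).
have w0 : flow_weight F0 = 1 by rewrite /flow_weight /flow_size cards0 expr0.
case: s => [|s]; last first.
  apply: has_sum0 => F; apply/negP => /and3P[/is_flow_geP[_ h2 _ h4] rO /eqP m0].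
  by have := h2 (root leafT); rewrite (negbTE rO) m0 h4 sum0.
rewrite -[_%:R]w0; apply: has_sum1 => F; apply/idP/eqP => [|->].
  move=> /and3P[/is_flow_geP[_ h2 _ h4] rO /eqP m0].
  case: F h2 h4 rO m0 => [[O m] r] /= h2 h4 rO m0; congr (_, _, _).
  - by apply/setP => v; rewrite (vr v) (negbTE rO) inE.
  - by apply/ffunP => v; rewrite (vr v) m0 ffunE.
  - by apply/ffunP => v; rewrite (vr v) h4 ffunE.
apply/and3P; split; rewrite /= ?inE ?ffunE //; apply/is_flow_geP; split=> [v|v|v|] /=;
  by rewrite ?inE ?ffunE ?sum0 // (vr v) eqxx.
Qed.

Lemma flow_sums d T :
  (forall e, has_sum (@is_flow_ge d T e) (@flow_weight T) (fps_coef (flow_ge_series d T) e)) /\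
  (forall e, has_sum (@is_inert_flow d T e) (@flow_weight T) (fps_coef (inert_series d T) e)).
Proof.
have can (X : choiceType) (A : pred X) (w : X -> {poly rat}) v :
    has_sum A w v -> has_sum A w (\sum_(x \in [set x | A x]%classic) w x).
  by move=> h; rewrite (has_sum_fsbig h).
suff zs : forall e, has_sum (@is_inert_flow d T e) (@flow_weight T) (fps_coef (inert_series d T) e).
  by split=> // e; apply: (can _ _ _ _ (flow_ge_sum e zs)).
elim/otree_ind_children: T => ts; elim: ts => [|t ts IH] IHt e.
  exact: (can _ _ _ _ (inert_sum_leaf d e)).
have D := @splitting_at (t :: ts) 0 isT; rewrite /del_nth /= drop0 in D.
have zS : forall e, has_sum (@is_inert_flow d (ONode ts) e) (@flow_weight _)
    (fps_coef (inert_series d (ONode ts)) e).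
  by apply: IH => u uts; apply: IHt; rewrite inE uts orbT.
apply: (can _ _ _ _ (inert_sum D e _ zS)) => a.
by apply: (can _ _ _ _ (flow_ge_sum a (IHt t _))); rewrite mem_head.
Qed.

Lemma inert_series_leaf d : inert_series d leafT = 1.
Proof. by apply: fpsP => e /=; rewrite (has_sum_fsbig (inert_sum_leaf d e)); case: e. Qed.

Lemma inert_series_cons d t ts :
  inert_series d (ONode (t :: ts)) = drop_below d (flow_ge_series d t) * inert_series d (ONode ts).
Proof.
have D := @splitting_at (t :: ts) 0 isT; rewrite /del_nth /= drop0 in D.
apply: fpsP => e; rewrite coef_mul /=.
exact: has_sum_fsbig (inert_sum D e (flow_sums d t).1 (flow_sums d (ONode ts)).2).
Qed.

Lemma inert_seriesE d ts : inert_series d (ONode ts) = \prod_(t <- ts) drop_below d (flow_ge_series d t).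
Proof.
elim: ts => [|t ts IH]; first by rewrite big_nil inert_series_leaf.
by rewrite inert_series_cons big_cons IH.
Qed.

(** Either the root creates some flow, which multiplies the series of the
    incoming rates by [1 / (1 - t)], or it is an output, which divides the part
    with positive rate by [t]. *)
Lemma flow_ge_seriesE d T : tK * flow_ge_series d T = cK * inert_series d T - bK * at_t0 (inert_series d T).
Proof.
apply: fpsP => -[|e]; rewrite /cK mulrDl -mulrA coefB coefD !coef_bK.
  by rewrite !coef_tK0 add0r subrr.
rewrite !coef_tKS coef_geomK mulr0 subr0.
exact: has_sum_fsbig (flow_ge_sum e (flow_sums d T).2).
Qed.

Lemma flow_seriesE T : flow_series T = flow_ge_series 0 T.
Proof.
apply: fpsP => e /=; apply: eq_fsbigl; apply/seteqP; split=> F /=.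
  by move=> [Ff /eqP Fe]; apply/and3P; split=> //; apply/forallP => v; rewrite implybT.
by move=> /and3P[Ff _ /eqP Fe].
Qed.

Lemma cflow_seriesE T : cflow_series T = flow_ge_series 1 T.
Proof.
apply: fpsP => e /=; apply: eq_fsbigl; apply/seteqP; split=> F /=.
  by move=> [Ff Fc /eqP Fe]; apply/and3P.
by move=> /and3P[Ff Fc /eqP Fe].
Qed.

Lemma drop_below0 f : drop_below 0 f = f.
Proof. by apply: fpsP. Qed.

Lemma drop_below1 f : drop_below 1 f = f - at_t0 f.
Proof. by apply: fpsP => -[|n] /=; rewrite ?subrr ?subr0. Qed.

(** * Flows on chains *)

Lemma ca_t1 : ca_t 1 = geomK.
Proof.
apply: tK_inj; rewrite /ca_t flow_seriesE flow_ge_seriesE inert_series_leaf rmorph1 /cK; ring.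
Qed.

(** A chain is a root with one branch, and no bound is put on the rates. *)
Lemma ca_tS k : tK * ca_t k.+2 = cK * ca_t k.+1 - bK * at_t0 (ca_t k.+1).
Proof. by rewrite /ca_t !flow_seriesE flow_ge_seriesE inert_seriesE big_seq1 drop_below0. Qed.

Lemma at_t0_ca1 : at_t0 (ca_t 1) = 1.
Proof. by rewrite ca_t1 at_t0_geomK. Qed.

Definition conv (f g : nat -> K) k := \sum_(1 <= i < k) f i * g (k - i)%N.

Lemma conv1 f g : conv f g 1 = 0.
Proof. by rewrite /conv big_geq. Qed.

Lemma convC f g k : conv f g k = conv g f k.
Proof.
rewrite /conv big_nat_rev /= big_nat [RHS]big_nat; apply: eq_bigr => i /andP[i1 ik].
by rewrite add1n subSS subKn ?(ltnW ik) // mulrC.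
Qed.

Lemma at_t0_conv f g k :
  at_t0 (conv f g k) = conv (fun i => at_t0 (f i)) (fun i => at_t0 (g i)) k.
Proof. by rewrite rmorph_sum; apply: eq_bigr => i _; rewrite rmorphM. Qed.

Lemma conv_caS k : tK * conv ca0 ca_t k.+2 =
  at_t0 (ca_t k.+1) * (geomK - 1) + cK * conv ca0 ca_t k.+1 - bK * conv ca0 ca0 k.+1.
Proof.
rewrite /conv big_nat_recr //= subSnn ca_t1 mulrDr mulrCA tgeomK addrC -addrA.
congr (_ + _); rewrite !mulr_sumr -sumrB big_nat [RHS]big_nat.
apply: eq_bigr => i /andP[i1 ik]; rewrite subSn; last by lia.
have -> : (k.+1 - i = (k - i).+1)%N by lia.
by rewrite mulrCA ca_tS mulrBr; congr (_ - _); rewrite mulrCA.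
Qed.

(** With [A] the generating series of the [ca_t k] and [A0] that of their values
    at [t = 0], the first relation is [(1 - t) A = A0 (1 + t A)], which is how the
    kernel method solves [ca_tS]. By [ca_tS] it is equivalent to the second one,
    and the second one in rank [k], together with its value at [t = 0], gives the
    first one in rank [k + 1]. *)
Lemma ca_conv k :
  (1 - tK) * ca_t k.+1 = at_t0 (ca_t k.+1) + tK * conv ca0 ca_t k.+1 /\
  ca_t k.+2 = (geomK + bK) * ca_t k.+1 + bK * conv ca0 ca_t k.+1.
Proof.
have step j : (1 - tK) * ca_t j.+1 = at_t0 (ca_t j.+1) + tK * conv ca0 ca_t j.+1 ->
    ca_t j.+2 = (geomK + bK) * ca_t j.+1 + bK * conv ca0 ca_t j.+1.
  move=> h; apply: tK_inj; rewrite ca_tS.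
  have -> : at_t0 (ca_t j.+1) = (1 - tK) * ca_t j.+1 - tK * conv ca0 ca_t j.+1.
    by rewrite h addrK.
  rewrite /cK; ring.
elim: k => [|k [IH1 IH2]].
  have h : (1 - tK) * ca_t 1 = at_t0 (ca_t 1) + tK * conv ca0 ca_t 1.
    by rewrite conv1 at_t0_ca1 mulr0 addr0 ca_t1 fps_geomP.
  by split=> //; apply: step.
have h : (1 - tK) * ca_t k.+2 = at_t0 (ca_t k.+2) + tK * conv ca0 ca_t k.+2.
  have h0 : at_t0 (ca_t k.+2) = (1 + bK) * at_t0 (ca_t k.+1) + bK * conv ca0 ca0 k.+1.
    rewrite IH2 rmorphD !rmorphM rmorphD /= at_t0_geomK at_t0_bK at_t0_conv.
    congr (_ + _ * _); apply: eq_bigr => i _; congr (_ * _); exact: at_t0_idem.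
  have h1 : tK * conv ca0 ca_t k.+1 = (1 - tK) * ca_t k.+1 - at_t0 (ca_t k.+1).
    by rewrite IH1 addrC addKr.
  apply: tK_inj; rewrite mulrCA ca_tS conv_caS h0 /cK tgeomK.
  move: (ca_t _) (at_t0 _) (conv ca0 ca_t _) (conv ca0 ca0 _) h1 => a a0 q q0 h1.
  apply/eqP; rewrite -subr_eq0; apply/eqP.
  transitivity ((geomK - 1 + bK) * ((1 - tK) * a - a0 - tK * q)
    + (geomK - 1 - tK * geomK) * a0); first by ring.
  by rewrite h1 tgeomK !subrr mulr0 mul0r addr0.
by split=> //; apply: step.
Qed.

(** * Word series *)

Lemma wmulE f g w : wmul f g w = \sum_(i < (size w).+1) f (take i w) * g (drop i w).
Proof. by []. Qed.

Lemma wmul_nil f g : wmul f g [::] = f [::] * g [::].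
Proof. by rewrite /wmul big_ord1. Qed.

Lemma wmul_cons f g a w :
  wmul f g (a :: w) = f [::] * g (a :: w) + wmul (fun u => f (a :: u)) g w.
Proof. by rewrite /wmul big_ord_recl. Qed.

Lemma wmulDl f f' g w : wmul (fun u => f u + f' u) g w = wmul f g w + wmul f' g w.
Proof. by rewrite -big_split; apply: eq_bigr => i _; rewrite mulrDl. Qed.

Lemma wmulZl c f g w : wmul (fun u => c * f u) g w = c * wmul f g w.
Proof. by rewrite [RHS]big_distrr; apply: eq_bigr => i _; rewrite /= mulrA. Qed.

Lemma wmulA f g h w : wmul (wmul f g) h w = wmul f (wmul g h) w.
Proof.
elim: w f g => [|a w IH] f g; first by rewrite !wmul_nil mulrA.
rewrite !wmul_cons wmul_nil.
have -> : (fun u => wmul f g (a :: u)) =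
    (fun u => f [::] * g (a :: u) + wmul (fun u => f (a :: u)) g u).
  by apply/funext => u; rewrite wmul_cons.
rewrite wmulDl wmulZl IH; ring.
Qed.

Lemma wone_mul g w : wmul wone g w = g w.
Proof.
case: w => [|a w]; first by rewrite wmul_nil mul1r.
rewrite wmul_cons mul1r /wmul big1 ?addr0 // => i _.
by rewrite mul0r.
Qed.

Lemma letter_mul0 a c h w : ohead w != Some a -> wmul (letter_series a c) h w = 0.
Proof.
case: w => [|x w] /= xa; first by rewrite wmul_nil mul0r.
rewrite wmul_cons mul0r add0r /wmul big1 // => i _.
by rewrite /letter_series /= (negbTE (_ : x != a)) ?mul0r.
Qed.

(** The left factor has to be a nonempty part of the initial run of [a], and the
    rest must not start with [a]: the only cut is at the end of the run. *)
Lemma letter_mul a c h k w : (0 < k)%N -> ohead w != Some a ->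
  (forall u, h (a :: u) = 0) ->
  wmul (letter_series a c) h (nseq k a ++ w) = c k * h w.
Proof.
move=> k0 wa h0; have kw : (k < (size (nseq k a ++ w)).+1)%N.
  by rewrite size_cat size_nseq ltnS leq_addr.
rewrite /wmul (bigD1 (Ordinal kw)) //= take_size_cat ?size_nseq //.
rewrite drop_size_cat ?size_nseq // /letter_series all_nseq size_nseq /= eqxx orbT.
rewrite -size_eq0 size_nseq -lt0n k0 big1 ?addr0 // => i ik.
have {}ik : (i : nat) != k by rewrite -(inj_eq val_inj) in ik.
case: (ltngtP i k) ik => // ik _.
  rewrite drop_cat size_nseq ik drop_nseq.
  by case E: (k - i)%N => [|n]; [lia|rewrite h0 mulr0].
have iw : (i <= k + size w)%N by have := ltn_ord i; rewrite [X in (_ < X.+1)%N]size_cat size_nseq ltnS.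
move: (nat_of_ord i) ik iw => j kj jw; rewrite take_cat size_nseq ltnNge (ltnW kj) /= all_cat.
case: w wa {kw i} jw => [|x w] xa jw; first by rewrite /= in jw; lia.
case E: (j - k)%N => [|n]; first by lia.
by rewrite /= (negbTE (_ : x != a)) // !andbF mul0r.
Qed.

Lemma PN_nil : wmul P_s N_s [::] = 0.
Proof. by rewrite wmul_nil mul0r. Qed.

Lemma wexp_small k w : (size w < k)%N -> wexp (wmul P_s N_s) k w = 0.
Proof.
elim: k w => // k IH w wk; rewrite /wexp iterS wmulE big1 // => i _.
case: i => -[|i] /= iw; first by rewrite take0 PN_nil mul0r.
rewrite [iter _ _ _ _]IH ?mulr0 // size_drop; lia.
Qed.

Lemma T_sE n w : (size w <= n)%N ->
  T_s w = \sum_(k < n.+1) bK ^+ k * wexp (wmul P_s N_s) k w.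
Proof.
move=> wn; rewrite /T_s (big_ord_widen _ (fun k => bK ^+ k * wexp (wmul P_s N_s) k w) (_ : (size w).+1 <= n.+1)%N) //.
rewrite [RHS](bigID (fun k : 'I_n.+1 => (k < (size w).+1)%N)) /= [X in _ + X]big1 ?addr0 //.
by move=> k; rewrite -leqNgt => /wexp_small->; rewrite mulr0.
Qed.

(** [T] is the geometric series [1 / (1 - b P N)]. *)
Lemma T_s_fix w : T_s w = wone w + bK * wmul (wmul P_s N_s) T_s w.
Proof.
rewrite /T_s big_ord_recl expr0 mul1r; congr (_ + _).
under eq_bigr => k _ do rewrite /= exprS -mulrA /bump /=.
rewrite -big_distrr; congr (_ * _).
transitivity (\sum_(k < size w) \sum_(i < (size w).+1)
    wmul P_s N_s (take i w) * (bK ^+ k * wexp (wmul P_s N_s) k (drop i w))).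
  apply: eq_bigr => k _; rewrite wmulE big_distrr.
  by apply: eq_bigr => i _; rewrite mulrCA.
rewrite exchange_big; apply: eq_bigr => i _; rewrite -big_distrr.
case: i => -[|i] /= iw; first by rewrite take0 PN_nil !mul0r.
congr (_ * _); case: w iw => [|x w] iw; first by [].
by rewrite -(@T_sE (size w)) //= size_drop leq_subr.
Qed.

Lemma TG_fix g w : wmul T_s g w = g w + bK * wmul P_s (wmul N_s (wmul T_s g)) w.
Proof.
have {1}-> : T_s = fun u => wone u + bK * wmul (wmul P_s N_s) T_s u.
  by apply/funext => u; apply: T_s_fix.
by rewrite wmulDl wone_mul wmulZl wmulA wmulA.
Qed.

(** The common shape of [N_t T P], [N T P_t] and [N T P]. *)
Definition mTp (f g : nat -> K) : wseries :=
  wmul (wmul (letter_series Lm f) T_s) (letter_series Lp g).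

Section MTP.
Variables f g : nat -> K.

Let H := wmul T_s (letter_series Lp g).

Lemma mTpE w : mTp f g w = wmul (letter_series Lm f) H w.
Proof. exact: wmulA. Qed.

Let H_fix w : H w = letter_series Lp g w + bK * wmul P_s (wmul N_s H) w.
Proof. exact: TG_fix. Qed.

Let H_m u : H (Lm :: u) = 0.
Proof. by rewrite H_fix /P_s letter_mul0 // mulr0 addr0. Qed.

Let H_nil : H [::] = 0.
Proof. by rewrite H_fix /P_s letter_mul0 // mulr0 addr0. Qed.

Lemma mTp_p u : mTp f g (Lp :: u) = 0.
Proof. by rewrite mTpE letter_mul0. Qed.

Lemma mTp_m : mTp f g [:: Lm] = 0.
Proof. by rewrite mTpE (@letter_mul _ _ _ 1 [::]) // H_nil mulr0. Qed.

Let NH_p u : wmul N_s H (Lp :: u) = 0.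
Proof. by rewrite /N_s letter_mul0. Qed.

Lemma mTp_block a k : (0 < a)%N -> (0 < k)%N ->
  mTp f g (nseq a Lm ++ nseq k Lp) = f a * g k.
Proof.
move=> a0 k0; rewrite mTpE letter_mul //; last by case: k k0.
congr (_ * _); rewrite H_fix -[in wmul _ _ _](cats0 (nseq k Lp)) letter_mul //.
rewrite /N_s letter_mul0 // !mulr0 addr0 /letter_series all_nseq size_nseq /= eqxx orbT.
by rewrite -size_eq0 size_nseq -lt0n k0.
Qed.

Lemma mTp_cat a k v : (0 < a)%N -> (0 < k)%N ->
  mTp f g (nseq a Lm ++ nseq k Lp ++ Lm :: v) =
  bK * (f a * at_t0 (ca_t k)) * wmul N_s H (Lm :: v).
Proof.
move=> a0 k0; rewrite mTpE letter_mul //; last by case: k k0.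
rewrite H_fix letter_mul // /letter_series all_cat /= !andbF add0r; ring.
Qed.

End MTP.

Lemma mTp_catE f g a k v : (0 < a)%N -> (0 < k)%N ->
  mTp f g (nseq a Lm ++ nseq k Lp ++ Lm :: v) =
  bK * (f a * at_t0 (ca_t k)) * mTp (nca ca0) g (Lm :: v).
Proof. by move=> a0 k0; rewrite mTp_cat // mTpE. Qed.

(** * The product of canopy series *)

(** What cutting a tree at a leaf does to its sequence of leaf letters: the cut
    leaf is the rightmost one on the left and the leftmost one on the right. *)
Fixpoint wcuts (w : seq letter) : seq (seq letter * seq letter) :=
  if w is a :: w' then ([:: Lp], Lm :: w') :: [seq (a :: c.1, c.2) | c <- wcuts w']
  else [::].

Definition wstar (f g : wseries) : wseries :=
  fun w => \sum_(c <- wcuts w) f c.1 * g c.2.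

Lemma wcuts_cat u v :
  wcuts (u ++ v) = [seq (c.1, c.2 ++ v) | c <- wcuts u] ++ [seq (u ++ c.1, c.2) | c <- wcuts v].
Proof.
elim: u => [|a u IH] /=; first by rewrite -[LHS]map_id; apply: eq_map => -[].
by rewrite IH map_cat -!map_comp.
Qed.

Lemma wcuts_nseqm a :
  wcuts (nseq a Lm) = [seq (nseq i Lm ++ [:: Lp], nseq (a - i) Lm) | i <- iota 0 a].
Proof.
elim: a => //= a IH; congr cons.
by rewrite IH (iotaDl 1) -!map_comp; apply: eq_map => i /=.
Qed.

Lemma wcuts_nseqp k :
  wcuts (nseq k.+1 Lp) = [seq (nseq i.+1 Lp, Lm :: nseq (k - i) Lp) | i <- iota 0 k.+1].
Proof.
have wcuts_cons b w : wcuts (b :: w)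
    = ([:: Lp], Lm :: w) :: [seq (b :: c.1, c.2) | c <- wcuts w] by [].
elim: k => // k IH; rewrite -[nseq k.+2 _]/(Lp :: nseq k.+1 Lp) wcuts_cons IH.
rewrite [iota 0 k.+2]/= -/(iota 1 k.+1) [in RHS]map_cons; congr cons.
by rewrite (iotaDl 1) -!map_comp; apply: eq_map => i.
Qed.

Lemma sum_iota1 (F : nat -> K) k : (0 < k)%N -> F 0 = 0 ->
  \sum_(i <- iota 0 k) F i = \sum_(1 <= i < k) F i.
Proof.
by case: k => // k _ F0; rewrite iota0E big_ltn // F0 add0r.
Qed.

Lemma sum_cuts_block (F : seq letter -> seq letter -> K) a k : (0 < a)%N ->
  (forall v, F [:: Lp] v = 0) ->
  \sum_(c <- wcuts (nseq a Lm ++ nseq k.+1 Lp)) F c.1 c.2 =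
  \sum_(1 <= i < a) F (nseq i Lm ++ nseq 1 Lp) (nseq (a - i) Lm ++ nseq k.+1 Lp) +
  \sum_(1 <= i < k.+1) F (nseq a Lm ++ nseq i Lp) (nseq 1 Lm ++ nseq (k.+1 - i) Lp) +
  F (nseq a Lm ++ nseq k.+1 Lp) [:: Lm].
Proof.
move=> a0 Fp; rewrite wcuts_cat wcuts_nseqm wcuts_nseqp big_cat !big_map sum_iota1 ?Fp //= -addrA.
congr (_ + _); rewrite -/(iota 0 k.+1) (_ : iota 0 k.+1 = iota 0 k ++ [:: k]); last first.
  by rewrite -addn1 iotaD.
rewrite big_cat big_seq1 subnn; congr (_ + _).
rewrite big_add1 /= iota0E; apply: eq_bigr => i _.
by rewrite subSS.
Qed.

(** Every word that starts with m and ends with p is a product of blocks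
    [m^a p^k], and [mTp] is computed block by block. *)
Inductive mpword : seq letter -> Prop :=
  | MpBlock a k : mpword (nseq a.+1 Lm ++ nseq k.+1 Lp)
  | MpCat a k v : mpword v -> mpword (nseq a.+1 Lm ++ nseq k.+1 Lp ++ v).

Lemma mpword_m v : mpword v -> exists u, v = Lm :: u.
Proof. by case=> *; eexists. Qed.

Section KeyIdentity.

(** The recursions of the coefficients of [N_t] and [P_t]; [lam] is
    [1 / (1 - t) + b] for them, and [1 + b] at [t = 0]. *)
Definition rec_m (f : nat -> K) (lam : K) :=
  forall a, bK * conv f (nca ca0) a.+1 = - f a.+2 - lam * f a.+1.
Definition rec_p (g : nat -> K) (mu : K) :=
  forall k, bK * conv ca0 g k.+1 = g k.+2 - mu * g k.+1.

Hypothesis rec_m0 : rec_m (nca ca0) (1 + bK).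
Hypothesis rec_p0 : rec_p ca0 (1 + bK).

Lemma key_block f g lam mu a k : rec_m f lam -> rec_p g mu ->
  let w := nseq a.+1 Lm ++ nseq k.+1 Lp in
  bK * wstar (mTp f ca0) (mTp (nca ca0) g) w =
  - mTp f g (Lm :: w) - mTp f g (rcons w Lp) + (mu - lam) * mTp f g w.
Proof.
move=> hf hg w; rewrite /wstar (@sum_cuts_block (fun x y => mTp f ca0 x * mTp (nca ca0) g y)) //; last first.
  by move=> v; rewrite mTp_p mul0r.
rewrite mTp_m mulr0 addr0.
have -> : Lm :: w = nseq a.+2 Lm ++ nseq k.+1 Lp by [].
have -> : rcons w Lp = nseq a.+1 Lm ++ nseq k.+2 Lp.
  by rewrite /w -cats1 -catA (_ : [:: Lp] = nseq 1 Lp) // -nseqD addn1.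
rewrite !mTp_block //.
have -> : \sum_(1 <= i < a.+1) mTp f ca0 (nseq i Lm ++ nseq 1 Lp) *
     mTp (nca ca0) g (nseq (a.+1 - i) Lm ++ nseq k.+1 Lp) = conv f (nca ca0) a.+1 * g k.+1.
  rewrite /conv mulr_suml big_nat [RHS]big_nat; apply: eq_bigr => i /andP[i1 ia].
  by rewrite !mTp_block ?subn_gt0 // at_t0_ca1 mulr1 mulrA.
have -> : \sum_(1 <= i < k.+1) mTp f ca0 (nseq a.+1 Lm ++ nseq i Lp) *
     mTp (nca ca0) g (nseq 1 Lm ++ nseq (k.+1 - i) Lp) = - (f a.+1 * conv ca0 g k.+1).
  rewrite /conv mulr_sumr -sumrN big_nat [RHS]big_nat; apply: eq_bigr => i /andP[i1 ia].
  rewrite !mTp_block ?subn_gt0 // at_t0_ca1 /=; ring.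
rewrite mulrDr mulrA hf mulrN mulrCA hg; ring.
Qed.

(** On a word [u v] whose first block is [u], a cut inside [u] or inside [v] leaves
    the other factor untouched, and is accounted for by the identity for [u] or
    for [v]. The two cuts next to the boundary give the words [u p] and [m v];
    their contributions cancel against the same words in these identities. *)
Lemma key_identity f g lam mu w : rec_m f lam -> rec_p g mu -> mpword w ->
  bK * wstar (mTp f ca0) (mTp (nca ca0) g) w =
  - mTp f g (Lm :: w) - mTp f g (rcons w Lp) + (mu - lam) * mTp f g w.
Proof.
move=> hf hg hw; elim: hw f lam hf => [a k|a k v hv IH] f lam hf; first exact: key_block.
have [v' vE] := mpword_m hv.
set u := nseq a.+1 Lm ++ nseq k.+1 Lp.
rewrite catA -/u.
have catE f' g' x : mTp f' g' (u ++ Lm :: x) = bK * mTp f' ca0 u * mTp (nca ca0) g' (Lm :: x).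
  by rewrite /u -catA mTp_catE // mTp_block.
have -> : wstar (mTp f ca0) (mTp (nca ca0) g) (u ++ v) =
    bK * wstar (mTp f ca0) (mTp (nca ca0) ca0) u * mTp (nca ca0) g v
    + mTp f ca0 u * mTp (nca ca0) g (Lm :: v)
    + (mTp f ca0 (rcons u Lp) * mTp (nca ca0) g v
       + bK * mTp f ca0 u * wstar (mTp (nca ca0) ca0) (mTp (nca ca0) g) v).
  rewrite /wstar wcuts_cat big_cat !big_map /=; congr (_ + _); last first.
    rewrite vE /= !big_cons mTp_p mul0r add0r -vE cats1; congr (_ + _).
    rewrite !big_map /= mulr_sumr; apply: eq_bigr => c _.
    by rewrite /= catE; ring.
  rewrite [LHS](@sum_cuts_block (fun x y => mTp f ca0 x * mTp (nca ca0) g (y ++ v)) a.+1 k) //; last first.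
    by move=> x; rewrite mTp_p mul0r.
  rewrite [X in _ = bK * X * _ + _](@sum_cuts_block (fun x y => mTp f ca0 x * mTp (nca ca0) ca0 y) a.+1 k) //; last first.
    by move=> x; rewrite mTp_p mul0r.
  rewrite mTp_m mulr0 addr0; congr (_ + _); rewrite mulrDr mulrDl.
  congr (_ + _); rewrite -mulrA mulr_suml mulr_sumr big_nat [RHS]big_nat;
    apply: eq_bigr => i /andP[i1 ia]; rewrite -catA vE mTp_catE ?subn_gt0 //;
    rewrite [mTp (nca ca0) ca0 _]mTp_block ?subn_gt0 //; ring.
have hu := @key_block f ca0 lam (1 + bK) a k hf rec_p0.
rewrite -/u /= in hu.
have hv' := IH _ _ rec_m0.
rewrite !mulrDr [bK * (bK * _ * _)]mulrA hu.
have -> : bK * (bK * mTp f ca0 u * wstar (mTp (nca ca0) ca0) (mTp (nca ca0) g) v)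
   = bK * mTp f ca0 u * (bK * wstar (mTp (nca ca0) ca0) (mTp (nca ca0) g) v) by ring.
rewrite hv'.
have -> : mTp f g (Lm :: u ++ v) = bK * mTp f ca0 (Lm :: u) * mTp (nca ca0) g v.
  rewrite vE /u -[Lm :: _]/((nseq a.+2 Lm ++ nseq k.+1 Lp) ++ Lm :: v') -catA mTp_catE //.
  by rewrite -[Lm :: _ ++ _]/(nseq a.+2 Lm ++ nseq k.+1 Lp) mTp_block.
have -> : mTp f g (rcons (u ++ v) Lp) = bK * mTp f ca0 u * mTp (nca ca0) g (rcons v Lp).
  by rewrite rcons_cat vE rcons_cons catE.
have -> : mTp f g (u ++ v) = bK * mTp f ca0 u * mTp (nca ca0) g v by rewrite vE catE.
ring.
Qed.

End KeyIdentity.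

Lemma rec_p_ca : rec_p ca_t (geomK + bK).
Proof. by move=> k; rewrite (ca_conv k).2 addrC addKr. Qed.

Lemma rec_p_ca0 : rec_p ca0 (1 + bK).
Proof.
move=> k; rewrite (ca_conv k).2 rmorphD !rmorphM rmorphD /= at_t0_geomK at_t0_bK at_t0_conv.
rewrite addrC addKr; congr (_ * _); by apply: eq_bigr => i _; congr (_ * _).
Qed.

Lemma rec_m_nca f lam : rec_p f lam -> rec_m (nca f) lam.
Proof.
move=> hf a; have -> : conv (nca f) (nca ca0) a.+1 = (-1) ^+ a.+1 * conv ca0 f a.+1.
  rewrite [conv ca0 f _]convC /conv mulr_sumr big_nat [RHS]big_nat.
  apply: eq_bigr => i /andP[i1 ia].
  have -> : (-1 : K) ^+ a.+1 = (-1) ^+ i * (-1) ^+ (a.+1 - i) by rewrite -exprD subnKC // ltnW.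
  ring.
rewrite mulrCA hf !exprS; ring.
Qed.

Definition wNtTP := mTp (nca ca_t) ca0.
Definition wNTPt := mTp (nca ca0) ca_t.
Definition wNTP := mTp (nca ca0) ca0.

(** A boundary [p m] between two blocks contributes one factor [b P N]. *)
Lemma mTp_cat_mp f g u v : mpword u -> mpword v ->
  mTp f g (u ++ v) = bK * mTp f ca0 u * mTp (nca ca0) g v.
Proof.
move=> hu /mpword_m[v' ->]; elim: hu f => [a k|a k w hw IH] f.
  by rewrite -catA mTp_catE // mTp_block.
have [w' wE] := mpword_m hw.
rewrite -!catA wE cat_cons !mTp_catE // -cat_cons -wE IH; ring.
Qed.

Lemma mTp_rcons f w : mpword w ->
  tK * mTp f ca_t (rcons w Lp) = cK * mTp f ca_t w - bK * mTp f ca0 w.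
Proof.
move=> hw; elim: hw f => [a k|a k v hv IH] f.
  have -> : rcons (nseq a.+1 Lm ++ nseq k.+1 Lp) Lp = nseq a.+1 Lm ++ nseq k.+2 Lp.
    by rewrite -cats1 -catA (_ : [:: Lp] = nseq 1 Lp) // -nseqD addn1.
  by rewrite !mTp_block // mulrCA ca_tS; ring.
have [v' vE] := mpword_m hv.
rewrite !rcons_cat vE rcons_cons !mTp_catE // -rcons_cons -vE mulrCA IH; ring.
Qed.

Lemma mTp_cons g w : mpword w ->
  tK * mTp (nca ca_t) g (Lm :: w) = bK * mTp (nca ca0) g w - cK * mTp (nca ca_t) g w.
Proof.
case=> [a k|a k v hv].
  rewrite -[Lm :: _]/(nseq a.+2 Lm ++ nseq k.+1 Lp) !mTp_block //.
  transitivity ((-1) ^+ a.+2 * (tK * ca_t a.+2) * g k.+1); first by ring.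
  rewrite ca_tS !exprS; ring.
have [v' ->] := mpword_m hv.
rewrite -[Lm :: _]/(nseq a.+2 Lm ++ nseq k.+1 Lp ++ Lm :: v') !mTp_catE //.
transitivity (bK * ((-1) ^+ a.+2 * (tK * ca_t a.+2) * at_t0 (ca_t k.+1))
  * mTp (nca ca0) g (Lm :: v')); first by ring.
rewrite ca_tS !exprS; ring.
Qed.

(** In other words, [1 + t N_t T P] times [1 - t N T P_t] is 1. This is the case
    [lam = mu] of [key_identity]: after multiplication by [t], the terms with an
    added letter are given by [mTp_cons] and [mTp_rcons], and [b] cancels. *)
Lemma wstar_NtTP_NTPt w : mpword w -> tK * wstar wNtTP wNTPt w = wNtTP w - wNTPt w.
Proof.
move=> hw; apply: bK_inj; rewrite mulrCA.
rewrite (key_identity (rec_m_nca rec_p_ca0) rec_p_ca0 (rec_m_nca rec_p_ca) rec_p_ca hw).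
rewrite subrr mul0r addr0 mulrBr mulrN mTp_cons // mTp_rcons // -/wNtTP -/wNTPt; ring.
Qed.

Lemma wstar_NTP_NTPt w : mpword w ->
  bK * wstar wNTP wNTPt w = - wNTPt (Lm :: w) - wNTPt (rcons w Lp) + (geomK - 1) * wNTPt w.
Proof.
move=> hw.
rewrite (key_identity (rec_m_nca rec_p_ca0) rec_p_ca0 (rec_m_nca rec_p_ca0) rec_p_ca hw).
rewrite -/wNTPt; ring.
Qed.

Lemma wstar_NtTP_NTP w : mpword w ->
  bK * wstar wNtTP wNTP w = - wNtTP (Lm :: w) - wNtTP (rcons w Lp) - (geomK - 1) * wNtTP w.
Proof.
move=> hw.
rewrite (key_identity (rec_m_nca rec_p_ca0) rec_p_ca0 (rec_m_nca rec_p_ca) rec_p_ca0 hw).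
rewrite -/wNtTP; ring.
Qed.

(** * Dendriform products of series *)

Fixpoint tsize (x : pbt) : nat := if x is PNode l r then (tsize l + tsize r).+1 else 0.

(** The pairs obtained by cutting a tree along the path from a leaf to the root:
    [x] occurs in [y * z] exactly when [(y, z)] is one of its cuts. *)
Fixpoint cuts (x : pbt) : seq (pbt * pbt) :=
  if x is PNode l r then
    [seq (c.1, PNode c.2 r) | c <- cuts l] ++ [seq (PNode l c.1, c.2) | c <- cuts r]
  else [:: (PLeaf, PLeaf)].

Definition fstar (f g : tseries) : tseries := fun x => \sum_(c <- cuts x) f c.1 * g c.2.

(** At a leaf, which is not in the dendriform algebra, the half products are 0. *)
Definition fsucc (f g : tseries) : tseries :=
  fun x => if x is PNode l r then \sum_(c <- cuts l) f c.1 * g (PNode c.2 r) else 0.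

Definition fprec (f g : tseries) : tseries :=
  fun x => if x is PNode l r then \sum_(c <- cuts r) f (PNode l c.1) * g c.2 else 0.

Lemma tsize_cuts x c : c \in cuts x -> (tsize c.1 + tsize c.2 = tsize x)%N.
Proof.
elim: x c => [|l IHl r IHr] c /=; first by rewrite inE => /eqP->.
rewrite mem_cat => /orP[] /mapP[d dl ->] /=.
  by rewrite -(IHl _ dl) addnS addnA.
by rewrite -(IHr _ dl) addSn addnA.
Qed.

Lemma fstar_leaf f g : fstar f g PLeaf = f PLeaf * g PLeaf.
Proof. by rewrite /fstar big_seq1. Qed.

Lemma fstar_node f g l r :
  fstar f g (PNode l r) = fsucc f g (PNode l r) + fprec f g (PNode l r).
Proof. by rewrite /fstar /= big_cat !big_map. Qed.

Lemma fprecE f g l r : fprec f g (PNode l r) = fstar (fun y => f (PNode l y)) g r.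
Proof. by []. Qed.

Lemma fsuccE f g l r : fsucc f g (PNode l r) = fstar f (fun z => g (PNode z r)) l.
Proof. by []. Qed.

Lemma fstar1 f x : fstar f (tree_s PLeaf) x = f x.
Proof.
elim: x f => [|l _ r IHr] f; first by rewrite fstar_leaf mulr1.
by rewrite fstar_node fprecE IHr fsuccE /fstar big1 ?add0r // => c _; rewrite mulr0.
Qed.

Lemma fstar_1 f x : fstar (tree_s PLeaf) f x = f x.
Proof.
elim: x f => [|l IHl r _] f; first by rewrite fstar_leaf mul1r.
by rewrite fstar_node fsuccE IHl fprecE /fstar big1 ?addr0 // => c _; rewrite mul0r.
Qed.

Lemma fstarDl f f' g x : fstar (fun y => f y + f' y) g x = fstar f g x + fstar f' g x.
Proof. by rewrite -big_split; apply: eq_bigr => i _; rewrite mulrDl. Qed.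

Lemma fstarDr f g g' x : fstar f (fun y => g y + g' y) x = fstar f g x + fstar f g' x.
Proof. by rewrite -big_split; apply: eq_bigr => i _; rewrite mulrDr. Qed.

Lemma fstarZl k f g x : fstar (fun y => k * f y) g x = k * fstar f g x.
Proof. by rewrite /fstar mulr_sumr; apply: eq_bigr => i _; rewrite mulrA. Qed.

Lemma fstarZr k f g x : fstar f (fun y => k * g y) x = k * fstar f g x.
Proof. by rewrite /fstar mulr_sumr; apply: eq_bigr => i _; rewrite mulrCA. Qed.

Lemma fsucc_fprec f g h x : fsucc f (fprec g h) x = fprec (fsucc f g) h x.
Proof.
case: x => // l r /=; under eq_bigr do rewrite mulr_sumr.
rewrite exchange_big; apply: eq_bigr => c _; rewrite mulr_suml.
by apply: eq_bigr => d _; rewrite mulrA.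
Qed.

(** Both sides cut [x] along two leaves. *)
Lemma fstarA f g h x : fstar (fstar f g) h x = fstar f (fstar g h) x.
Proof.
elim: x f g h => [|l IHl r IHr] f g h; first by rewrite !fstar_leaf mulrA.
have nodeE f' g' y : (fun z => fstar f' g' (PNode y z)) =
    fun z => fsucc f' g' (PNode y z) + fprec f' g' (PNode y z).
  by apply/funext => z; rewrite fstar_node.
have nodeE' f' g' y : (fun z => fstar f' g' (PNode z y)) =
    fun z => fsucc f' g' (PNode z y) + fprec f' g' (PNode z y).
  by apply/funext => z; rewrite fstar_node.
rewrite !fstar_node !fsuccE !fprecE nodeE nodeE' fstarDl fstarDr.
have -> : fstar (fun z => fsucc f g (PNode l z)) h r
    = fstar f (fun z => fprec g h (PNode z r)) l.
  by rewrite -fprecE -fsuccE fsucc_fprec.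
have -> : fstar f (fun z => fsucc g h (PNode z r)) l
    = fstar f (fstar g (fun z => h (PNode z r))) l by [].
have -> : fstar (fun z => fprec f g (PNode l z)) h r
    = fstar (fstar (fun z => f (PNode l z)) g) h r by [].
by rewrite IHl IHr addrA.
Qed.

Lemma fprecA f g h x : fprec (fprec f g) h x = fprec f (fstar g h) x.
Proof. by case: x => // l r; rewrite !fprecE -fstarA. Qed.

Lemma fsuccA f g h x : fsucc (fstar f g) h x = fsucc f (fsucc g h) x.
Proof. by case: x => // l r; rewrite !fsuccE fstarA. Qed.

Section Exponential.
Variables (n : nat) (X W gam q : tseries).
Hypotheses (X0 : X PLeaf = 1) (W0 : W PLeaf = 1).
Hypothesis XE : forall l r, X (PNode l r) = fprec gam X (PNode l r).
Hypothesis WE : forall l r, W (PNode l r) = - fsucc W gam (PNode l r).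
Hypothesis qE : forall x, (tsize x <= n)%N ->
  (tsize x)%:R * gam x = q x + fsucc q gam x - fprec gam q x.

(** Multiplication by the number of vertices is a derivation for all the
    products. Applied to [X = 1 + gam < X], it gives an equation whose unique
    solution is [q * X], by the dendriform axioms and the hypothesis on [q]. *)
Lemma deriv_X x : (tsize x <= n)%N -> (tsize x)%:R * X x = fstar q X x.
Proof.
have [m] := ubnP (tsize x); elim: m x => // m IH [|l r] xm xn.
  have := qE (leq0n n : (tsize PLeaf <= n)%N); rewrite /= !mul0r subr0 addr0 => q0.
  by rewrite fstar_leaf -q0 !mul0r.
have succX : fsucc q X (PNode l r) = fsucc q (fprec gam X) (PNode l r).
  by apply: eq_bigr => c _; rewrite XE.
rewrite fstar_node succX fsucc_fprec XE.
have := fprecA gam q X (PNode l r); rewrite /= => eA.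
rewrite /= mulr_sumr.
have -> : \sum_(c <- cuts r) (tsize l + tsize r).+1%:R * (gam (PNode l c.1) * X c.2)
  = \sum_(c <- cuts r) ((q (PNode l c.1) + fsucc q gam (PNode l c.1)
       - fprec gam q (PNode l c.1)) * X c.2 + gam (PNode l c.1) * fstar q X c.2).
  rewrite big_seq [RHS]big_seq; apply: eq_bigr => c /tsize_cuts cr.
  have [c2m c2n c1n] : [/\ tsize c.2 < m, tsize c.2 <= n & (tsize l + tsize c.1).+1 <= n]%N.
    by move: (tsize c.1) (tsize c.2) cr xm xn => u v /= <-; split; lia.
  rewrite -IH // -qE // -cr /= addnA -addSn natrD; ring.
rewrite big_split /= -eA -big_split /= -big_split /=; apply: eq_bigr => c _; ring.
Qed.

Lemma deriv_W x : (tsize x <= n)%N -> (tsize x)%:R * W x = - fstar W q x.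
Proof.
have [m] := ubnP (tsize x); elim: m x => // m IH [|l r] xm xn.
  have := qE (leq0n n : (tsize PLeaf <= n)%N); rewrite /= !mul0r subr0 addr0 => q0.
  by rewrite fstar_leaf -q0 /= mulr0 oppr0 ?mul0r.
have precW : fprec W q (PNode l r) = - fprec (fsucc W gam) q (PNode l r).
  by rewrite /= -sumrN; apply: eq_bigr => c _; rewrite WE mulNr.
rewrite fstar_node precW -fsucc_fprec WE mulrN; congr (- _).
have := fsuccA W q gam (PNode l r); rewrite /= => eA.
rewrite /= mulr_sumr.
have -> : \sum_(c <- cuts l) (tsize l + tsize r).+1%:R * (W c.1 * gam (PNode c.2 r))
  = \sum_(c <- cuts l) (W c.1 * (q (PNode c.2 r) + fsucc q gam (PNode c.2 r)
       - fprec gam q (PNode c.2 r)) - fstar W q c.1 * gam (PNode c.2 r)).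
  rewrite big_seq [RHS]big_seq; apply: eq_bigr => c /tsize_cuts cr.
  have [c1m c1n c2n] : [/\ tsize c.1 < m, tsize c.1 <= n & (tsize c.2 + tsize r).+1 <= n]%N.
    by move: (tsize c.1) (tsize c.2) cr xm xn => u v /= <-; split; lia.
  rewrite -[fstar W q _]opprK -IH // -qE // -cr /= -addnA -addnS natrD; ring.
rewrite big_split /= sumrN eA -sumrN -big_split /= -sumrN -big_split /=; apply: eq_bigr => c _; ring.
Qed.

(** By [deriv_X] and [deriv_W], [X > Y < W] solves the equation satisfied by [Z].
    In size [k > 1] the equation determines the value from smaller sizes, as [q]
    vanishes at the leaf; in size 1 it says nothing. *)
Lemma exp_unique (Z : tseries) : Z PLeaf = 0 -> Z Ytree = 1 ->
  (forall x, (tsize x <= n.+1)%N -> (tsize x)%:R * Z x = Z x + fsucc q Z x - fprec Z q x) ->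
  forall x, (tsize x <= n.+1)%N -> Z x = vee_s X W x.
Proof.
move=> Z0 Z1 ZE x; have [m] := ubnP (tsize x); elim: m x => // m IH [|l r] xm xn //.
have q0 : q PLeaf = 0.
  by have := qE (leq0n n : (tsize PLeaf <= n)%N); rewrite /= !mul0r subr0 addr0.
have [lr0|lr0] := posnP (tsize l + tsize r).
  have [-> ->] : l = PLeaf /\ r = PLeaf.
    by move: lr0; clear; case: l; case: r.
  by rewrite Z1 /= X0 W0 mulr1.
apply: (natK_inj lr0).
have -> : (tsize l + tsize r)%:R * Z (PNode l r)
    = fsucc q Z (PNode l r) - fprec Z q (PNode l r).
  have := ZE _ xn; rewrite [tsize (PNode l r)]/= -addn1 natrD mulrDl mul1r addrC -addrA.
  by move/addrI.
have [ln rn] : (tsize l <= n)%N /\ (tsize r <= n)%N by move: xn => /=; split; lia.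
rewrite /vee_s natrD mulrDl mulrA deriv_X // [(tsize r)%:R * _]mulrCA deriv_W // mulrN.
congr (_ - _); rewrite /fstar ?mulr_suml ?mulr_sumr /= big_seq [RHS]big_seq;
  apply: eq_bigr => c /tsize_cuts cl.
  have [c0|c0] := posnP (tsize c.1).
    by have -> : c.1 = PLeaf; [case: c.1 c0|rewrite q0 !mul0r].
  rewrite IH ?mulrA //=; move: (tsize c.1) (tsize c.2) c0 cl xm xn => u v c0 /= <-; lia.
have [c0|c0] := posnP (tsize c.2).
  by have -> : c.2 = PLeaf; [case: c.2 c0|rewrite q0 !mulr0].
rewrite IH /= ?mulrA //=; move: (tsize c.1) (tsize c.2) c0 cl xm xn => u v c0 /= <-; lia.
Qed.
End Exponential.

(** * Bilinear extensions *)

Section Extension.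
Variables (R : comNzRingType) (A C : choiceType).

Definition lin_ext (F : A -> {malg R[C]}) (x : {malg R[A]}) : {malg R[C]} :=
  \sum_(a <- msupp x) x@_a *: F a.

Lemma lin_extEw F x (L : {fset A}) : (msupp x `<=` L)%fset -> lin_ext F x = \sum_(a <- L) x@_a *: F a.
Proof.
move=> xL; apply: big_fset_incl => // a _ /mcoeff_outdom->.
by rewrite scale0r.
Qed.

Lemma lin_ext_is_linear F : linear (lin_ext F).
Proof.
move=> k x y; pose L := (msupp x `|` msupp y `|` msupp (k *: x + y))%fset.
have xL : (msupp x `<=` L)%fset by rewrite /L -fsetUA fsubsetUl.
have yL : (msupp y `<=` L)%fset by rewrite /L [(msupp x `|` _)%fset]fsetUC -fsetUA fsubsetUl.
have zL : (msupp (k *: x + y) `<=` L)%fset by rewrite fsubsetUr.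
rewrite !(lin_extEw _ xL, lin_extEw _ yL, lin_extEw _ zL) scaler_sumr -big_split.
by apply: eq_bigr => a _; rewrite mcoeffD mcoeffZ scalerDl scalerA.
Qed.

HB.instance Definition _ F := GRing.isLinear.Build R {malg R[A]} {malg R[C]} _ (lin_ext F) (lin_ext_is_linear F).

Lemma lin_extU F a : lin_ext F << a >> = F a.
Proof.
rewrite (@lin_extEw _ _ [fset a]%fset) ?msuppU_le // big_seq_fset1 mcoeffU eqxx.
by rewrite scale1r.
Qed.

End Extension.

Section Bilinear.
Variables (R : comNzRingType) (A B C : choiceType) (h : A -> B -> {malg R[C]}).

Lemma bilinEl x y : bilin h x y = lin_ext (fun a => lin_ext (h a) y) x.
Proof.
apply: eq_bigr => a _; rewrite scaler_sumr; apply: eq_bigr => b _.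
by rewrite scalerA.
Qed.

Lemma bilinEr x y : bilin h x y = lin_ext (fun b => lin_ext (h^~ b) x) y.
Proof.
rewrite /bilin exchange_big; apply: eq_bigr => b _; rewrite scaler_sumr.
by apply: eq_bigr => a _; rewrite scalerA mulrC.
Qed.

Lemma bilinUU a b : bilin h << a >> << b >> = h a b.
Proof. by rewrite bilinEl !lin_extU. Qed.

End Bilinear.

Lemma malg_sum1 (R : comNzRingType) (A : choiceType) (f : {malg R[A]}) a :
  \sum_(k <- msupp f) f@_k * (k == a)%:R = f@_a.
Proof.
rewrite {3}[f]monalgE raddf_sum; apply: eq_bigr => k _.
by rewrite /= mcoeffU; case: eqP => _; rewrite ?mulr1 ?mulr0.
Qed.

(** The dendriform products have structure constants that count occurrences in
    the list of cuts of the result. *)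
Lemma bilin_coef_count (R : comNzRingType) (A B C : choiceType) (h : A -> B -> {malg R[C]}) f g c
    (L : seq (A * B)) :
  (forall a b, (h a b)@_c = (count_mem (a, b) L)%:R) ->
  (bilin h f g)@_c = \sum_(d <- L) f@_d.1 * g@_d.2.
Proof.
move=> hL; rewrite /bilin raddf_sum.
under eq_bigr do rewrite raddf_sum.
under eq_bigr do (under eq_bigr do rewrite /= mcoeffZ hL).
elim: L {hL} => [|[a b] L IH].
  by rewrite big_nil big1 // => i _; rewrite big1 // => j _; rewrite mulr0.
rewrite big_cons -IH -[in f@_ _](malg_sum1 f) -(malg_sum1 g) big_distrlr -big_split.
apply: eq_bigr => i _; rewrite -big_split; apply: eq_bigr => j _ /=.
rewrite natrD mulrDr; congr (_ + _); rewrite xpair_eqE [a == i]eq_sym [b == j]eq_sym.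
by rewrite mulrACA -natrM mulnb.
Qed.

(** * The dendriform products in coordinates *)

Definition coords (f : {malg K[pbt]}) : tseries := fun x => f@_x.

Lemma eq_node a b l r : (PNode a b == PNode l r) = (a == l) && (b == r).
Proof. by apply/eqP/andP => [[-> ->]//|[/eqP-> /eqP->]]. Qed.

Lemma vee_node (R : comNzRingType) (f g : {malg R[pbt]}) l r : (vee f g)@_(PNode l r) = f@_l * g@_r.
Proof.
rewrite (@bilin_coef_count _ _ _ _ _ _ _ _ [:: (l, r)]) ?big_seq1 // => a b.
by rewrite mcoeffU /= eq_node xpair_eqE [l == a]eq_sym [r == b]eq_sym addn0.
Qed.

Lemma vee_leaf (R : comNzRingType) (f g : {malg R[pbt]}) : (vee f g)@_PLeaf = 0.
Proof.
rewrite (@bilin_coef_count _ _ _ _ _ _ _ _ [::]) ?big_nil // => a b.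
by rewrite mcoeffU.
Qed.

Definition succs (x : pbt) : seq (pbt * pbt) :=
  if x is PNode l r then [seq (c.1, PNode c.2 r) | c <- cuts l] else [::].

Definition precs (x : pbt) : seq (pbt * pbt) :=
  if x is PNode l r then [seq (PNode l c.1, c.2) | c <- cuts r] else [::].

Lemma count_succs a c d l r :
  count_mem (a, PNode c d) (succs (PNode l r)) = (count_mem (a, c) (cuts l) * (d == r))%N.
Proof.
rewrite /= count_map; case: (eqVneq d r) => [->|dr]; last first.
  rewrite muln0; apply/eqP; rewrite -leqn0 leqNgt -has_count; apply/hasPn => e _ /=.
  by rewrite xpair_eqE eq_node [r == d]eq_sym (negbTE dr) !andbF.
rewrite muln1; apply: eq_count => e /=; rewrite [e in RHS]surjective_pairing.
by rewrite !xpair_eqE eq_node eqxx andbT.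
Qed.

Lemma count_precs a b c l r :
  count_mem (PNode a b, c) (precs (PNode l r)) = ((a == l) * count_mem (b, c) (cuts r))%N.
Proof.
rewrite /= count_map; case: (eqVneq a l) => [->|al]; last first.
  rewrite mul0n; apply/eqP; rewrite -leqn0 leqNgt -has_count; apply/hasPn => e _ /=.
  by rewrite xpair_eqE eq_node [l == a]eq_sym (negbTE al) !andFb.
rewrite mul1n; apply: eq_count => e /=; rewrite [e in RHS]surjective_pairing.
by rewrite !xpair_eqE eq_node eqxx andTb.
Qed.

Lemma count_cuts_leafl y x : count_mem (PLeaf, y) (cuts x) = (y == x).
Proof.
elim: x y => [|l IHl r _] y; first by rewrite /= addn0 xpair_eqE eqxx eq_sym.
rewrite -[cuts _]/(succs (PNode l r) ++ precs (PNode l r)) count_cat.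
rewrite [X in (_ + X)%N](_ : _ = 0%N) ?addn0; last first.
  by apply/eqP; rewrite -leqn0 leqNgt -has_count; apply/hasPn => _ /mapP[e _ ->].
case: y => [|c d]; last by rewrite count_succs IHl eq_node mulnb.
rewrite [RHS](_ : _ = 0%N) //.
by apply/eqP; rewrite -leqn0 leqNgt -has_count; apply/hasPn => _ /mapP[e _ ->]; rewrite /= ?xpair_eqE ?andbF.
Qed.

Lemma count_cuts_leafr y x : count_mem (y, PLeaf) (cuts x) = (y == x).
Proof.
elim: x y => [|l _ r IHr] y; first by rewrite /= addn0 xpair_eqE eqxx andbT eq_sym.
rewrite -[cuts _]/(succs (PNode l r) ++ precs (PNode l r)) count_cat.
rewrite [X in (X + _)%N](_ : _ = 0%N) ?add0n; last first.
  by apply/eqP; rewrite -leqn0 leqNgt -has_count; apply/hasPn => _ /mapP[e _ ->]; rewrite /= ?xpair_eqE ?andbF.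
case: y => [|c d]; last by rewrite count_precs IHr eq_node mulnb.
rewrite [RHS](_ : _ = 0%N) //.
by apply/eqP; rewrite -leqn0 leqNgt -has_count; apply/hasPn => _ /mapP[e _ ->]; rewrite /= ?xpair_eqE ?andbF.
Qed.

Lemma star_node (R : comNzRingType) a b c d : star_tree R (PNode a b) (PNode c d) =
  vee << a >> (star_tree R b (PNode c d)) + vee (star_tree R (PNode a b) c) << d >>.
Proof. by []. Qed.

(** [cuts] is the coproduct dual to the product [*]. *)
Lemma star_tree_coef (R : comNzRingType) y z x : (star_tree R y z)@_x = (count_mem (y, z) (cuts x))%:R.
Proof.
elim: x y z => [|l IHl r IHr] [|a b] [|c d].
- by rewrite mcoeffU.
- by rewrite star_1l mcoeffU count_cuts_leafl.
- by rewrite star_1r mcoeffU count_cuts_leafr.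
- have -> : count_mem (PNode a b, PNode c d) (cuts PLeaf) = 0%N by [].
  rewrite star_node. rewrite mcoeffD. rewrite vee_leaf. rewrite vee_leaf. rewrite addr0. by [].
- by rewrite star_1l mcoeffU count_cuts_leafl.
- by rewrite star_1l mcoeffU count_cuts_leafl.
- by rewrite star_1r mcoeffU count_cuts_leafr.
rewrite -[cuts _]/(succs (PNode l r) ++ precs (PNode l r)) count_cat count_succs count_precs.
rewrite star_node mcoeffD 2!vee_node IHr IHl.
rewrite !mcoeffU addnC natrD !natrM. by rewrite mulrC.
Qed.

Lemma dsucc_coef f g x : (dsucc f g)@_x = fsucc (coords f) (coords g) x.
Proof.
rewrite (@bilin_coef_count _ _ _ _ _ _ _ _ (succs x)); first by case: x => [|l r]; rewrite ?big_nil //= big_map.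
move=> a [|c d]; case: x => [|l r].
- by rewrite mcoeff0.
- rewrite mcoeff0 (_ : count _ _ = 0%N) //.
  by apply/eqP; rewrite -leqn0 leqNgt -has_count; apply/hasPn => _ /mapP[e _ ->]; rewrite /= ?xpair_eqE ?andbF.
- by rewrite vee_leaf.
- by rewrite vee_node count_succs star_tree_coef mcoeffU natrM.
Qed.

Lemma dprec_coef f g x : (dprec f g)@_x = fprec (coords f) (coords g) x.
Proof.
rewrite (@bilin_coef_count _ _ _ _ _ _ _ _ (precs x)); first by case: x => [|l r]; rewrite ?big_nil //= big_map.
move=> [|a b] c; case: x => [|l r].
- by rewrite mcoeff0.
- rewrite mcoeff0 (_ : count _ _ = 0%N) //.
  by apply/eqP; rewrite -leqn0 leqNgt -has_count; apply/hasPn => _ /mapP[e _ ->].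
- by rewrite vee_leaf.
- by rewrite vee_node count_precs star_tree_coef mcoeffU natrM.
Qed.

Lemma dend_pl_coef f g x :
  (dend_pl_mul f g)@_x = fsucc (coords g) (coords f) x - fprec (coords f) (coords g) x.
Proof.
have -> : (dend_pl_mul f g)@_x = (dsucc g f)@_x - (dprec f g)@_x by exact: mcoeffB.
by congr (_ - _); [exact: dsucc_coef|exact: dprec_coef].
Qed.

(** * The canopy series solve the dendriform equations *)

Local Notation eps := (tree_s PLeaf).

Lemma mpword_cons v : mpword v -> mpword (Lm :: v).
Proof.
case=> [a k|a k w hw]; first exact: (MpBlock a.+1 k).
exact: (MpCat a.+1 k hw).
Qed.

Lemma mpword_rcons v : mpword v -> mpword (rcons v Lp).
Proof.
have nseqS k : rcons (nseq k.+1 Lp) Lp = nseq k.+2 Lp.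
  by rewrite -cats1 (_ : [:: Lp] = nseq 1 Lp) // -nseqD addn1.
elim=> [a k|a k w _ IH]; rewrite !rcons_cat ?nseqS; first exact: (MpBlock a k.+1).
exact: MpCat.
Qed.

Lemma mpword_cat u v : mpword u -> mpword v -> mpword (u ++ v).
Proof.
move=> hu hv; elim: hu => [a k|a k w _ IH]; rewrite -?catA; first exact: MpCat.
exact: MpCat.
Qed.

Lemma mpword_letters a l r : mpword (leaf_letters a (PNode l r)).
Proof.
suff h x b : x <> PLeaf -> mpword (leaf_letters b x) by apply: h.
elim: x b => // {}l IHl {}r IHr b _ /=.
case: l IHl => [|l1 l2] IHl; case: r IHr => [|r1 r2] IHr.
- exact: (MpBlock 0 0).
- by apply: mpword_cons; apply: IHr.
- by rewrite cats1; apply: mpword_rcons; apply: IHl.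
- by apply: mpword_cat; [apply: IHl|apply: IHr].
Qed.

Lemma mpword_ends v : mpword v -> exists u, v = Lm :: rcons u Lp.
Proof.
elim=> [a k|a k w _ [u ->]].
  exists (nseq a Lm ++ nseq k Lp); rewrite rcons_cat; congr (_ :: _ ++ _).
  by rewrite -cats1 (_ : [:: Lp] = nseq 1 Lp) // -nseqD addn1.
by exists (nseq a Lm ++ nseq k.+1 Lp ++ Lm :: u); rewrite !rcons_cat.
Qed.

Lemma full_canopyE l r a : full_canopy l r = leaf_letters a (PNode l r).
Proof.
have [u uE] := mpword_ends (mpword_letters a l r).
rewrite /full_canopy /canopy -/(leaf_letters a (PNode l r)) uE /=.
have uK : take (size u) (rcons u Lp) = u by rewrite -cats1 take_size_cat.
by rewrite size_rcons /= uK.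
Qed.

Lemma canopy_node f l r a : canopy_s f (PNode l r) = f (leaf_letters a (PNode l r)).
Proof. by rewrite /canopy_s (full_canopyE l r a). Qed.

Lemma cuts_letters a x :
  [seq (leaf_letters Lp c.1, leaf_letters Lm c.2) | c <- cuts x] = wcuts (leaf_letters a x).
Proof.
elim: x a => [|l IHl r IHr] a //=.
rewrite wcuts_cat -(IHl Lm) -(IHr Lp) map_cat -!map_comp.
by congr (_ ++ _); apply: eq_map => c.
Qed.

(** A cut splits the sequence of leaf letters at the cut leaf, whose letter becomes
    p on the left and m on the right, whatever it was: so the product of canopy
    series only depends on the full canopy. *)
Lemma fstar_canopy f g l r : f [:: Lp] = 0 -> g [:: Lm] = 0 ->
  fstar (canopy_s f) (canopy_s g) (PNode l r) = wstar f g (leaf_letters Lm (PNode l r)).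
Proof.
move=> f0 g0; rewrite /wstar -(cuts_letters Lm) big_map; apply: eq_bigr => -[y z] _ /=.
by case: y z => [|? ?] [|? ?]; rewrite ?(canopy_node _ _ _ Lp) ?(canopy_node _ _ _ Lm) //= ?f0 ?g0 ?mul0r ?mulr0.
Qed.

Definition cNtTP := canopy_s wNtTP.
Definition cNTPt := canopy_s wNTPt.
Definition cNTP := canopy_s wNTP.

Lemma at_t0_nca f i : at_t0 ((-1) ^+ i * f i) = (-1) ^+ i * at_t0 (f i).
Proof. by rewrite rmorphM rmorphXn rmorphN1. Qed.

Lemma at_t0_mTp f g w : mpword w ->
  at_t0 (mTp f g w) = mTp (fun i => at_t0 (f i)) (fun i => at_t0 (g i)) w.
Proof.
move=> hw; elim: hw f g => [a k|a k v hv IH] f g; first by rewrite !mTp_block // rmorphM.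
have [v' vE] := mpword_m hv.
rewrite vE !mTp_catE // -vE !rmorphM /= IH at_t0_bK at_t0_idem.
congr (_ * mTp _ _ _); apply/funext => i.
by rewrite (at_t0_nca ca0) at_t0_idem.
Qed.

Lemma at_t0_NtTP x : at_t0 (cNtTP x) = cNTP x.
Proof.
case: x => [|l r]; first by rewrite /= rmorph0.
rewrite /cNtTP /cNTP !(canopy_node _ _ _ Lm) at_t0_mTp; last exact: mpword_letters.
congr mTp; apply/funext => i; rewrite ?(at_t0_nca ca_t) ?(at_t0_nca ca0) ?at_t0_idem //.
Qed.

Lemma at_t0_NTPt x : at_t0 (cNTPt x) = cNTP x.
Proof.
case: x => [|l r]; first by rewrite /= rmorph0.
rewrite /cNTPt /cNTP !(canopy_node _ _ _ Lm) at_t0_mTp; last exact: mpword_letters.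
congr mTp; apply/funext => i; rewrite ?(at_t0_nca ca_t) ?(at_t0_nca ca0) ?at_t0_idem //.
Qed.

(** The dendriform exponential of [rhs_gam], by [Xs_eq], and its inverse. *)
Definition Xs : tseries := fun x => eps x - tK * cNTPt x.
Definition Ws : tseries := fun x => eps x + tK * cNtTP x.

Definition rhs_s : tseries := fun x =>
  geomK * tree_s Ytree x + cK * vee_s eps cNtTP x - cK * vee_s cNTPt eps x
  - tK * cK * vee_s cNTPt cNtTP x.

Definition rhs_gam : tseries := fun x => rhs_s x - at_t0 (rhs_s x).

Lemma tree_s_node l r : tree_s Ytree (PNode l r) = eps l * eps r.
Proof.
by rewrite /tree_s eq_node; case: (l == _); case: (r == _); rewrite /= ?mulr0 ?mulr1.
Qed.

Lemma tK_rhs_s x : tK * rhs_s x = cK * vee_s Xs Ws x - bK * tree_s Ytree x.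
Proof.
case: x => [|l r]; first by rewrite /rhs_s /= /tree_s /=; ring.
have e : tK * geomK = cK - bK by rewrite /cK addrK.
rewrite /rhs_s tree_s_node /vee_s /Xs /Ws; set a := eps l; set b := eps r.
transitivity (tK * geomK * (a * b) + tK * (cK * (a * cNtTP r) - cK * (cNTPt l * b)
   - tK * cK * (cNTPt l * cNtTP r))); first by ring.
rewrite e; ring.
Qed.

Lemma at_t0_eps x : at_t0 (eps x) = eps x.
Proof. by rewrite /tree_s; case: eqP; rewrite ?rmorph1 ?rmorph0. Qed.

Lemma at_t0_cK : at_t0 cK = bK.
Proof. by rewrite rmorphD rmorphM /= at_t0_tK mul0r add0r at_t0_bK. Qed.

Lemma rhs_gam_node l r : rhs_gam (PNode l r) =
  ((geomK - 1) * eps l - cK * cNTPt l + bK * cNTP l) * eps r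
  + (cK * eps l - tK * cK * cNTPt l) * cNtTP r - bK * eps l * cNTP r.
Proof.
rewrite /rhs_gam /rhs_s tree_s_node /vee_s !rmorphB !rmorphD !rmorphM /=.
rewrite !at_t0_eps at_t0_geomK at_t0_cK at_t0_tK at_t0_NtTP at_t0_NTPt; ring.
Qed.

Lemma wNtTP_p : wNtTP [:: Lp] = 0. Proof. exact: mTp_p. Qed.
Lemma wNTP_p : wNTP [:: Lp] = 0. Proof. exact: mTp_p. Qed.
Lemma wNTPt_m : wNTPt [:: Lm] = 0. Proof. exact: mTp_m. Qed.
Lemma wNTP_m : wNTP [:: Lm] = 0. Proof. exact: mTp_m. Qed.

Lemma fstar_NtTP_NTPt x : tK * fstar cNtTP cNTPt x = cNtTP x - cNTPt x.
Proof.
case: x => [|l r]; first by rewrite fstar_leaf !mul0r mulr0 subr0.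
rewrite fstar_canopy ?wNtTP_p ?wNTPt_m // wstar_NtTP_NTPt; last exact: mpword_letters.
by rewrite /cNtTP /cNTPt !(canopy_node _ _ _ Lm).
Qed.

Lemma fstar_NtTP_Xs x : fstar cNtTP Xs x = cNTPt x.
Proof.
have -> : Xs = fun y => eps y + (- tK) * cNTPt y by apply/funext => y; rewrite mulNr.
by rewrite fstarDr fstarZr fstar1 mulNr fstar_NtTP_NTPt opprB addrC subrK.
Qed.

Lemma fstar_Ws_NTPt x : fstar Ws cNTPt x = cNtTP x.
Proof. by rewrite fstarDl fstarZl fstar_1 fstar_NtTP_NTPt addrC subrK. Qed.

Lemma fstar_NTP_Xs x : fstar cNTP Xs x = cNTP x - tK * fstar cNTP cNTPt x.
Proof.
have -> : Xs = fun y => eps y + (- tK) * cNTPt y by apply/funext => y; rewrite mulNr.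
by rewrite fstarDr fstarZr fstar1 mulNr.
Qed.

Lemma fstar_Ws_NTP x : fstar Ws cNTP x = cNTP x + tK * fstar cNtTP cNTP x.
Proof. by rewrite fstarDl fstarZl fstar_1. Qed.

(** The word of [l \/ r] is the concatenation of those of [l] and [r], a leaf
    contributing one letter. When [l] is a leaf, the added letter m is next to
    [N], which does not depend on [t], so [ca_tS] does not apply and the product
    with [NTP] appears. *)
Lemma NTPt_leaf_node r1 r2 : let r := PNode r1 r2 in
  tK * (bK * fstar cNTP cNTPt r) = - tK * cNTPt (PNode PLeaf r) - cK * cNTPt r + bK * cNTP r
    + tK * (geomK - 1) * cNTPt r.
Proof.
move=> r; have hr := mpword_letters Lp r1 r2.
rewrite /cNTPt /cNTP fstar_canopy ?wNTP_p ?wNTPt_m // !(canopy_node _ _ _ Lp).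
have -> : leaf_letters Lm (PNode r1 r2) = leaf_letters Lp r by [].
rewrite wstar_NTP_NTPt // mulrDr mulrBr mulrN mTp_rcons // -/wNTPt -/wNTP /=; ring.
Qed.

Lemma NTPt_node_leaf l1 l2 : let l := PNode l1 l2 in
  tK * cNTPt (PNode l PLeaf) = cK * cNTPt l - bK * cNTP l.
Proof.
move=> l; have hl := mpword_letters Lm l1 l2.
by rewrite /cNTPt /cNTP !(canopy_node _ _ _ Lm) /= cats1 mTp_rcons.
Qed.

Lemma NTPt_node_node l1 l2 r1 r2 : let l := PNode l1 l2 in let r := PNode r1 r2 in
  cNTPt (PNode l r) = bK * cNTP l * cNTPt r.
Proof.
move=> l r; rewrite /cNTPt /cNTP !(canopy_node _ _ _ Lm).
rewrite -[leaf_letters Lm (PNode l r)]/(leaf_letters Lm l ++ leaf_letters Lp r).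
by rewrite /wNtTP /wNTPt /wNTP mTp_cat_mp //; apply: mpword_letters.
Qed.

Lemma NtTP_node_leaf l1 l2 : let l := PNode l1 l2 in
  tK * (bK * fstar cNtTP cNTP l) = cK * cNtTP l - bK * cNTP l - tK * cNtTP (PNode l PLeaf)
    - tK * (geomK - 1) * cNtTP l.
Proof.
move=> l; have hl := mpword_letters Lm l1 l2.
rewrite /cNtTP /cNTP fstar_canopy ?wNtTP_p ?wNTP_m // !(canopy_node _ _ _ Lm).
rewrite wstar_NtTP_NTP // -/l mulrBr mulrBr mulrN mTp_cons // -/wNtTP -/wNTP /= cats1; ring.
Qed.

Lemma NtTP_leaf_node r1 r2 : let r := PNode r1 r2 in
  tK * cNtTP (PNode PLeaf r) = bK * cNTP r - cK * cNtTP r.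
Proof.
move=> r; have hr := mpword_letters Lp r1 r2.
by rewrite /cNtTP /cNTP !(canopy_node _ _ _ Lp) /= mTp_cons.
Qed.

Lemma NtTP_node_node l1 l2 r1 r2 : let l := PNode l1 l2 in let r := PNode r1 r2 in
  cNtTP (PNode l r) = bK * cNtTP l * cNTP r.
Proof.
move=> l r; rewrite /cNtTP /cNTP !(canopy_node _ _ _ Lm).
rewrite -[leaf_letters Lm (PNode l r)]/(leaf_letters Lm l ++ leaf_letters Lp r).
by rewrite /wNtTP /wNTPt /wNTP mTp_cat_mp //; apply: mpword_letters.
Qed.

Lemma NTPt_Y : cNTPt Ytree = - geomK.
Proof.
rewrite /cNTPt (canopy_node _ _ _ Lm) -[leaf_letters _ _]/(nseq 1 Lm ++ nseq 1 Lp).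
by rewrite /wNTPt mTp_block // at_t0_ca1 ca_t1 expr1 ?mulr1 mulN1r.
Qed.

Lemma NtTP_Y : cNtTP Ytree = - geomK.
Proof.
rewrite /cNtTP (canopy_node _ _ _ Lm) -[leaf_letters _ _]/(nseq 1 Lm ++ nseq 1 Lp).
by rewrite /wNtTP mTp_block // at_t0_ca1 ca_t1 expr1 ?mulr1 mulN1r.
Qed.

Lemma eps_node l r : eps (PNode l r) = 0. Proof. by []. Qed.
Lemma eps_leaf : eps PLeaf = 1. Proof. by []. Qed.
Lemma NtTP_leaf : cNtTP PLeaf = 0. Proof. by []. Qed.
Lemma NTPt_leaf : cNTPt PLeaf = 0. Proof. by []. Qed.
Lemma NTP_leaf : cNTP PLeaf = 0. Proof. by []. Qed.

(** The product with [Xs] on the right sends [N_t T P] to [N T P_t], since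
    [Ws * Xs = 1]; what remains depends on whether [l] and [r] are leaves. *)
Lemma Xs_eq l r : Xs (PNode l r) = fprec rhs_gam Xs (PNode l r).
Proof.
rewrite fprecE.
have -> : (fun y => rhs_gam (PNode l y)) = fun y =>
   (((geomK - 1) * eps l - cK * cNTPt l + bK * cNTP l) * eps y
  + (cK * eps l - tK * cK * cNTPt l) * cNtTP y) + (- (bK * eps l)) * cNTP y.
  by apply/funext => y; rewrite rhs_gam_node mulNr.
rewrite !fstarDl !fstarZl fstar_1 fstar_NtTP_Xs fstar_NTP_Xs {1 2}/Xs eps_node.
case: l => [|l1 l2]; case: r => [|r1 r2];
  rewrite ?eps_node ?eps_leaf ?NtTP_leaf ?NTPt_leaf ?NTP_leaf ?fstar_leaf ?NTP_leaf.
- rewrite NTPt_Y mulrN tgeomK; ring.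
- have := NTPt_leaf_node r1 r2; set r := PNode r1 r2; cbv zeta => e.
  transitivity (tK * (bK * fstar cNTP cNTPt r) + cK * cNTPt r - bK * cNTP r
    - tK * (geomK - 1) * cNTPt r); first by rewrite e; ring.
  ring.
- have := NTPt_node_leaf l1 l2; cbv zeta => e; rewrite sub0r e; ring.
- have := NTPt_node_node l1 l2 r1 r2; cbv zeta => ->; ring.
Qed.

Lemma Ws_eq l r : Ws (PNode l r) = - fsucc Ws rhs_gam (PNode l r).
Proof.
rewrite fsuccE.
have -> : (fun y => rhs_gam (PNode y r)) = fun y =>
   (((geomK - 1) * eps r + cK * cNtTP r - bK * cNTP r) * eps y
  + (- (cK * eps r) - tK * cK * cNtTP r) * cNTPt y) + (bK * eps r) * cNTP y.
  by apply/funext => y; rewrite rhs_gam_node; ring.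
rewrite !fstarDr !fstarZr fstar1 fstar_Ws_NTPt fstar_Ws_NTP {1 2}/Ws eps_node.
case: l => [|l1 l2]; case: r => [|r1 r2];
  rewrite ?eps_node ?eps_leaf ?NtTP_leaf ?NTPt_leaf ?NTP_leaf ?fstar_leaf ?NTP_leaf.
- rewrite NtTP_Y mulrN tgeomK; ring.
- have := NtTP_leaf_node r1 r2; cbv zeta => e; rewrite add0r e; ring.
- have := NtTP_node_leaf l1 l2; set l := PNode l1 l2; cbv zeta => e.
  transitivity (- (tK * (bK * fstar cNtTP cNTP l)) + cK * cNtTP l - bK * cNTP l
    - tK * (geomK - 1) * cNtTP l); first by rewrite e; ring.
  ring.
- have := NtTP_node_node l1 l2 r1 r2; cbv zeta => ->; ring.
Qed.

(** * The pre-Lie product *)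

Lemma sum_vertex (V : nmodType) T (F : seq nat -> V) :
  \sum_(v : vertex T) F (ssval v) = \sum_(p <- verts T) F p.
Proof.
rewrite -[LHS]big_enum -(big_map (fun v : vertex T => ssval v) xpredT F) /=.
apply: perm_big; apply: uniq_perm.
- by rewrite map_inj_uniq ?enum_uniq //; apply: val_inj.
- exact: verts_uniq.
move=> p; apply/mapP/idP => [[v _ ->]|pT]; first exact: ssval_in.
by exists (vtx pT); rewrite ?mem_enum.
Qed.

Section GraftSum.
Variable V : nmodType.

Definition sum_graftings (h : rtree -> V) (S T : otree) : V :=
  \sum_(p <- verts S) h (\pi (graft S p T)).

Lemma pi_set_nth us j g : (j < size us)%N ->
  \pi (ONode (set_nth leafT us j g)) = bprodR (\pi g) (\pi (ONode (del_nth j us))).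
Proof.
move=> ju; have sj : size (take j us) = j by rewrite size_take ju.
rewrite set_nthE ju -cat1s.
have := @pi_del_nth (take j us ++ [:: g] ++ drop j.+1 us) j.
rewrite size_cat sj /= addnS ltnS leq_addr => /(_ isT) <-.
rewrite nth_cat sj ltnn subnn /del_nth take_size_cat // drop_cat sj ltnNge leqnSn /=.
by rewrite subSn // subnn /= drop0.
Qed.

Lemma sum_graftings_rec h us T :
  sum_graftings h (ONode us) T = h (bprodR (\pi T) (\pi (ONode us)))
   + \sum_(j <- iota 0 (size us))
       sum_graftings (fun B => h (bprodR B (\pi (ONode (del_nth j us))))) (nth leafT us j) T.
Proof.
rewrite /sum_graftings big_cons /= bprodR_pi; congr (_ + _).
rewrite big_flatten /= big_map.
have -> : zip (iota 0 (size us)) [seq verts i | i <- us]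
    = [seq (j, verts (nth leafT us j)) | j <- iota 0 (size us)].
  have {2}-> : us = [seq nth leafT us j | j <- iota 0 (size us)].
    by rewrite -/(mkseq _ _) mkseq_nth.
  rewrite -map_comp; elim: (iota _ _) => //= j s ->; by [].
rewrite big_map big_seq [RHS]big_seq; apply: eq_bigr => j.
rewrite mem_iota /= add0n => ju; rewrite big_map; apply: eq_bigr => p _ /=.
by rewrite pi_set_nth.
Qed.

Lemma nverts_child us j : (j < size us)%N -> (nverts (nth leafT us j) < nverts (ONode us))%N.
Proof.
move=> ju; rewrite nvertsE ltnS sumnE big_map (big_nth leafT) big_mkord.
by rewrite (bigD1 (Ordinal ju)) //= leq_addr.
Qed.

(** By [sum_graftings_rec] the sum is expressed through the branches of [S], and
    isomorphic trees have the same branches up to order. *)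
Lemma sum_graftings_iso h S S' T T' : otree_iso S S' -> otree_iso T T' -> sum_graftings h S T = sum_graftings h S' T'.
Proof.
have [n] := ubnP (nverts S); elim: n S S' T T' h => // n IH [us] [us'] T T' h un e TT'.
have un' : (nverts (ONode us') < n.+1)%N by rewrite -(nverts_iso e).
have declE vs W : (nverts (ONode vs) < n.+1)%N -> otree_iso W T' ->
  \sum_(j <- iota 0 (size vs))
       sum_graftings (fun B => h (bprodR B (\pi (ONode (del_nth j vs))))) (nth leafT vs j) W
  = \sum_(AR <- splits_seq vs) sum_graftings (fun B => h (bprodR B AR.2)) (repr AR.1) T'.
  move=> vn WT; rewrite big_map big_seq [RHS]big_seq; apply: eq_bigr => j.
  rewrite mem_iota /= add0n => jv; apply: IH => //.
    exact: leq_trans (nverts_child jv) _.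
  by rewrite otree_iso_sym repr_iso.
rewrite !sum_graftings_rec (declE us T un TT') (declE us' T' un' (otree_iso_refl T')).
by rewrite (perm_big _ (splits_seq_perm e)) (piP _ _ TT') (piP _ _ e).
Qed.

Lemma sum_graftings_splits h T H :
  sum_graftings h (repr T) (repr H) = h (bprodR H T)
    + \sum_(AR <- splits T) sum_graftings (fun B => h (bprodR B AR.2)) (repr AR.1) (repr H).
Proof.
rewrite /splits; case E: (repr T) => [us]; rewrite sum_graftings_rec -E !reprK; congr (_ + _).
rewrite E /= big_map; apply: eq_bigr => j _; apply: sum_graftings_iso; last exact: otree_iso_refl.
by rewrite otree_iso_sym repr_iso.
Qed.

End GraftSum.

Lemma lin_ext_comp (R : comNzRingType) (A B C : choiceType) (G : B -> {malg R[C]}) (F : A -> {malg R[B]}) x :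
  lin_ext G (lin_ext F x) = lin_ext (fun a => lin_ext G (F a)) x.
Proof.
by rewrite {2 3}/lin_ext linear_sum; apply: eq_bigr => a _; rewrite linearZ.
Qed.

Lemma nverts_graft S p T : p \in verts S -> nverts (graft S p T) = (nverts S + nverts T)%N.
Proof.
elim: p S => [|i p IH] [us].
  by rewrite /= !nvertsE /= addnC.
rewrite mem_verts_cons => /andP[iu pi].
have e : sumn (map nverts us) = (sumn (map nverts (take i us))
    + (nverts (nth leafT us i) + sumn (map nverts (drop i.+1 us))))%N.
  by rewrite -{1}(cat_take_drop i us) (drop_nth leafT iu) map_cat sumn_cat.
rewrite [graft _ _ _]/= !nvertsE set_nthE iu e map_cat sumn_cat /= IH //.
by rewrite addSn -!addnA [(nverts T + _)%N]addnC.
Qed.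

Section PreLieFormula.
Variable R : comNzRingType.
Local Notation pl := (@pl_mul R).
Local Notation treemod := {malg R[rtree]}.

Lemma graft_sumE (S T : rtree) :
  graft_sum R S T = sum_graftings (fun B => << B >> : treemod) (repr S) (repr T).
Proof. exact: (sum_vertex (repr S) (fun p => << \pi (graft (repr S) p (repr T)) >> : treemod)). Qed.

Lemma graft_sum_deg (S T U : rtree) :
  nvertsR U <> (nvertsR S + nvertsR T)%N -> (graft_sum R S T)@_U = 0.
Proof.
move=> ne; rewrite graft_sumE /sum_graftings raddf_sum big_seq big1 // => p pS /=.
rewrite mcoeffU; case: eqP => // eU; case: ne.
by rewrite -eU nvertsR_pi nverts_graft.
Qed.

Definition bprodM : treemod -> treemod -> treemod := bilin (fun A S => << bprodR A S >>).

Lemma pl_UU A B : pl << A >> << B >> = graft_sum R A B.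
Proof. exact: bilinUU. Qed.

Lemma plEr x y : pl x y = lin_ext (fun b => lin_ext (fun a => graft_sum R a b) x) y.
Proof. exact: bilinEr. Qed.

Lemma plEl x y : pl x y = lin_ext (fun a => lin_ext (graft_sum R a) y) x.
Proof. exact: bilinEl. Qed.

Lemma bprodMEr x y : bprodM x y = lin_ext (fun b => lin_ext (fun a => << bprodR a b >>) x) y.
Proof. exact: bilinEr. Qed.

Lemma bprodMEl x y : bprodM x y = lin_ext (fun a => lin_ext (fun b => << bprodR a b >>) y) x.
Proof. exact: bilinEl. Qed.

(** Grafting on [T] acts on the root or inside one of the branches of [T]. *)
Lemma pl_splits T x :
  pl << T >> x = bprodM x << T >> + \sum_(AR <- splits T) bprodM (pl << AR.1 >> x) << AR.2 >>.
Proof.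
rewrite plEl lin_extU bprodMEr lin_extU.
have e AR : bprodM (pl << AR.1 >> x) << AR.2 >>
    = lin_ext (fun b => lin_ext (fun a => << bprodR a AR.2 >>) (graft_sum R AR.1 b)) x.
  by rewrite bprodMEr lin_extU plEl lin_extU lin_ext_comp.
under eq_bigr do rewrite e.
rewrite {1 2}/lin_ext; under [X in _ = _ + X]eq_bigr do rewrite {1}/lin_ext.
rewrite exchange_big -big_split; apply: eq_bigr => b _ /=.
rewrite -scaler_sumr -scalerDr; congr (_ *: _).
rewrite graft_sumE sum_graftings_splits; congr (_ + _); apply: eq_bigr => AR _.
by rewrite graft_sumE linear_sum; apply: eq_bigr => p _; rewrite /= lin_extU.
Qed.

(** * Truncation by the number of vertices *)

(** Used as a congruence: formal series are truncated to trees with at most [n]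
    vertices, and equalities hold up to elements of order [n + 1]. *)
Definition ord_ge d (x : treemod) := forall U, (nvertsR U < d)%N -> x@_U = 0.

Lemma ord_ge_bilin (h : rtree -> rtree -> treemod) d e x y :
  (forall a b U, nvertsR U <> (nvertsR a + nvertsR b)%N -> (h a b)@_U = 0) ->
  ord_ge d x -> ord_ge e y -> ord_ge (d + e) (bilin h x y).
Proof.
move=> hh hx hy U Ude; rewrite /bilin raddf_sum big1 // => a _.
rewrite /= raddf_sum big1 // => b _; rewrite /= mcoeffZ.
case: (ltnP (nvertsR a) d) => [/hx->|da]; first by rewrite !mul0r.
case: (ltnP (nvertsR b) e) => [/hy->|eb]; first by rewrite mulr0 mul0r.
by rewrite hh ?mulr0 //; lia.
Qed.

Lemma ord_ge_pl d e x y : ord_ge d x -> ord_ge e y -> ord_ge (d + e) (pl x y).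
Proof. by apply: ord_ge_bilin; apply: graft_sum_deg. Qed.

Lemma ord_ge_bprodM d e x y : ord_ge d x -> ord_ge e y -> ord_ge (d + e) (bprodM x y).
Proof.
apply: ord_ge_bilin => a b U ne; rewrite mcoeffU; case: eqP => // eU.
by case: ne; rewrite -eU nvertsR_bprodR.
Qed.

Lemma ord_geU T : ord_ge (nvertsR T) << T >>.
Proof. by move=> U UT; rewrite mcoeffU; case: eqP UT => // ->; rewrite ltnn. Qed.

Lemma ord_ge1 x : ord_ge 1 x.
Proof. by move=> U; rewrite ltnS leqn0 => /eqP U0; have := nvertsR_gt0 U; rewrite U0. Qed.

Lemma ord_ge0 x : ord_ge 0 x.
Proof. by []. Qed.

Lemma ord_geN d x : ord_ge d x -> ord_ge d (- x).
Proof. by move=> hx U Ud; rewrite mcoeffN hx // oppr0. Qed.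

End PreLieFormula.

(** * Sums over isomorphism classes of rooted trees *)

Fixpoint short_seqs (T : Type) k (s : seq T) : seq (seq T) :=
  if k is k'.+1 then [::] :: [seq x :: l | x <- s, l <- short_seqs k' s] else [:: [::]].

Lemma mem_short_seqs (T : eqType) k (s l : seq T) :
  (size l <= k)%N -> {subset l <= s} -> l \in short_seqs k s.
Proof.
elim: k l => [|k IH] [|x l] //= lk ls; rewrite inE /=.
apply/allpairsP; exists (x, l); split=> //=; first by rewrite ls ?mem_head.
by apply: IH => // y yl; rewrite ls // inE yl orbT.
Qed.

Fixpoint small_otrees n : seq otree :=
  if n is n'.+1 then [seq ONode ts | ts <- short_seqs n' (small_otrees n')] else [::].

Lemma mem_small_otrees n T : (nverts T <= n)%N -> T \in small_otrees n.
Proof.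
elim: n T => [|n IH] [ts]; rewrite nvertsE // ltnS => tsn.
apply/map_f/mem_short_seqs.
  apply: leq_trans tsn; elim: ts => //= t ts IHts.
  by rewrite -add1n leq_add // nverts_gt0.
move=> t tts; apply: IH; apply: leq_trans tsn.
by rewrite sumnE big_map (big_rem t) //= leq_addr.
Qed.

Definition small_rtrees n : seq rtree := undup [seq \pi T | T <- small_otrees n & (nverts T <= n)%N].

Lemma small_rtrees_uniq n : uniq (small_rtrees n).
Proof. exact: undup_uniq. Qed.

Lemma mem_small_rtrees n T : (T \in small_rtrees n) = (nvertsR T <= n)%N.
Proof.
rewrite mem_undup; apply/mapP/idP => [[U]|Tn].
  by rewrite mem_filter => /andP[Un _] ->; rewrite nvertsR_pi.
by exists (repr T); rewrite ?reprK // mem_filter Tn mem_small_otrees.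
Qed.

Lemma nvertsR_split A S T : (A, S) \in splits T -> (nvertsR A + nvertsR S = nvertsR T)%N.
Proof. by move=> /splits_bprodR <-; rewrite nvertsR_bprodR. Qed.

Lemma sum_uniq1 (V : nmodType) (I : eqType) (L : seq I) (F : I -> V) i :
  uniq L -> i \in L -> \sum_(k <- L) F k *+ (k == i) = F i.
Proof.
move=> LU iL; rewrite (bigD1_seq i) //= eqxx mulr1n big1 ?addr0 // => k /negbTE->.
by rewrite mulr0n.
Qed.

Lemma sum_count_pairs (V : nmodType) (I : eqType) (L : seq I) (F : I -> I -> V)
    (s : seq (I * I)) : uniq L -> (forall x, x \in s -> (x.1 \in L) && (x.2 \in L)) ->
  \sum_(x <- s) F x.1 x.2 = \sum_(a <- L) \sum_(b <- L) F a b *+ count_mem (a, b) s.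
Proof.
move=> LU; elim: s => [|[a b] s IH] sL.
  by rewrite big_nil big1 // => a _; rewrite big1.
rewrite big_cons IH => [|x xs]; last by apply: sL; rewrite inE xs orbT.
have /andP[/= aL bL] := sL (a, b) (mem_head _ _).
rewrite -{1}(sum_uniq1 (fun a => F a b) LU aL) -big_split /=; apply: eq_bigr => a' _.
rewrite -{1}(sum_uniq1 (F a') LU bL) -sumrMnl -big_split /=; apply: eq_bigr => b' _.
by rewrite xpair_eqE mulrnDr -mulrnA mulnb [a == _]eq_sym [b == _]eq_sym andbC.
Qed.

Section ClassSums.
Variables (R : comNzRingType) (iaut g z : rtree -> R) (n : nat).
Hypothesis iautE : forall T, iaut T * (autR T)%:R = 1.
Hypothesis zE : forall A S T, (A, S) \in splits T -> z T = g A * z S.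

Local Notation treemod := {malg R[rtree]}.
Local Notation pl := (@pl_mul R).

(** Counting isomorphisms: there are [aut T / (aut A * aut S)] ways of splitting
    off a branch in the class [A] from [T], with rest in the class [S]. *)
Lemma sum_splits (F : rtree -> rtree -> treemod) :
  \sum_(T <- small_rtrees n) iaut T *: \sum_(AS <- splits T) F AS.1 AS.2 =
  \sum_(A <- small_rtrees n) \sum_(S <- small_rtrees n)
    (iaut A * iaut S) *: F A S *+ (nvertsR A + nvertsR S <= n)%N.
Proof.
transitivity (\sum_(T <- small_rtrees n) \sum_(A <- small_rtrees n) \sum_(S <- small_rtrees n)
    (iaut A * iaut S) *: F A S *+ (T == bprodR A S)).
  rewrite big_seq [RHS]big_seq; apply: eq_bigr => T; rewrite mem_small_rtrees => Tn.
  rewrite (sum_count_pairs _ (small_rtrees_uniq n)) => [|[A S] /nvertsR_split e]; last first.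
    by rewrite !mem_small_rtrees; apply/andP; split; apply: leq_trans Tn; rewrite -e ?leq_addl ?leq_addr.
  rewrite scaler_sumr; apply: eq_bigr => A _; rewrite scaler_sumr; apply: eq_bigr => S _.
  rewrite -!scaler_nat !scalerA; congr (_ *: _).
  have := congr1 (fun k : nat => k%:R : R) (count_splits A S T); rewrite !natrM => e.
  have -> : iaut T * (count_mem (A, S) (splits T))%:R
     = iaut T * ((count_mem (A, S) (splits T))%:R * ((autR A)%:R * (autR S)%:R))
       * (iaut A * iaut S).
    transitivity (iaut T * (count_mem (A, S) (splits T))%:R
       * (iaut A * (autR A)%:R) * (iaut S * (autR S)%:R)); last by ring.
    by rewrite !iautE !mulr1.
  by rewrite e eq_sym [iaut T * _]mulrA iautE mul1r mulrC.
rewrite exchange_big; apply: eq_bigr => A _; rewrite exchange_big; apply: eq_bigr => S _.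
case: leqP => AS /=; last first.
  rewrite mulr0n big_seq big1 // => T; rewrite mem_small_rtrees => Tn.
  by case: eqP => // e; move: Tn; rewrite e nvertsR_bprodR leqNgt AS.
rewrite (sum_uniq1 (fun=> (iaut A * iaut S) *: F A S)) ?small_rtrees_uniq ?mulr1n //.
by rewrite mem_small_rtrees nvertsR_bprodR.
Qed.

Definition wsum (a : rtree -> R) : treemod := \sum_(T <- small_rtrees n) (iaut T * a T) *: << T >>.

Definition euler_wsum (a : rtree -> R) : treemod :=
  \sum_(T <- small_rtrees n) ((iaut T * a T) * (nvertsR T)%:R) *: << T >>.

Local Notation Sn := (wsum z).
Local Notation Gn := (wsum g).
Local Notation NSn := (euler_wsum z).
Local Notation NGn := (euler_wsum g).

(** The weight [z] is multiplicative over branches, with [g] the weight of a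
    branch; this is where the exponential in [S = B_+ (exp G)] comes from. *)
Lemma sum_splits_low (F : rtree -> rtree -> treemod) U :
  (forall A S, ord_ge (nvertsR A + nvertsR S) (F A S)) -> (nvertsR U <= n)%N ->
  (\sum_(T <- small_rtrees n) (iaut T * z T) *: \sum_(AS <- splits T) F AS.1 AS.2)@_U =
  (\sum_(A <- small_rtrees n) \sum_(S <- small_rtrees n)
    ((iaut A * g A) * (iaut S * z S)) *: F A S)@_U.
Proof.
move=> Fge Un.
have -> : \sum_(T <- small_rtrees n) (iaut T * z T) *: \sum_(AS <- splits T) F AS.1 AS.2 =
    \sum_(T <- small_rtrees n) iaut T *: \sum_(AS <- splits T) (g AS.1 * z AS.2) *: F AS.1 AS.2.
  apply: eq_bigr => T _; rewrite -scalerA; congr (_ *: _); rewrite scaler_sumr.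
  rewrite big_seq [RHS]big_seq; apply: eq_bigr => -[A S] AS.
  by rewrite (zE AS).
rewrite (sum_splits (fun A S => (g A * z S) *: F A S)) !raddf_sum; apply: eq_bigr => A _.
rewrite /= !raddf_sum; apply: eq_bigr => S _ /=.
rewrite mcoeffMn !mcoeffZ; case: leqP => AS.
  by rewrite mulr1n !mulrA; congr (_ * _); ring.
by rewrite Fge ?mulr0 ?mul0rn //; apply: leq_ltn_trans AS.
Qed.

Lemma pl_suml (I : Type) (s : seq I) (c : I -> R) (y : I -> treemod) x :
  pl (\sum_(i <- s) c i *: y i) x = \sum_(i <- s) c i *: pl (y i) x.
Proof.
rewrite plEl linear_sum; apply: eq_bigr => i _.
by rewrite linearZ plEl.
Qed.

Lemma bprodM_suml (I : Type) (s : seq I) (c : I -> R) (y : I -> treemod) x :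
  bprodM (\sum_(i <- s) c i *: y i) x = \sum_(i <- s) c i *: bprodM (y i) x.
Proof.
rewrite bprodMEl linear_sum; apply: eq_bigr => i _.
by rewrite linearZ bprodMEl.
Qed.

Lemma bprodM_sumr (I : Type) (s : seq I) (c : I -> R) (y : I -> treemod) x :
  bprodM x (\sum_(i <- s) c i *: y i) = \sum_(i <- s) c i *: bprodM x (y i).
Proof.
rewrite bprodMEr linear_sum; apply: eq_bigr => i _.
by rewrite linearZ bprodMEr.
Qed.

Lemma bprodM_addl (x y u : treemod) : bprodM (x + y) u = bprodM x u + bprodM y u.
Proof. by rewrite !bprodMEl linearD. Qed.

Lemma plBr (x y u : treemod) : pl u (x - y) = pl u x - pl u y.
Proof. by rewrite !plEr linearB. Qed.

(** Grafting on [S = B_+(exp G)] acts on the root or on one factor [G]. *)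
Lemma pl_wsum H U : (nvertsR U <= n)%N ->
  (pl Sn H)@_U = (bprodM H Sn + bprodM (pl Gn H) Sn)@_U.
Proof.
move=> Un; rewrite /wsum pl_suml.
under eq_bigr do rewrite pl_splits scalerDr.
rewrite big_split /= -bprodM_sumr !mcoeffD; congr (_ + _).
rewrite (sum_splits_low (F := fun A S => bprodM (pl << A >> H) << S >>)) //; last first.
  move=> A S; apply: ord_ge_bprodM (@ord_geU _ S); rewrite -[nvertsR A]addn0.
  exact: ord_ge_pl (@ord_geU _ A) (@ord_ge0 _ H).
congr (_ @_ _); rewrite pl_suml bprodM_suml; apply: eq_bigr => A _.
by rewrite bprodM_sumr scaler_sumr; apply: eq_bigr => S _; rewrite scalerA.
Qed.

(** Counting the vertices of a tree branch by branch. *)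
Lemma euler_wsum_branches U : (nvertsR U <= n)%N -> NSn@_U = (Sn + bprodM NGn Sn)@_U.
Proof.
move=> Un.
have -> : NSn = Sn + \sum_(T <- small_rtrees n) (iaut T * z T) *:
    \sum_(AS <- splits T) (nvertsR AS.1)%:R *: << bprodR AS.1 AS.2 >>.
  rewrite /euler_wsum /wsum -big_split; apply: eq_bigr => T _ /=.
  rewrite -scalerA nvertsR_splits -addn1 natrD scalerDl scale1r scalerDr addrC; congr (_ + _ *: _).
  rewrite natr_sum scaler_suml; congr (_ *: _); apply: eq_big_seq => -[A S] AS /=.
  by rewrite (splits_bprodR AS).
rewrite !mcoeffD; congr (_ + _).
rewrite (sum_splits_low (F := fun A S => (nvertsR A)%:R *: << bprodR A S >>)) //; last first.
  move=> A S V VAS; rewrite mcoeffZ (@ord_geU _ (bprodR A S)) ?mulr0 //.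
  by rewrite nvertsR_bprodR.
congr (_ @_ _); rewrite bprodM_suml; apply: eq_bigr => A _.
rewrite bprodM_sumr scaler_sumr; apply: eq_bigr => S _.
rewrite /bprodM bilinUU !scalerA; congr (_ *: _); ring.
Qed.

(** Fixed point iteration for [H' = H - (G <- H')]: as [G] has order at least 1,
    each step increases the order of the error. *)
Lemma solve_pl k d H : ord_ge d H -> (n < d + k)%N ->
  exists H', ord_ge n.+1 (H - (H' + pl Gn H')).
Proof.
elim: k d H => [|k IH] d H Hd nd.
  exists 0 => U Un; rewrite plEr linear0 addr0 subr0.
  by apply: Hd; apply: leq_trans Un _; rewrite -[d]addn0.
have [|H'' hH] := IH d.+1 (pl Gn H) _ ltac:(by rewrite addSnnS).
  by rewrite -add1n; apply: ord_ge_pl => //; apply: ord_ge1.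
exists (H - H''); rewrite plBr.
have -> : H - (H - H'' + (pl Gn H - pl Gn H'')) = - (pl Gn H - (H'' + pl Gn H'')).
  by rewrite opprD addrA subKr !opprB addrA.
exact: ord_geN.
Qed.

(** The right hand side [H + (G <- H)] is what makes [euler_wsum_branches] and
    [pl_wsum] combine into a single grafting. *)
Lemma euler_graft : exists H,
  (forall U, (nvertsR U <= n)%N -> NGn@_U = (H + pl Gn H)@_U) /\
  (forall U, (nvertsR U <= n)%N -> NSn@_U = (Sn + pl Sn H)@_U).
Proof.
have [H hH] := @solve_pl n 1 NGn (@ord_ge1 _ _) ltac:(by rewrite add1n).
exists H; split=> U Un.
  by apply/eqP; rewrite -subr_eq0 -mcoeffB hH.
rewrite euler_wsum_branches // !mcoeffD pl_wsum //; congr (_ + _).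
rewrite -[in LHS](subrK (H + pl Gn H) NGn) bprodM_addl bprodM_addl mcoeffD -[RHS]add0r; congr (_ + _).
by rewrite (ord_ge_bprodM hH (@ord_ge0 _ Sn)) // addn0.
Qed.
End ClassSums.

(** * The image of the flow series *)

(** The recursions express these series through the branches, which isomorphic
    trees share up to order. *)
Lemma inert_series_iso d S S' : otree_iso S S' -> inert_series d S = inert_series d S'.
Proof.
have [n] := ubnP (nverts S); elim: n S S' => // n IH [us] [us'] un e.
have un' : (nverts (ONode us') < n.+1)%N by rewrite -(nverts_iso e).
have mE T T' : (nverts T < n)%N -> otree_iso T T' -> flow_ge_series d T = flow_ge_series d T'.
  by move=> Tn TT'; apply: tK_inj; rewrite !flow_ge_seriesE (IH _ _ Tn TT').
have declE vs : (nverts (ONode vs) < n.+1)%N ->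
    inert_series d (ONode vs) = \prod_(AS <- splits_seq vs) drop_below d (flow_ge_series d (repr AS.1)).
  move=> vn; rewrite inert_seriesE (big_nth leafT) big_map -iota0E big_seq [RHS]big_seq.
  apply: eq_bigr => j; rewrite mem_iota /= add0n => jv; congr drop_below.
  apply: mE; first exact: leq_trans (nverts_child jv) _.
  by rewrite otree_iso_sym repr_iso.
by rewrite !declE // (perm_big _ (splits_seq_perm e)).
Qed.

Definition iautK (T : rtree) : K := ratK (autR T)%:R^-1.
Definition inertK (T : rtree) : K := inert_series 1 (repr T).
(** The branches at the root of a connected flow are connected flows of positive
    exit rate. *)
Definition posK (T : rtree) : K := drop_below 1 (flow_ge_series 1 (repr T)).

Lemma iautKE T : iautK T * (autR T)%:R = 1.
Proof. exact/ratK_mulVn/autR_gt0. Qed.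

Lemma inertK_splits A S T : (A, S) \in splits T -> inertK T = posK A * inertK S.
Proof.
move=> /splits_bprodR <-; rewrite /inertK (inert_series_iso 1 (repr_iso _)) inert_series_cons.
by congr (_ * inert_series _ _); case: (repr S).
Qed.

Lemma inertK_bullet : inertK bullet = 1.
Proof. by rewrite /inertK (inert_series_iso 1 (repr_iso leafT)) inert_series_leaf. Qed.

Lemma autR_bullet : autR bullet = 1%N.
Proof.
rewrite autR_pi; apply/eqP; rewrite eqn_leq aut_gt0 andbT.
have vr (v : vertex leafT) : v = Defs.root leafT.
  by apply: val_inj; case: v => p /=; rewrite inE => /eqP.
rewrite -(card1 [ffun v : vertex leafT => v]); apply/subset_leq_card/fintype.subsetP => f _.
by rewrite inE; apply/eqP/ffunP => v; rewrite ffunE (vr (f v)) (vr v).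
Qed.

Lemma iautK_bullet : iautK bullet = 1.
Proof. by rewrite -[LHS]mulr1 -[X in _ * X](_ : (autR bullet)%:R = 1) ?iautKE // autR_bullet. Qed.

Lemma connected_flowsE T : connected_flows T = iautK T * flow_ge_series 1 (repr T).
Proof. by rewrite /connected_flows cflow_seriesE. Qed.

Lemma at_t0_inertK T : at_t0 (inertK T) = (T == bullet)%:R.
Proof.
case E: (splits T) => [|[A S] s].
  by rewrite (splits_nil E) inertK_bullet rmorph1 eqxx.
rewrite (_ : T == bullet = false); last first.
  by apply/eqP => Tb; rewrite Tb splits_bullet in E.
rewrite (@inertK_splits A S) ?E ?mem_head // rmorphM /= /posK drop_below1 rmorphB /= at_t0_idem.
by rewrite subrr mul0r.
Qed.

Lemma posKE T : iautK T * posK T = connected_flows T - at_t0 (connected_flows T).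
Proof.
by rewrite connected_flowsE /posK drop_below1 mulrBr rmorphM /= /iautK at_t0_ratK.
Qed.

Lemma tK_connected_flows T :
  tK * connected_flows T = cK * (iautK T * inertK T) - bK * (T == bullet)%:R.
Proof.
rewrite connected_flowsE mulrCA flow_ge_seriesE mulrBr -/(inertK T) at_t0_inertK mulrCA; congr (_ - _).
case: eqP => [->|_]; last by rewrite !mulr0.
by rewrite iautK_bullet mul1r.
Qed.

Lemma nvertsR_eq1 T : nvertsR T = 1%N -> T = bullet.
Proof.
rewrite nvertsR_splits => -[h]; apply: splits_nil; case: (splits T) h => // AS s.
by rewrite big_cons; have := nvertsR_gt0 AS.1; case: (nvertsR _).
Qed.

(** Absence of [t] is needed because [phi] is linear over the coefficient ring
    but the evaluation at [t = 0] is not: the two only commute on such series. *)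
Definition homog_tfree d (f : tseries) :=
  forall x, at_t0 (f x) = f x /\ (tsize x != d -> f x = 0).

Lemma homog_tfreeB d f g : homog_tfree d f -> homog_tfree d g -> homog_tfree d (fun x => f x - g x).
Proof.
move=> hf hg x; have [f1 f2] := hf x; have [g1 g2] := hg x; split.
  by rewrite rmorphB /= f1 g1.
by move=> xd; rewrite f2 // g2 // subrr.
Qed.

Lemma homog_tfree_sum d (I : eqType) (s : seq I) (f : I -> tseries) :
  (forall i, i \in s -> homog_tfree d (f i)) -> homog_tfree d (fun x => \sum_(i <- s) f i x).
Proof.
move=> hf x; split.
  rewrite rmorph_sum; apply: eq_big_seq => i /hf /(_ x) [e _]; exact: e.
by move=> xd; rewrite big_seq big1 // => i /hf /(_ x) [_ ->].
Qed.

Lemma homog_tfree_cuts d e f g l r (s : seq (pbt * pbt)) :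
  homog_tfree d f -> homog_tfree e g -> (forall c, c \in s -> (tsize c.1 + tsize c.2 = (tsize l + tsize r).+1)%N) ->
  at_t0 (\sum_(c <- s) f c.1 * g c.2) = \sum_(c <- s) f c.1 * g c.2 /\
  ((tsize l + tsize r).+1 != (d + e)%N -> \sum_(c <- s) f c.1 * g c.2 = 0).
Proof.
move=> hf hg hs; split.
  by rewrite rmorph_sum; apply: eq_bigr => c _; rewrite rmorphM /= (hf _).1 (hg _).1.
move=> ne; rewrite big_seq big1 // => c /hs cs.
case: (eqVneq (tsize c.1) d) => [cd|/(hf _).2->]; last by rewrite mul0r.
case: (eqVneq (tsize c.2) e) => [ce|/(hg _).2->]; last by rewrite mulr0.
by move: ne; rewrite -cs cd ce eqxx.
Qed.

Lemma homog_tfree_pl d e f g : homog_tfree d f -> homog_tfree e g ->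
  homog_tfree (d + e) (fun x => fsucc g f x - fprec f g x).
Proof.
move=> hf hg; apply: homog_tfreeB => -[|l r]; try by rewrite /= rmorph0.
  have := @homog_tfree_cuts e d g f l r (succs (PNode l r)) hg hf.
  rewrite big_map [(e + d)%N]addnC => h; apply: h => _ /mapP[c /tsize_cuts <- ->] /=.
  by rewrite addnS addnA.
have := @homog_tfree_cuts d e f g l r (precs (PNode l r)) hf hg.
rewrite big_map => h; apply: h => _ /mapP[c /tsize_cuts <- ->] /=.
by rewrite addSn addnA.
Qed.

Lemma bprodR_pl (R : comNzRingType) A S : (<< bprodR A S >> : {malg R[rtree]}) =
  pl_mul << S >> << A >>
  - \sum_(CD <- splits S) sum_graftings (fun B => << bprodR B CD.2 >>) (repr CD.1) (repr A).
Proof. by rewrite pl_UU graft_sumE sum_graftings_splits addrK. Qed.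

Section Image.
Variable phi : {linear {malg K[rtree]} -> {malg K[pbt]}}.
Hypothesis phi_morph : forall x y, phi (pl_mul x y) = dend_pl_mul (phi x) (phi y).
Hypothesis phi_bullet : phi << bullet >> = << Ytree >>.

Definition phiT (T : rtree) : tseries := coords (phi << T >>).

Lemma phiT_bullet x : phiT bullet x = tree_s Ytree x.
Proof.
rewrite /phiT phi_bullet /coords mcoeffU /tree_s eq_sym; by case: eqP.
Qed.

Lemma phi_pl x y : coords (phi (pl_mul x y)) =
  fun w => fsucc (coords (phi y)) (coords (phi x)) w - fprec (coords (phi x)) (coords (phi y)) w.
Proof. by apply/funext => w; rewrite phi_morph; apply: dend_pl_coef. Qed.

Lemma phiT_bprodR A S : phiT (bprodR A S) = fun w =>
  (fsucc (phiT A) (phiT S) w - fprec (phiT S) (phiT A) w)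
  - \sum_(CD <- splits S) \sum_(p <- verts (repr CD.1))
      phiT (bprodR (\pi (graft (repr CD.1) p (repr A))) CD.2) w.
Proof.
apply/funext => w; rewrite {1}/phiT bprodR_pl linearB /coords mcoeffB.
have := congr1 (fun f => f w) (phi_pl << S >> << A >>); rewrite {1}/coords => ->.
congr (_ - _); rewrite linear_sum raddf_sum; apply: eq_bigr => CD _.
by rewrite /sum_graftings /= linear_sum raddf_sum.
Qed.

(** The pre-Lie algebra is generated by the one-vertex tree: [bprodR A S] is the
    grafting of [A] on [S], up to trees of the same size whose root has fewer
    children. *)
Lemma phiT_homog_tfree T : homog_tfree (nvertsR T) (phiT T).
Proof.
have [n] := ubnP (nvertsR T); elim: n T => // n IHn T.
have [m] := ubnP (size (splits T)); elim: m T => // m IHm T Tm Tn.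
case E: (splits T) => [|[A S] s].
  rewrite (splits_nil E) nvertsR_bullet => x; rewrite phiT_bullet /tree_s.
  case: eqP => [->|_]; first by rewrite rmorph1.
  by rewrite rmorph0.
have TE : T = bprodR A S by rewrite (@splits_bprodR A S T) // E mem_head.
have TAS : nvertsR T = (nvertsR A + nvertsR S)%N by rewrite TE nvertsR_bprodR.
have An := nvertsR_gt0 A; have Sn := nvertsR_gt0 S.
rewrite {2}TE phiT_bprodR; apply: homog_tfreeB.
  by rewrite TAS addnC; apply: homog_tfree_pl; apply: IHn; lia.
apply: homog_tfree_sum => -[C D] CD; apply: homog_tfree_sum => p pC /=.
have SE := splits_bprodR CD.
have e : nvertsR (bprodR (\pi (graft (repr C) p (repr A))) D) = nvertsR T.
  rewrite nvertsR_bprodR nvertsR_pi nverts_graft // TAS -SE nvertsR_bprodR -/(nvertsR C) -/(nvertsR A).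
  by rewrite [(nvertsR C + nvertsR A)%N]addnC addnA.
rewrite -e; apply: IHm; last by rewrite e.
by rewrite size_splits_bprodR -(size_splits_bprodR C) SE; move: Tm; rewrite TE size_splits_bprodR.
Qed.

Lemma phiT_at_t0 T x : at_t0 (phiT T x) = phiT T x.
Proof. by have [] := phiT_homog_tfree T x. Qed.

Lemma phiT_size T x : tsize x != nvertsR T -> phiT T x = 0.
Proof. by have [] := phiT_homog_tfree T x. Qed.

Lemma phi_sum (I : Type) (s : seq I) (c : I -> K) (y : I -> rtree) x :
  (phi (\sum_(i <- s) c i *: << y i >>))@_x = \sum_(i <- s) c i * phiT (y i) x.
Proof.
rewrite linear_sum raddf_sum; apply: eq_bigr => i _.
by rewrite /= linearZ mcoeffZ.
Qed.

Lemma malgE_scale (R : comNzRingType) (A : choiceType) (x : {malg R[A]}) :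
  x = \sum_(a <- msupp x) x@_a *: << a >>.
Proof.
rewrite {1}[x]monalgE; apply: eq_bigr => a _; apply/malgP => k.
by rewrite mcoeffZ !mcoeffU; case: eqP; rewrite ?mulr1 ?mulr0.
Qed.

Lemma phi_low n x y w : (forall U, (nvertsR U <= n)%N -> x@_U = y@_U) -> (tsize w <= n)%N ->
  (phi x)@_w = (phi y)@_w.
Proof.
move=> xy wn; apply/eqP; rewrite -subr_eq0 -mcoeffB -linearB /=; apply/eqP.
rewrite [x - y]malgE_scale phi_sum big1 // => U _.
case: (eqVneq (tsize w) (nvertsR U)) => [e|/phiT_size->]; last by rewrite mulr0.
by rewrite mcoeffB xy ?subrr ?mul0r // -e.
Qed.
End Image.

Section Main.
Variable phi : {linear {malg K[rtree]} -> {malg K[pbt]}}.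
Hypothesis phi_morph : forall x y, phi (pl_mul x y) = dend_pl_mul (phi x) (phi y).
Hypothesis phi_bullet : phi << bullet >> = << Ytree >>.

Local Notation phiT := (phiT phi).
Local Notation Ec := (extend_to_series phi connected_flows).
Local Notation SK n := (wsum iautK n inertK).
Local Notation GK n := (wsum iautK n posK).

Let phiT_size := phiT_size phi_morph phi_bullet.
Let phiT_at_t0 := phiT_at_t0 phi_morph phi_bullet.

Lemma extend_to_seriesE s n x : (tsize x <= n)%N ->
  extend_to_series phi s x = \sum_(T <- small_rtrees n) s T * phiT T x.
Proof.
move=> xn; rewrite /extend_to_series.
rewrite -(fsbig_widen [set` small_rtrees n]%classic setT) //; first by rewrite -fsbig_seq ?small_rtrees_uniq.
move=> T [_ /= /negP]; rewrite mem_small_rtrees -ltnNge => nT.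
by rewrite -[_@__]/(phiT T x) phiT_size ?mulr0 //; apply: contraL nT => /eqP <-; rewrite -leqNgt.
Qed.

Lemma phi_wsum_posK n x : (tsize x <= n)%N -> (phi (GK n))@_x = Ec x - at_t0 (Ec x).
Proof.
move=> xn; rewrite (extend_to_seriesE _ xn) rmorph_sum /= -sumrB /wsum phi_sum.
by apply: eq_bigr => T _; rewrite rmorphM /= phiT_at_t0 -mulrBl posKE.
Qed.

(** The recursion at the root, applied to every tree. *)
Lemma tK_Ec n x : (0 < n)%N -> (tsize x <= n)%N ->
  tK * Ec x = cK * (phi (SK n))@_x - bK * tree_s Ytree x.
Proof.
move=> n0 xn; rewrite (extend_to_seriesE _ xn) /wsum phi_sum.
have -> : tree_s Ytree x = \sum_(T <- small_rtrees n) (T == bullet)%:R * phiT T x.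
  rewrite -(phiT_bullet phi_bullet) -(sum_uniq1 (phiT^~ x) (small_rtrees_uniq n) (_ : bullet \in _)).
    by apply: eq_bigr => T _; rewrite mulr_natl.
  by rewrite mem_small_rtrees nvertsR_bullet.
rewrite !mulr_sumr -sumrB; apply: eq_bigr => T _.
transitivity (tK * connected_flows T * phiT T x); first exact: mulrA.
rewrite tK_connected_flows /=; ring.
Qed.

Lemma phi_wsum_inertK_leaf n : (phi (SK n))@_PLeaf = 0.
Proof.
rewrite /wsum phi_sum big1 // => T _; rewrite phiT_size ?mulr0 //=.
by have := nvertsR_gt0 T; case: (nvertsR T).
Qed.

Lemma phi_wsum_inertK_Y n : (0 < n)%N -> (phi (SK n))@_Ytree = 1.
Proof.
move=> n0; rewrite /wsum phi_sum (bigD1_seq bullet) ?small_rtrees_uniq ?mem_small_rtrees ?nvertsR_bullet //=.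
rewrite (phiT_bullet phi_bullet) iautK_bullet inertK_bullet /tree_s eqxx !mulr1 big1 ?addr0 // => T Tb.
rewrite phiT_size ?mulr0 //=; apply: contra Tb => /eqP/esym/nvertsR_eq1 ->.
exact: eqxx.
Qed.

Lemma phi_euler (a : rtree -> K) n x :
  (phi (euler_wsum iautK n a))@_x = (tsize x)%:R * (phi (wsum iautK n a))@_x.
Proof.
have e1 : (phi (euler_wsum iautK n a))@_x
    = \sum_(T <- small_rtrees n) iautK T * a T * (nvertsR T)%:R * phiT T x by exact: phi_sum.
have e2 : (phi (wsum iautK n a))@_x = \sum_(T <- small_rtrees n) iautK T * a T * phiT T x.
  by exact: phi_sum.
apply: (etrans e1); apply/esym/(etrans (congr1 (fun k => (tsize x)%:R * k) e2)).
rewrite mulr_sumr; apply: eq_bigr => T _; case: (eqVneq (tsize x) (nvertsR T)) => [->|/phiT_size e]; last by rewrite e !mulr0.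
by ring.
Qed.

Lemma Ec_leaf : Ec PLeaf = 0.
Proof.
rewrite (@extend_to_seriesE _ 0) // big1 // => T _; rewrite phiT_size ?mulr0 //=.
by have := nvertsR_gt0 T; case: (nvertsR T).
Qed.

(** If the formula holds in sizes at most [m], then [phi G] agrees with [rhs_gam]
    there, which is all that [exp_unique] needs to give [phi S] in sizes at most
    [m + 1]; the recursion at the root then gives the formula in these sizes. *)
Lemma Ec_formula x : Ec x = rhs_s x.
Proof.
suff h m : forall y, (tsize y <= m)%N -> Ec y = rhs_s y by apply: (h (tsize x)).
elim: m => [|m IH] y ym.
  have -> : y = PLeaf by case: y ym.
  by rewrite Ec_leaf /rhs_s /= /tree_s /=; ring.
have gamE u : (tsize u <= m)%N -> (phi (GK m.+1))@_u = rhs_gam u.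
  by move=> um; rewrite phi_wsum_posK ?IH //; apply: leqW.
have [H [hG hS]] := euler_graft m.+1 iautKE inertK_splits.
pose q := coords (phi H).
have qE u : (tsize u <= m)%N ->
    (tsize u)%:R * rhs_gam u = q u + fsucc q rhs_gam u - fprec rhs_gam q u.
  move=> um; rewrite -gamE // -phi_euler.
  have -> : (phi (euler_wsum iautK m.+1 posK))@_u = (phi (H + pl_mul (GK m.+1) H))@_u.
    by apply: (phi_low phi_morph phi_bullet hG); apply: leqW.
  rewrite linearD mcoeffD -[X in _ + X = _]/(coords (phi (pl_mul (GK m.+1) H)) u).
  rewrite (phi_pl phi_morph) -addrA; congr (_ + (_ - _)).
    case: u um => // l r um; rewrite /=; apply: eq_big_seq => c /tsize_cuts cl.
    congr (_ * _); apply: gamE; apply: leq_trans um.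
    by rewrite /= ltnS leq_add2r -cl leq_addl.
  case: u um => // l r um; rewrite /=; apply: eq_big_seq => c /tsize_cuts cl.
  congr (_ * _); apply: gamE; apply: leq_trans um.
  by rewrite /= ltnS leq_add2l -cl leq_addr.
have ZE u : (tsize u <= m.+1)%N -> (tsize u)%:R * coords (phi (SK m.+1)) u =
    coords (phi (SK m.+1)) u + fsucc q (coords (phi (SK m.+1))) u - fprec (coords (phi (SK m.+1))) q u.
  move=> um; rewrite {1}/coords -phi_euler.
  have -> : (phi (euler_wsum iautK m.+1 inertK))@_u = (phi (SK m.+1 + pl_mul (SK m.+1) H))@_u.
    exact: (phi_low phi_morph phi_bullet hS).
  rewrite linearD mcoeffD -[X in _ + X = _]/(coords (phi (pl_mul (SK m.+1) H)) u).
  by rewrite (phi_pl phi_morph) addrA.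
apply: tK_inj; rewrite (@tK_Ec m.+1) // tK_rhs_s; congr (_ * _ - _).
apply: (exp_unique (n := m) (gam := rhs_gam) (q := q) _ _ Xs_eq Ws_eq qE _ _ ZE) => //.
- by rewrite /Xs NTPt_leaf mulr0 subr0.
- by rewrite /Ws NtTP_leaf mulr0 addr0.
- exact: phi_wsum_inertK_leaf.
- exact: phi_wsum_inertK_Y.
Qed.

End Main.

Unset Implicit Arguments.

Theorem proposition6p6
  (phi : {linear {malg K[rtree]} -> {malg K[pbt]}})
  (phi_Dend : forall x, in_Dend (phi x))
  (phi_morph : forall x y, phi (pl_mul x y) = dend_pl_mul (phi x) (phi y))
  (phi_bullet : phi << bullet >> = << Ytree >>)
  (x : pbt) :
  let NtTP := canopy_s (wmul (wmul Nt_s T_s) P_s) in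
  let NTPt := canopy_s (wmul (wmul N_s T_s) Pt_s) in
  let one := tree_s PLeaf in
  let c := tK * geomK + bK in
  extend_to_series phi connected_flows x =
    geomK * tree_s Ytree x
    + c * vee_s one NtTP x
    - c * vee_s NTPt one x
    - tK * c * vee_s NTPt NtTP x.
Proof. exact: Ec_formula. Qed.
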